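(* Let $n\ge 3$ and let $a,b$ be real numbers with $a<n$, $b<n$. Let $\mathbf X$ be an i.i.d. sample of size $n$ from the bivariate normal distribution with parameters $(\mu_1,\mu_2,\sigma_1,\sigma_2,\rho)$, and use the prior $\pi_{ab}$. Let $\psi(y)=y/\sqrt{1+y^2}$ and, with the data $\mathbf X$ (hence $r$) held fixed, let $$Y^*=-\frac{Z_3^*}{\sqrt{\chi^{2*}_{n-a}}}+\frac{\sqrt{\chi^{2*}_{n-b}}}{\sqrt{\chi^{2*}_{n-a}}}\,\frac{r}{\sqrt{1-r^2}} .$$ (a) For every $\alpha\in(0,1)$, the posterior $1-\alpha$ quantile of $\rho$ given $\mathbf X$ is $\rho^*_{1-\alpha}=\psi(Y^*_{1-\alpha})$, where $Y^*_{1-\alpha}$ is the $1-\alpha$ quantile of $Y^*$. (b) For every $\alpha\in(0,1)$, every $\boldsymbol\xi=(\mu_1,\mu_2,\sigma_1,\sigma_2)$ and every $\rho\in(-1,1)$, the frequentist coverage satisfies $$P(\rho<\rho^*_{1-\alpha}\mid\boldsymbol\xi,\rho)=P\left(\frac{\sqrt{1-\rho^2}\,Z_3+\rho\sqrt{\chi^2_{n-1}}}{\sqrt{\chi^2_{n-2}}}>\left(\frac{\sqrt{1-\rho^2}\,Z_3^*+\rho\sqrt{\chi^{2*}_{n-a}}}{\sqrt{\chi^{2*}_{n-b}}}\right)_{\alpha}\ \Big|\ \rho\right).$$ (c) The quantity in (b) equals $1-\alpha$ for all $\alpha\in(0,1)$ and all $\rho\in(-1,1)$ if and only if $(a,b)=(1,2)$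 (the right-Haar prior).
   Context: Model: $\mathbf x_k=(x_{1k},x_{2k})'$, $k=1,\dots,n$, are i.i.d. bivariate normal with mean $(\mu_1,\mu_2)'\in\mathbb R^2$ and covariance matrix $\boldsymbol\Sigma=\begin{pmatrix}\sigma_1^2&\rho\sigma_1\sigma_2\\ \rho\sigma_1\sigma_2&\sigma_2^2\end{pmatrix}$, $\sigma_1,\sigma_2>0$, $|\rho|<1$. Statistics: $\overline x_i=n^{-1}\sum_k x_{ik}$, $s_{ij}=\sum_k(x_{ik}-\overline x_i)(x_{jk}-\overline x_j)$, $r=s_{12}/\sqrt{s_{11}s_{22}}$ (with $|r|<1$ almost surely). Prior: $\pi_{ab}$ is the (improper) density, with respect to $d\mu_1\,d\mu_2\,d\sigma_1\,d\sigma_2\,d\rho$, $$\pi_{ab}(\mu_1,\mu_2,\sigma_1,\sigma_2,\rho)=\frac{1}{\sigma_1^{3-a}\sigma_2^{2-b}(1-\rho^2)^{2-b/2}},$$ and the posterior given $\mathbf X$ is the normalized product of likelihood and prior (proper when $a<n$, $b<n$). Random variables: $Z_3$ and $Z_3^*$ are standard normal; $\chi^2_m$ and $\chi^{2*}_m$ denote chi-squared random variables with $m$ (real, positive) degrees of freedom, i.e. Gamma with shape $m/2$ and rate $1/2$. All of $Z_3,\chi^2_{n-1},\chi^2_{n-2},Z_3^*,\chi^{2*}_{n-a},\chi^{2*}_{n-b}$ are mutually independent. Quantiles: $(W)_{\beta}$ (or $W_\beta$) denotes the $\beta$ quantile of $W$ with respect to the distribution of the starred variables only, all non-starred quantities being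 held fixed. Frequentist coverage: $P(\cdot\mid\boldsymbol\xi,\rho)$ is probability under the sampling distribution of $\mathbf X$ with the parameters fixed; $\rho^*_{1-\alpha}$ is a function of $\mathbf X$. *)

(* Defs.v *)
From HB Require Import structures.
From mathcomp Require Export all_boot all_order all_algebra.
From mathcomp Require Export all_classical all_reals all_analysis.
From mathcomp Require Export measurable_realfun.
Export Order.TTheory GRing.Theory Num.Theory.
Export numFieldNormedType.Exports.

Set Implicit Arguments.
Unset Strict Implicit.
Unset Printing Implicit Defensive.

Local Open Scope classical_set_scope.
Local Open Scope ring_scope.

Section probability.
Context {R : realType} {d : measure_display} {T : measurableType d}.

Definition has_density (P : probability T R) (X : {mfun T >-> R})
    (f : R -> R) : Prop :=
  forall B : set R, measurable B ->
    P (X @^-1` B) = (\int[lebesgue_measure]_(x in B) (f x)%:E)%E.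

Definition has_density2 (P : probability T R) (X : {mfun T >-> (R * R)%type})
    (f : R * R -> R) : Prop :=
  forall B : set (R * R), measurable B ->
    P (X @^-1` B) =
    (\int[lebesgue_measure \x lebesgue_measure]_(x in B) (f x)%:E)%E.

(* As the B i may be the full space, the product rule over the whole finite
   family entails the product rule over every subfamily. *)
Definition mutually_independent d' (U : measurableType d')
    (P : probability T R) (I : finType) (X : I -> {mfun T >-> U}) : Prop :=
  forall B : I -> set U, (forall i, measurable (B i)) ->
    P (\bigcap_i (X i @^-1` B i)) = (\prod_i P (X i @^-1` B i))%E.

(* P is any set function, so that this applies to probability measures and to
   the posterior below. *)
Definition quantile (U : Type) (P : set U -> \bar R) (W : U -> R) (beta : R) : R :=
  inf [set w | (beta%:E <= P [set u | (W u <= w)%R])%E].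

End probability.

Section densities.
Context {R : realType}.

Definition Gamma (s : R) : R :=
  \int[lebesgue_measure]_(t in `]0, +oo[) (t `^ (s - 1) * expR (- t)).

Definition gamma_pdf (shape rate x : R) : R :=
  if 0 < x then
    rate `^ shape * x `^ (shape - 1) * expR (- (rate * x)) / Gamma shape
  else 0.

Definition chi2_pdf (m : R) : R -> R := gamma_pdf (m / 2) 2^-1.

Definition vec2 (u v : R) : 'cV[R]_2 := \col_i (if i == 0 then u else v).

Definition bvn_cov (s1 s2 rho : R) : 'M[R]_2 :=
  \matrix_(i, j) (if i == j then vec2 s1 s2 i 0 ^+ 2 else rho * s1 * s2).

Definition bvn_pdf (m : 'cV[R]_2) (S : 'M[R]_2) (x : R * R) : R :=
  let y := vec2 x.1 x.2 - m in
  expR (- 2^-1 * (y^T *m invmx S *m y) 0 0) / (2 * pi * Num.sqrt (\det S)).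

End densities.

Section model.
Context {R : realType} {n : nat}.

(* Parameters are listed as (mu1, mu2, sigma1, sigma2, rho). *)
Definition param : Type := (R * R * R * R * R)%type.

Definition param_space : set (R * R * R * R * R) :=
  [set th | let: (_, _, s1, s2, rho) := th in
            [/\ 0 < s1, 0 < s2 & `|rho| < 1]].

Definition obs_pdf (th : param) : R * R -> R :=
  let: (m1, m2, s1, s2, rho) := th in
  bvn_pdf (vec2 m1 m2) (bvn_cov s1 s2 rho).

Definition iid_sample (d : measure_display) (T : measurableType d)
    (P : probability T R) (X : 'I_n -> {mfun T >-> (R * R)%type})
    (th : param) : Prop :=
  mutually_independent P X /\
  forall k, has_density2 P (X k) (obs_pdf th).

Definition smean (u : 'I_n -> R) : R := n%:R^-1 * \sum_k u k.

Definition sscp (u v : 'I_n -> R) : R :=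
  \sum_k (u k - smean u) * (v k - smean v).

Definition s11 (x : 'I_n -> R * R) : R := sscp (fst \o x) (fst \o x).
Definition s22 (x : 'I_n -> R * R) : R := sscp (snd \o x) (snd \o x).
Definition s12 (x : 'I_n -> R * R) : R := sscp (fst \o x) (snd \o x).

Definition scorr (x : 'I_n -> R * R) : R :=
  s12 x / Num.sqrt (s11 x * s22 x).

Definition likelihood (x : 'I_n -> R * R) (th : param) : R :=
  \prod_k obs_pdf th (x k).

Definition prior (a b : R) (th : param) : R :=
  let: (_, _, s1, s2, rho) := th in
  (s1 `^ (3 - a) * s2 `^ (2 - b) * (1 - rho ^+ 2) `^ (2 - b / 2))^-1.

Definition posterior_mass (a b : R) (x : 'I_n -> R * R)
    (B : set (R * R * R * R * R)) : \bar R :=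
  (\int[lebesgue_measure \x lebesgue_measure \x lebesgue_measure
        \x lebesgue_measure \x lebesgue_measure]_(th in param_space `&` B)
     (likelihood x th * prior a b th)%:E)%E.

(* When the total mass is infinite (e.g. for samples with s11 x = 0 or
   |scorr x| = 1, a null event under the model) the quotient is 0. *)
Definition posterior (a b : R) (x : 'I_n -> R * R)
    (B : set (R * R * R * R * R)) : \bar R :=
  (posterior_mass a b x B / posterior_mass a b x setT)%E.

Definition rho_posterior_quantile (a b : R) (x : 'I_n -> R * R) (beta : R) : R :=
  quantile (posterior a b x) (fun th => th.2) beta.

End model.
Arguments param : clear implicits.

Definition psi {R : realType} (y : R) : R := y / Num.sqrt (1 + y ^+ 2).

(* Main.v *)
(* The data enter only through the sums of squares and products. Write the
   standardised sample as a triangular array, built one observation at a time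
   by Givens rotations: then s11 = s1^2 A^2, s12 = s1 s2 A (rho A + tau t) and
   s22 = s2^2 ((rho A + tau t)^2 + (tau B)^2), where tau = sqrt (1 - rho^2), t is
   standard normal and A^2, B^2 are independent chi-squared variables with n - 1
   and n - 2 degrees of freedom. On the posterior side, integrating out the means
   and substituting u = sqrt s11 / s1, w = sqrt s22 / (s2 tau), y = rho / tau,
   z = r w - u y turns the posterior density into a product in which all powers of
   1 - rho^2 cancel: this is the law of Y*. Solving Y* <= rho / tau for r then
   exchanges the roles of the posterior quantile and of the pivot, whence the
   coverage. Finally, exact coverage for all levels makes the starred and the
   unstarred pivots equal in law for every rho. At rho = 0, and then at the event
   {pivot <= 0} for all rho, this compares laws of ratios Z / sqrt (chi2_m), whose
   densities determine m. *)
Require Import Defs.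
From HB Require Import structures.
From mathcomp Require Import ring lra.

Set Implicit Arguments.
Unset Strict Implicit.
Unset Printing Implicit Defensive.

Local Open Scope classical_set_scope.
Local Open Scope ring_scope.

(** * Densities and product laws *)

(** The degrees of freedom [n - a] and [n - b] are arbitrary reals, whereas those of the sample
    arise by recursion on the number of observations. Both sides meet in the density
    [u ^ p * exp (- u ^ 2 / 2)] of a chi variable, known up to a constant: constants are recovered
    from total mass one or cancel in a quotient, so no value of [Gamma] is ever computed.
    Independence is given as a product rule for events. Joint laws are therefore transported a few
    coordinates at a time, the events on all other variables being stored in a set [E] of fixed
    weight. Invariance of the plane normal law under rotations then suffices, and no Jacobian in
    dimension [n] occurs. A random angle is harmless as long as it is independent of the rotated
    pair. The coverage event and the pivot event agree only off a null set. Comparing their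
    probabilities requires measurability of the coverage event on all samples, including the
    degenerate ones, where the posterior mass may be infinite and the quantile takes a default
    value. *)

Lemma measurable_inv {R : realType} : measurable_fun [set: R] (@GRing.inv R).
Proof.
have -> : [set: R] = [set 0] `|` ~` [set 0] by rewrite setUv.
have m0 : measurable ([set 0] : set R) by exact: measurable_set1.
apply/measurable_funU => //; first exact: measurableC.
split; first exact: measurable_fun_set1.
apply: open_continuous_measurable_fun.
  apply: closed_openC; apply: accessible_closed_set1; exact: hausdorff_accessible.
by move=> x /set_mem/= /eqP x0; exact: inv_continuous.
Qed.

Lemma measurable_sqrt {R : realType} : measurable_fun [set: R] (@Num.sqrt R).
Proof. by apply: continuous_measurable_fun; exact: sqrt_continuous. Qed.

Section density.
Local Open Scope ereal_scope.
Context d (T : measurableType d) (R : realType).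
Variables (mu m : {measure set T -> \bar R}) (f : T -> R).
Hypothesis f0 : forall x, (0 <= f x)%R.
Hypothesis mf : measurable_fun [set: T] f.
Hypothesis mE : forall A, measurable A -> m A = \int[mu]_(x in A) (f x)%:E.

Import HBNNSimple.

Let density_nnsfun (h : {nnsfun T >-> R}) :
  \int[m]_x (h x)%:E = \int[mu]_x ((h x)%:E * (f x)%:E).
Proof.
under [LHS]eq_integral do rewrite fimfunE -fsumEFin//.
rewrite [LHS]ge0_integral_fsum//; last 2 first.
  - by move=> r; exact/measurable_EFinP/measurableT_comp.
  - by move=> n x _; rewrite EFinM nnfun_muleindic_ge0.
under [RHS]eq_integral.
  move=> x xD; rewrite fimfunE -fsumEFin// ge0_mule_fsuml; last first.
    by move=> r; rewrite EFinM nnfun_muleindic_ge0.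
  over.
rewrite [RHS]ge0_integral_fsum//; last 2 first.
  - move=> r; apply: emeasurable_funM; apply/measurable_EFinP => //.
    exact/measurableT_comp.
  - by move=> n x _; rewrite mule_ge0 ?lee_fin// -lee_fin EFinM nnfun_muleindic_ge0.
apply: eq_fsbigr => r rh.
have r0 : (0 <= r)%R by move: rh => /set_mem [x _ <-].
rewrite integralZl_indic_nnsfun// integral_indic// setIT mE//.
under [RHS]eq_integral do rewrite EFinM -muleA.
rewrite ge0_integralZl//.
- by rewrite integral_mkcond epatch_indic; under [in RHS]eq_integral do rewrite muleC.
- by apply: emeasurable_funM; apply/measurable_EFinP.
- by move=> x _; rewrite mule_ge0// ?lee_fin.
Qed.

(** Since [m] is known only through its values on sets, the formula is obtained for simple functions
    and extended by monotone convergence on both sides. The normal law, the chi-squared laws and the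
    substitution rule below all rest on it. *)
Lemma ge0_integral_density (g : T -> \bar R) :
    measurable_fun [set: T] g -> (forall x, 0 <= g x) ->
  \int[m]_x g x = \int[mu]_x (g x * (f x)%:E).
Proof.
move=> mg g0; pose h := nnsfun_approx measurableT mg.
transitivity (limn (fun n => \int[m]_x (h n x)%:E)).
  rewrite -monotone_convergence//=.
  - apply: eq_integral => x _; apply/esym/cvg_lim => //=.
    exact: cvg_nnsfun_approx.
  - by move=> n; exact/measurable_EFinP.
  - by move=> n x _; rewrite lee_fin.
  - by move=> x _ a b ab; rewrite lee_fin; exact/lefP/nd_nnsfun_approx.
rewrite (_ : (fun _ => _) = fun n => \int[mu]_x ((h n x)%:E * (f x)%:E)); last first.
  by apply/funext => n; exact: density_nnsfun.
rewrite -monotone_convergence//=.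
- apply: eq_integral => x _; apply/cvg_lim => //=.
  by apply: cvgeZr => //; exact: cvg_nnsfun_approx.
- by move=> n; apply: emeasurable_funM; exact/measurable_EFinP.
- by move=> n x _; rewrite mule_ge0// lee_fin.
- move=> x _ a b ab; rewrite lee_wpmul2r// lee_fin//.
  exact/lefP/nd_nnsfun_approx.
Qed.

End density.

Section pair_law.
Local Open Scope ereal_scope.
Context d (T : measurableType d) (R : realType) (P : {measure set T -> \bar R}).
Context d1 (S1 : measurableType d1) d2 (S2 : measurableType d2).
Variables (mu : {finite_measure set S1 -> \bar R}) (nu : {finite_measure set S2 -> \bar R}).

(** The restriction of [P] to [E], pushed forward by [(U, V)] and divided by [e], agrees with the
    product measure on rectangles, hence everywhere. The event [E] will hold the conditions on all
    variables other than [U] and [V], which makes it possible to transform two coordinates while the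
    rest of the family stays untouched. *)
Lemma pair_law (U : T -> S1) (V : T -> S2) (E : set T) (e : \bar R) :
  measurable_fun [set: T] U -> measurable_fun [set: T] V -> measurable E ->
  e \is a fin_num -> 0 <= e ->
  (forall A B, measurable A -> measurable B ->
    P (U @^-1` A `&` V @^-1` B `&` E) = mu A * nu B * e) ->
  forall C, measurable C ->
    P ((fun w => (U w, V w)) @^-1` C `&` E) = (mu \x nu) C * e.
Proof.
move=> mU mV mE efin e0 H C mC.
have mUV : measurable_fun [set: T] (fun w => (U w, V w)) by exact/measurable_fun_pair.
pose Mf : {measure set (S1 * S2) -> \bar R} :=
  pushforward (mrestr P mE) (fun w => (U w, V w)).
pose M := Mf mUV.
have ME X : M X = P ((fun w => (U w, V w)) @^-1` X `&` E) by [].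
have MXE A B : measurable A -> measurable B -> M (A `*` B) = mu A * nu B * e.
  by move=> mA mB; rewrite ME -H.
rewrite -ME.
(* Weight zero cannot be normalised; there the rectangle of full sides already has measure zero. *)
have [e00|e_neq0] := eqVneq e 0.
  rewrite e00 mule0; apply/eqP; rewrite -measure_le0.
  rewrite (le_trans (le_measure M _ _ (@subsetT _ C))) ?inE//.
  by have := MXE _ _ measurableT measurableT; rewrite setXTT e00 mule0 => /eqP; rewrite eq_le => /andP[].
have e_gt0 : (0 < fine e)%R by rewrite fine_gt0// lt0e e_neq0 e0/= ltey_eq efin.
pose k : {nonneg R} := NngNum (ltW (divr_gt0 ltr01 e_gt0)).
have kE : e * k%:num%:E = 1 by rewrite /= -[X in X * _](fineK efin) -EFinM div1r divff// gt_eqF.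
rewrite (product_measure_unique (m' := mscale k M))//.
  by rewrite /mscale/= muleAC [X in _ = X * _]muleC kE mul1e.
move=> A B mA mB; transitivity (k%:num%:E * (mu A * nu B * e)).
  by congr (_ * _); exact: MXE.
by rewrite muleC -muleA kE mule1.
Qed.

End pair_law.

(** * Substitution in integrals over the line *)

Section substitution.
Local Open Scope ereal_scope.
Context {R : realType}.
Local Notation mu := (@lebesgue_measure R).

Section density_measure.
Variable f : R -> R.
Hypotheses (mf : measurable_fun [set: R] f) (f0 : forall x, (0 <= f x)%R).

Let dens (A : set (measurableTypeR R)) : \bar R := \int[mu]_(x in A) (f x)%:E.
Let dens0 : dens set0 = 0. Proof. exact: integral_set0. Qed.
Let dens_ge0 A : 0 <= dens A.
Proof. by apply: integral_ge0 => x _; rewrite lee_fin. Qed.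
Let dens_sigma_additive : semi_sigma_additive dens.
Proof.
move=> /= A mA tA mUA; rewrite /dens ge0_integral_bigcup//=.
- apply: is_cvg_ereal_nneg_natsum_cond => n _ _; exact: dens_ge0.
- by apply: measurable_funTS; exact/measurable_EFinP.
- by move=> x _; rewrite lee_fin.
Qed.

(** Half-open intervals are stable under intersection and generate the Borel sets; finiteness on the
    intervals from [-k] to [k] supplies the exhaustion under which two measures agreeing on them
    coincide. *)
Lemma integral_density_unique (m : {measure set (measurableTypeR R) -> \bar R}) :
    (forall a b : R, (a < b)%R -> m `]a, b]%classic = \int[mu]_(x in `]a, b]) (f x)%:E) ->
    (forall a b : R, \int[mu]_(x in `]a, b]) (f x)%:E < +oo) ->
  forall A, measurable A -> m A = \int[mu]_(x in A) (f x)%:E.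
Proof.
move=> mE mfin A mA.
pose D : {measure set (measurableTypeR R) -> \bar R} :=
  HB.pack dens (isMeasure.Build _ _ _ dens dens0 dens_ge0 dens_sigma_additive).
rewrite -[RHS]/(D A).
apply: (@measure_unique _ R (measurableTypeR R) (@ocitv R) (fun k => `](- k%:R)%R, k%:R]%classic)) => //.
- exact: ocitvI.
- by move=> k; exact: is_ocitv.
- rewrite -subTset => x _; exists (Num.truncn `|x|).+1 => //=.
  by have := truncnS_gt `|x|; rewrite in_itv/= ltr_norml => /andP[-> /ltW].
- move=> X /ocitvP[->|[[a b] /= ab ->]]; first by rewrite !measure0.
  exact: mE.
- move=> k; have [k0|k0] := ltP (- k%:R)%R (k%:R : R); first by rewrite mE.
  by rewrite set_itv_ge ?bnd_simp -?leNgt// measure0.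
Qed.

End density_measure.

(** Lebesgue measure on [E], pulled back through the inverse [G], has density [f]: on half-open
    intervals this is the fundamental theorem of calculus. The last condition on [E] says that it
    contains every point between two values of [F]. Outside [E] the map [G] may take any values, so
    total functions such as [ln] serve as inverses. *)
Lemma ge0_integral_subst (F f G : R -> R) (E : set R) :
  (forall x : R, is_derive x (1%R : R) F (f x)) -> continuous f -> (forall x, (0 < f x)%R) ->
  measurable E -> measurable_fun [set: R] G ->
  (forall x, E (F x)) -> cancel F G -> (forall y, E y -> F (G y) = y) ->
  (forall p q y, (F p < y)%R -> (y <= F q)%R -> E y) ->
  forall g, measurable_fun [set: R] g -> (forall y, 0 <= g y) ->
  \int[mu]_x (g (F x) * (f x)%:E) = \int[mu]_(y in E) g y.
Proof.
move=> dF cf f0 mE mG EF FG GF Eitv g mg g0.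
have cF : continuous F.
  move=> x; apply: differentiable_continuous; apply/derivable1_diffP.
  exact: (@ex_derive _ _ _ _ _ _ _ (dF x)).
have mF : measurable_fun [set: R] F by exact: continuous_measurable_fun.
have mf : measurable_fun [set: R] f by exact: continuous_measurable_fun.
have Fm : {homo F : x y / (x < y)%R}.
  move=> x y xy.
  have [] := @MVT R F f x y xy.
  - exact: continuous_subspaceT.
  - move=> c _ /eqP; rewrite subr_eq => /eqP ->.
    by rewrite ltrDr mulr_gt0// subr_gt0.
have FmE : {mono F : x y / (x < y)%R}.
  by apply: leW_mono; apply: le_mono.
have FTC a b : (a < b)%R -> \int[mu]_(x in `]a, b]) (f x)%:E = (F b - F a)%:E.
  move=> ab; rewrite EFinB -(@continuous_FTC2 _ f F a b)//.
  - by rewrite integral_itv_obnd_cbnd//; apply/measurable_EFinP; exact: measurable_funTS.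
  - exact: continuous_subspaceT.
  - split.
    + by move=> x _; exact: (@ex_derive _ _ _ _ _ _ _ (dF x)).
    + by apply: cvg_at_right_filter; exact: cF.
    + by apply: cvg_at_left_filter; exact: cF.
  - by move=> x _; rewrite derive1E; exact: (@derive_val _ _ _ _ _ _ _ (dF x)).
pose nuf : {measure set (measurableTypeR R) -> \bar R} := pushforward (mrestr mu mE) (G : _ -> measurableTypeR R).
pose nu := nuf mG.
have nuE A : measurable A -> nu A = \int[mu]_(x in A) (f x)%:E.
  move=> mA; apply: integral_density_unique => //.
  - by move=> x; exact: ltW.
  - move=> a b ab; rewrite FTC//.
    transitivity (mu `]F a, F b]%classic).
      congr (mu _); apply/seteqP; split => y /=; rewrite !in_itv/=.
        by move=> [/andP[ay yb] Ey]; rewrite -(GF y Ey) FmE ay leNgt FmE -leNgt.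
      move=> /andP[ay yb]; have Ey := Eitv _ _ _ ay yb; split => //.
      by rewrite -FmE GF// ay leNgt -FmE GF// -leNgt.
    by rewrite lebesgue_measure_itv/= lte_fin Fm// EFinB.
  - move=> a b; have [ab|ab] := ltP a b; first by rewrite FTC// ltry.
    by rewrite set_itv_ge ?bnd_simp -?leNgt// integral_set0.
transitivity (\int[nu]_x g (F x)).
  rewrite (@ge0_integral_density _ _ _ mu nu f)//; first by move=> x; exact: ltW.
  exact: measurableT_comp.
rewrite (_ : \int[nu]_x g (F x) = \int[mrestr mu mE]_x g (F (G x))); last first.
  have := @ge0_integral_pushforward _ _ (measurableTypeR R) (measurableTypeR R) R G
    mG (mrestr mu mE) setT (g \o F) measurableT.
  rewrite preimage_setT; apply => //.
    exact: measurableT_comp.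
  by move=> y _; exact: g0.
rewrite (@ge0_integral_density _ _ _ mu (mrestr mu mE) \1_E)//.
- rewrite [RHS]integral_mkcond epatch_indic; apply: eq_integral => y _ /=.
  have [yE|yE] := boolP (y \in E); first by rewrite GF//; exact/set_mem.
  by rewrite indicE (negbTE yE) !mule0.
- by move=> A mA; rewrite integral_indic// setIC.
- by apply: measurableT_comp => //; exact: measurableT_comp.
Qed.

End substitution.

(** * Changes of variable *)

Section psi.
Context {R : realType}.

Lemma sqrt1_sqr_gt0 (y : R) : (0 < Num.sqrt (1 + y ^+ 2)).
Proof. by rewrite sqrtr_gt0 ltr_pwDl// sqr_ge0. Qed.

Lemma sqr_sqrt1_sqr (y : R) : (Num.sqrt (1 + y ^+ 2) ^+ 2 = 1 + y ^+ 2).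
Proof. by rewrite sqr_sqrtr// addr_ge0// sqr_ge0. Qed.

(** [psi] is the sine of the arctangent, so this is the squared cosine. In the posterior it turns
    every power of [1 - rho ^+ 2] into a power of [Num.sqrt (1 + y ^+ 2)]. *)
Lemma onem_psi_sqr (y : R) : (1 - psi y ^+ 2 = (Num.sqrt (1 + y ^+ 2) ^+ 2)^-1).
Proof.
rewrite /psi expr_div_n sqr_sqrt1_sqr.
by field; rewrite gt_eqF// ltr_pwDl// sqr_ge0.
Qed.

Lemma psi_itv (y : R) : psi y \in `](-1), 1[.
Proof.
have h : (0 < 1 - psi y ^+ 2) by rewrite onem_psi_sqr invr_gt0 exprn_gt0// sqrt1_sqr_gt0.
by rewrite in_itv/= -ltr_norml -(@ltr_pXn2r _ 2)// ?nnegrE// expr1n real_normK ?num_real// -subr_gt0.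
Qed.

Definition psi_inv (r : R) : R := (r / Num.sqrt (1 - r ^+ 2)).

Lemma psiK : cancel (@psi R) psi_inv.
Proof.
move=> y; rewrite /psi_inv onem_psi_sqr sqrtrV ?sqr_ge0// sqrtr_sqr gtr0_norm ?sqrt1_sqr_gt0//.
by rewrite invrK /psi divfK// gt_eqF// sqrt1_sqr_gt0.
Qed.

Lemma psi_invK : {in `](-1), 1[, cancel psi_inv (@psi R)}.
Proof.
move=> r; rewrite in_itv/= => r1.
have h : (0 < 1 - r ^+ 2) by nra.
have s0 : (0 < Num.sqrt (1 - r ^+ 2)) by rewrite sqrtr_gt0.
have -> : psi (psi_inv r) = (psi_inv r / Num.sqrt ((Num.sqrt (1 - r ^+ 2))^-1 ^+ 2)).
  congr (_ / Num.sqrt _); rewrite /psi_inv expr_div_n exprVn sqr_sqrtr ?ltW//.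
  by field; rewrite gt_eqF.
rewrite sqrtr_sqr gtr0_norm ?invr_gt0// /psi_inv.
by field; rewrite gt_eqF.
Qed.

Definition dpsi (y : R) : R := ((Num.sqrt (1 + y ^+ 2) ^+ 3)^-1).

Lemma is_derive_psi (y : R) : is_derive y 1 (@psi R) (dpsi y).
Proof.
have s0 := sqrt1_sqr_gt0 y.
have q0 : (0 < 1 + y ^+ 2) by rewrite ltr_pwDl// sqr_ge0.
have ds : is_derive y 1 (fun y => Num.sqrt (1 + y ^+ 2)) (y / Num.sqrt (1 + y ^+ 2)).
  have dq : is_derive y 1 (fun y => 1 + y ^+ 2) (2 * y).
    by apply: is_derive_eq; rewrite /GRing.scale/=; ring.
  have := @is_derive1_comp R (@Num.sqrt R) (fun y => 1 + y ^+ 2) y _ _ (is_derive1_sqrt q0) dq.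
  move=> h; rewrite (_ : _ / _ = (2 * Num.sqrt (1 + y ^+ 2))^-1 * (2 * y)); first exact: h.
  by field; rewrite gt_eqF.
have sn0 : Num.sqrt (1 + y ^+ 2) != 0 by rewrite gt_eqF.
have := is_deriveM (is_derive_id y 1) (@is_deriveV _ (fun y => Num.sqrt (1 + y ^+ 2)) _ _ _ sn0 ds).
rewrite /GRing.scale/= => h.
rewrite (_ : dpsi y = y * (- Num.sqrt (1 + y ^+ 2) ^- 2 * (y / Num.sqrt (1 + y ^+ 2))) +
  (Num.sqrt (1 + y ^+ 2))^-1 * 1); first exact: h.
rewrite /dpsi.
have /eqP := sqr_sqrt1_sqr y; rewrite -subr_eq => /eqP.
move: sn0; set t := Num.sqrt _ => t0 tE.
(* Writing the unit as [t ^+ 2 - y ^+ 2] makes the identity purely rational in [t] and [y]. *)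
rewrite mulr1 -[LHS]mul1r -tE.
by field.
Qed.

End psi.

Section changes_of_variable.
Local Open Scope ereal_scope.
Context {R : realType}.
Local Notation mu := (@lebesgue_measure R).
Implicit Type g : R -> \bar R.

Lemma ge0_integral_opp g : measurable_fun [set: R] g -> (forall x, 0 <= g x) ->
  \int[mu]_x g (- x)%R = \int[mu]_x g x.
Proof.
move=> mg g0.
have mN : measurable_fun [set: measurableTypeR R] (-%R : _ -> measurableTypeR R).
  exact: oppr_measurable.
have := @ge0_integral_pushforward _ _ (measurableTypeR R) (measurableTypeR R) R -%R
  mN mu setT g measurableT.
rewrite preimage_setT => <- //.
by apply: eq_measure_integral => A mA _; exact: lebesgue_measureN.
Qed.

Let lin_pos (c d : R) g : (0 < c)%R ->
  measurable_fun [set: R] g -> (forall x, 0 <= g x) ->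
  \int[mu]_x g (c * x + d)%R = (c^-1)%:E * \int[mu]_x g x.
Proof.
move=> c0 mg g0; have c_neq0 : (c != 0)%R by rewrite gt_eqF.
have mgc : measurable_fun [set: R] (fun x => g (c * x + d)%R).
  by apply: measurableT_comp => //; apply: measurable_funD => //; exact: measurable_funM.
have dF (x : R) : is_derive x (1%R : R) (fun x => c * x + d)%R c.
  by apply: is_derive_eq; rewrite /GRing.scale/= mulr1 ?mulr0 !addr0.
rewrite -[in RHS](@ge0_integral_subst R (fun x => c * x + d)%R (cst c) (fun y => (y - d) / c)%R setT dF)//.
- rewrite /cst ge0_integralZr//= ?lee_fin ?ltW//.
  by rewrite muleCA -EFinM mulVf ?mule1.
- by move=> x; exact: cvg_cst.
- by apply: measurable_funM => //; exact: measurable_funB.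
- by move=> x; rewrite addrK mulrC mulKf.
- by move=> y _; rewrite mulrC divfK// subrK.
Qed.

Lemma ge0_integral_affine (c d : R) g : (c != 0)%R ->
  measurable_fun [set: R] g -> (forall x, 0 <= g x) ->
  \int[mu]_x g (c * x + d)%R = (`|c|^-1)%:E * \int[mu]_x g x.
Proof.
move=> c0 mg g0; have [cp|cn|ce] := ltgtP c 0%R; last by rewrite ce eqxx in c0.
  rewrite ltr0_norm// -(lin_pos d _ mg)// ?oppr_gt0//.
  rewrite -[RHS]ge0_integral_opp//.
    by apply: eq_integral => x _; rewrite mulrNN.
  by apply: measurableT_comp => //; apply: measurable_funD => //; exact: measurable_funM.
by rewrite gtr0_norm// lin_pos.
Qed.

(** On the logarithmic scale the inversion [x -> k / x] and the square become the affine maps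
    [t -> - t + ln k] and [t -> 2 t]; the next two substitutions are reduced to
    [ge0_integral_affine] in this way. *)
Lemma ge0_integral_expR g :
  measurable_fun [set: R] g -> (forall x, 0 <= g x) ->
  \int[mu]_x (g (expR x) * (expR x)%:E) = \int[mu]_(x in `]0%R, +oo[) g x.
Proof.
move=> mg g0; apply: (@ge0_integral_subst R expR expR (@ln R)) => //.
- exact: continuous_expR.
- by move=> x; exact: expR_gt0.
- by move=> x /=; rewrite in_itv/= expR_gt0.
- exact: expRK.
- by move=> y; rewrite /= in_itv/= andbT => y0; rewrite lnK.
- move=> p q y py _; rewrite /= in_itv/= andbT; exact: lt_trans (expR_gt0 _) py.
Qed.

Lemma ge0_integral_inv (k : R) g : (0 < k)%R ->
  measurable_fun [set: R] g -> (forall x, 0 <= g x) ->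
  \int[mu]_(x in `]0%R, +oo[) (g (k / x)%R * (k / x ^+ 2)%:E) =
  \int[mu]_(x in `]0%R, +oo[) g x.
Proof.
move=> k0 mg g0.
pose h x := g x * `|x|%:E.
have mh : measurable_fun [set: R] h.
  by apply: emeasurable_funM => //; apply/measurable_EFinP; exact: normr_measurable.
have mi : measurable_fun [set: R] (fun x => k / x)%R.
  by apply: measurable_funM => //; exact: measurable_inv.
(* The absolute value changes nothing on the half-line but makes the integrand nonnegative
   everywhere, as [ge0_integral_expR] demands. *)
transitivity (\int[mu]_(x in `]0%R, +oo[) (g (k / x)%R * (`|k / x ^+ 2|)%:E)).
  by apply: eq_integral => x _; rewrite ger0_norm// divr_ge0 ?sqr_ge0// ltW.
rewrite -!ge0_integral_expR//; last 2 first.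
- apply: emeasurable_funM; first exact: measurableT_comp.
  apply/measurable_EFinP; apply: measurableT_comp => //.
  apply: measurable_funM => //; apply: (measurableT_comp measurable_inv).
  exact: exprn_measurable.
- by move=> x; rewrite mule_ge0.
transitivity (\int[mu]_x (g (expR ((-1) * x + ln k)%R) * (expR ((-1) * x + ln k)%R)%:E)).
  apply: eq_integral => x _; rewrite mulN1r expRD lnK// expRN mulrC -muleA -EFinM.
  congr (_ * _%:E); rewrite ger0_norm ?divr_ge0 ?sqr_ge0 ?ltW//.
  by field; rewrite gt_eqF// expR_gt0.
rewrite (@ge0_integral_affine (-1)%R (ln k) (fun x => g (expR x) * (expR x)%:E)).
- by rewrite normrN normr1 invr1 mul1e.
- by rewrite oppr_eq0 oner_eq0.
- by apply: emeasurable_funM; [exact: measurableT_comp|apply/measurable_EFinP].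
- by move=> x; rewrite mule_ge0// lee_fin expR_ge0.
Qed.

Lemma ge0_integral_sqr g :
  measurable_fun [set: R] g -> (forall x, 0 <= g x) ->
  \int[mu]_(x in `]0%R, +oo[) (g (x ^+ 2)%R * (2 * x)%:E) =
  \int[mu]_(x in `]0%R, +oo[) g x.
Proof.
move=> mg g0.
transitivity (\int[mu]_(x in `]0%R, +oo[) (g (x ^+ 2)%R * (2 * `|x|)%:E)).
  apply: eq_integral => x /set_mem/=; rewrite in_itv/= andbT => x0.
  by rewrite gtr0_norm.
rewrite -!ge0_integral_expR//; last 2 first.
- apply: emeasurable_funM; first by apply: measurableT_comp => //; exact: exprn_measurable.
  by apply/measurable_EFinP; apply: measurable_funM => //; exact: measurableT_comp.
- by move=> x; rewrite mule_ge0// lee_fin mulr_ge0.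
transitivity (\int[mu]_x (2%:E * (g (expR (2 * x + 0)%R) * (expR (2 * x + 0)%R)%:E))).
  apply: eq_integral => x _.
  have -> : (2 * x + 0 = x + x)%R by ring.
  rewrite expRD -expr2 ger0_norm ?expR_ge0// -muleA [RHS]muleCA -!EFinM.
  by congr (_ * _%:E); ring.
pose h x := g (expR x) * (expR x)%:E.
have mh : measurable_fun [set: R] h.
  by apply: emeasurable_funM; [exact: measurableT_comp|apply/measurable_EFinP].
have h0 x : 0 <= h x by rewrite mule_ge0// lee_fin expR_ge0.
rewrite ge0_integralZl//=.
rewrite (@ge0_integral_affine 2 0 h)//.
- rewrite muleA -EFinM ger0_norm// divff ?mul1e//.
- apply: (measurableT_comp mh); apply: measurable_funD => //; exact: measurable_funM.
- by move=> x _; exact: h0.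
Qed.

Lemma ge0_integral_itv0y_scale (c : R) g : (0 < c)%R ->
  measurable_fun [set: R] g -> (forall x, 0 <= g x) ->
  \int[mu]_(x in `]0%R, +oo[) g (c * x)%R = (c^-1)%:E * \int[mu]_(x in `]0%R, +oo[) g x.
Proof.
move=> c0 mg g0.
rewrite [LHS]integral_mkcond [in RHS]integral_mkcond !epatch_indic.
rewrite -[c in (c^-1)%:E](gtr0_norm c0) -(@ge0_integral_affine c 0)//.
- apply: eq_integral => x _ /=; congr (_ * _); first by rewrite addr0.
  by rewrite addr0 !indicE !mem_setE !in_itv/= !andbT pmulr_rgt0.
- by rewrite gt_eqF.
- apply: emeasurable_funM => //; apply/measurable_EFinP; exact: measurable_indic.
- by move=> x; rewrite mule_ge0// lee_fin.
Qed.

Lemma ge0_integral_psi g : measurable_fun [set: R] g -> (forall x, 0 <= g x) ->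
  \int[mu]_y (g (psi y) * ((Num.sqrt (1 + y ^+ 2) ^+ 3)^-1)%:E) =
  \int[mu]_(x in `](-1)%R, 1%R[) g x.
Proof.
move=> mg g0.
have cs : continuous (fun y : R => Num.sqrt (1 + y ^+ 2) ^+ 3)%R.
  move=> y; apply: (@continuous_comp _ _ _ (fun y : R => Num.sqrt (1 + y ^+ 2))%R
    (fun z : R => z ^+ 3)%R); last exact: exprn_continuous.
  apply: (@continuous_comp _ _ _ (fun y : R => 1 + y ^+ 2)%R (@Num.sqrt R));
    last exact: sqrt_continuous.
  by apply: cvgD; [exact: cvg_cst|exact: exprn_continuous].
apply: (@ge0_integral_subst R (@psi R) dpsi psi_inv _ is_derive_psi) => //.
- move=> y; rewrite /dpsi.
  apply: cvgV; first by rewrite gt_eqF// exprn_gt0// sqrt1_sqr_gt0.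
  exact: cs.
- by move=> y; rewrite invr_gt0 exprn_gt0// sqrt1_sqr_gt0.
- apply: measurable_funM => //; apply: (measurableT_comp measurable_inv).
  by apply: (measurableT_comp measurable_sqrt); apply: measurable_funB => //; exact: exprn_measurable.
- by move=> y; apply: psi_itv.
- exact: psiK.
- by move=> r; exact: psi_invK.
- move=> p q y /=; rewrite in_itv/=.
  have := psi_itv p; have := psi_itv q; rewrite !in_itv/= => /andP[_ q1] /andP[p1 _].
  by move=> py yq; rewrite (lt_trans p1 py) (le_lt_trans yq q1).
Qed.

End changes_of_variable.

Ltac meas_step :=
  lazymatch goal with
  | |- measurable_fun _ (fun x => x) => exact: measurable_id
  | |- measurable_fun _ (fun _ => ?c) => exact: measurable_cst
  | |- measurable_fun _ (fun x => (@?a x + @?b x)%R) => apply: measurable_funD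
  | |- measurable_fun _ (fun x => (- @?a x)%R) => apply: (measurableT_comp (@oppr_measurable _ setT))
  | |- measurable_fun _ (fun x => (@?a x * @?b x)%R) => apply: measurable_funM
  | |- measurable_fun _ (fun x => (@?a x ^+ _)%R) => apply: measurable_funX
  | |- measurable_fun _ (fun x => (@?a x ^-1)%R) => apply: (measurableT_comp measurable_inv)
  | |- measurable_fun _ (fun x => Num.sqrt (@?a x)) => apply: (measurableT_comp measurable_sqrt)
  | |- measurable_fun _ (fun x => expR (@?a x)) => apply: (measurableT_comp (@measurable_expR _))
  | |- measurable_fun _ (fun x => ln (@?a x)) => apply: (measurableT_comp (@measurable_ln _))
  | |- measurable_fun _ (fun x => `| @?a x |%R) => apply: (measurableT_comp (@normr_measurable _ setT))
  | |- measurable_fun _ (fun x => (@?a x, @?b x)) => apply: measurable_fun_pair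
  | |- measurable_fun _ (fun x => fst x) => exact: measurable_fst
  | |- measurable_fun _ (fun x => snd x) => exact: measurable_snd
  | |- measurable_fun _ fst => exact: measurable_fst
  | |- measurable_fun _ snd => exact: measurable_snd
  | |- measurable_fun _ (fun x => fst (@?a x)) => apply: (measurableT_comp measurable_fst)
  | |- measurable_fun _ (fun x => snd (@?a x)) => apply: (measurableT_comp measurable_snd)
  end.
Ltac meas := repeat meas_step.

Section tonelli.
Local Open Scope ereal_scope.
Context d1 d2 (T1 : measurableType d1) (T2 : measurableType d2) (R : realType).
Variables (m1 : {sigma_finite_measure set T1 -> \bar R})
  (m2 : {sigma_finite_measure set T2 -> \bar R}) (f : T1 -> T2 -> \bar R).
Hypothesis mf : measurable_fun [set: T1 * T2] (fun p => f p.1 p.2).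
Hypothesis f0 : forall x y, 0 <= f x y.

Lemma tonelli_swap : \int[m1]_x \int[m2]_y f x y = \int[m2]_y \int[m1]_x f x y.
Proof. by apply: (fubini_tonelli (fun p => f p.1 p.2) mf) => x; exact: f0. Qed.

Lemma tonelli_product :
  \int[m1 \x m2]_p f p.1 p.2 = \int[m1]_x \int[m2]_y f x y.
Proof. by apply: (fubini_tonelli1 (fun p => f p.1 p.2) mf) => x; exact: f0. Qed.

Lemma measurable_tonelli : measurable_fun [set: T1] (fun x => \int[m2]_y f x y).
Proof.
by apply: (measurable_fun_fubini_tonelli_F (fun p => f p.1 p.2) mf) => x; exact: f0.
Qed.

End tonelli.

(** * Rotation invariance of the standard normal law in the plane *)

Section gaussian.
Local Open Scope ereal_scope.
Context {R : realType}.
Local Notation mu := (@lebesgue_measure R).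
Local Notation mR := (measurableTypeR R).
Local Notation gamma := (@normal_prob R 0 1).

(** The rotation is done one variable at a time: [u = c x + s y] at fixed [y], for which the second
    coordinate is [(y - s u) / c], then [v = (y - s u) / c] at fixed [u]. The factors [|c|^-1] and
    [|c|] cancel. Dividing by [c] is what excludes quarter turns here. *)
Lemma ge0_integral_rot_lebesgue (c s : R) (f : R * R -> \bar R) :
  (c != 0)%R -> (c ^+ 2 + s ^+ 2 = 1)%R ->
  measurable_fun [set: R * R] f -> (forall x, 0 <= f x) ->
  \int[mu]_x \int[mu]_y f (c * x + s * y, - s * x + c * y)%R =
  \int[mu]_x \int[mu]_y f (x, y).
Proof.
move=> c0 cs mf f0.
have absc0 : (`|c| != 0)%R by rewrite normr_eq0.
have mh : measurable_fun [set: mR * mR] (fun p => f (c * p.1 + s * p.2, - s * p.1 + c * p.2)%R).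
  by apply: (measurableT_comp mf); meas.
have mg : measurable_fun [set: mR * mR] (fun p => f (p.2, (p.1 - s * p.2) / c)%R).
  by apply: (measurableT_comp mf); meas.
rewrite (tonelli_swap mu mu mh); last by [].
transitivity (\int[mu]_y ((`|c|^-1)%:E * \int[mu]_u f (u, (y - s * u) / c)%R)).
  apply: eq_integral => y _ /=.
  rewrite -(@ge0_integral_affine _ c (s * y) (fun u => f (u, (y - s * u) / c)%R))//.
  - apply: eq_integral => x _; congr (f (_, _)).
    have -> : ((y - s * (c * x + s * y)) = (c ^+ 2 + s ^+ 2) * y - s * (c * x + s * y))%R.
      by rewrite cs mul1r.
    by field.
  - by apply: (measurableT_comp mf); meas.
rewrite ge0_integralZl//; last 2 first.
- exact: (measurable_tonelli mu mg).
- by move=> y _; exact: integral_ge0.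
rewrite (tonelli_swap mu mu mg); last by [].
transitivity ((`|c|^-1)%:E * \int[mu]_u (`|c|%:E * \int[mu]_v f (u, v))).
  congr (_ * _); apply: eq_integral => u _.
  rewrite -[X in X%:E * _]invrK -normfV -(@ge0_integral_affine _ c^-1 (- s * u / c) (fun v => f (u, v)))//.
  - by apply: eq_integral => y _; congr (f (_, _)); field.
  - by rewrite invr_neq0.
  - by apply: (measurableT_comp mf); meas.
rewrite ge0_integralZl//.
- by rewrite muleA -EFinM mulVf// mul1e.
- by apply: measurable_tonelli => //; apply: (measurableT_comp mf); meas.
- by move=> u _; exact: integral_ge0.
Qed.

Lemma normal_pdf01E (x : R) : normal_pdf 0 1 x = (normal_peak 1 * expR (- (x ^+ 2 / 2)))%R.
Proof.
rewrite normal_pdfE ?oner_eq0// /normal_fun subr0 expr1n.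
by congr (_ * expR _)%R; rewrite mulNr.
Qed.

Lemma integral_gamma (f : R -> \bar R) :
  measurable_fun [set: R] f -> (forall x, 0 <= f x) ->
  \int[gamma]_x f x = \int[mu]_x (f x * (normal_pdf 0 1 x)%:E).
Proof.
move=> mf f0; apply: ge0_integral_density => //; last exact: measurable_normal_pdf.
by move=> x; exact: normal_pdf_ge0.
Qed.

Let rot_neq0 (c s : R) (f : R * R -> \bar R) :
  (c != 0)%R -> (c ^+ 2 + s ^+ 2 = 1)%R ->
  measurable_fun [set: R * R] f -> (forall x, 0 <= f x) ->
  \int[gamma]_x \int[gamma]_y f (c * x + s * y, - s * x + c * y)%R =
  \int[gamma]_x \int[gamma]_y f (x, y).
Proof.
move=> c0 cs mf f0.
have mphi : measurable_fun [set: R] (@normal_pdf R 0 1) by exact: measurable_normal_pdf.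
have mphi2 : measurable_fun [set: R * R] (fun p : R * R => (normal_pdf 0 1 p.1 * normal_pdf 0 1 p.2)%:E).
  by apply/measurable_EFinP; apply: measurable_funM; apply: (measurableT_comp mphi); meas.
have toL (g : R * R -> \bar R) : measurable_fun [set: R * R] g -> (forall x, 0 <= g x) ->
    \int[gamma]_x \int[gamma]_y g (x, y) =
    \int[mu]_x \int[mu]_y (g (x, y) * (normal_pdf 0 1 x * normal_pdf 0 1 y)%:E).
  move=> mg g0; rewrite integral_gamma//; last 2 first.
  - by apply: measurable_tonelli => //; apply: (measurableT_comp mg); meas.
  - by move=> x; exact: integral_ge0.
  apply: eq_integral => x _.
  have mgx : measurable_fun [set: R] (fun y => g (x, y)).
    by apply: (measurableT_comp mg); meas.
  rewrite integral_gamma// -ge0_integralZr//.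
  - by apply: eq_integral => y _; rewrite -muleA -EFinM [in RHS]mulrC.
  - by apply: emeasurable_funM => //; apply/measurable_EFinP.
  - by move=> y _; rewrite mule_ge0// lee_fin normal_pdf_ge0.
  - by rewrite lee_fin normal_pdf_ge0.
have mh : measurable_fun [set: R * R] (fun p => f (c * p.1 + s * p.2, - s * p.1 + c * p.2)%R).
  by apply: (measurableT_comp mf); meas.
rewrite (toL _ mh); last by [].
rewrite (toL _ mf); last by [].
have mH := emeasurable_funM mf mphi2.
etransitivity; last first.
  apply: (ge0_integral_rot_lebesgue c0 cs mH) => x.
  by rewrite mule_ge0// lee_fin mulr_ge0// normal_pdf_ge0.
apply: eq_integral => x _; apply: eq_integral => y _ /=; congr (_ * _%:E).
rewrite !normal_pdf01E mulrACA [RHS]mulrACA -!expRD; congr (_ * expR _)%R.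
transitivity ((- (x ^+ 2 / 2) - y ^+ 2 / 2) * (c ^+ 2 + s ^+ 2))%R; last by field.
by rewrite cs mulr1.
Qed.

Lemma ge0_integral_rot (c s : R) (f : R * R -> \bar R) :
  (c ^+ 2 + s ^+ 2 = 1)%R ->
  measurable_fun [set: R * R] f -> (forall x, 0 <= f x) ->
  \int[gamma]_x \int[gamma]_y f (c * x + s * y, - s * x + c * y)%R =
  \int[gamma]_x \int[gamma]_y f (x, y).
Proof.
have [->|c0] := eqVneq c 0%R; last exact: rot_neq0.
(* A quarter turn is the square of a rotation by an eighth of a turn. *)
rewrite expr0n/= add0r => s1 mf f0.
pose q : R := (Num.sqrt 2)^-1%R.
have q2 : (q ^+ 2 = 2^-1)%R by rewrite exprVn sqr_sqrtr.
have q0 : (q != 0)%R by rewrite invr_eq0 sqrtr_eq0 -ltNge.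
have qs1 : (q ^+ 2 + (s * q) ^+ 2 = 1)%R by rewrite exprMn s1 q2; field.
pose g p := f (q * p.1 + s * q * p.2, - (s * q) * p.1 + q * p.2)%R.
have mg : measurable_fun [set: R * R] g by apply: (measurableT_comp mf); meas.
rewrite -(rot_neq0 q0 qs1 mf); last by [].
rewrite -[RHS](rot_neq0 q0 qs1 mg); last by move=> p; exact: f0.
apply: eq_integral => x _; apply: eq_integral => y _; rewrite /g/=; congr (f (_, _)).
- transitivity ((1 - s ^+ 2) * (q ^+ 2) * x + (2 * q ^+ 2) * s * y)%R; last by ring.
  by rewrite s1 q2; field.
- transitivity ((1 - s ^+ 2) * (q ^+ 2) * y - (2 * q ^+ 2) * s * x)%R; last by ring.
  by rewrite s1 q2; field.
Qed.

End gaussian.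

(** * Chi distributions *)

Section tonelliD.
Local Open Scope ereal_scope.
Context d1 d2 (T1 : measurableType d1) (T2 : measurableType d2) (R : realType).
Variables (m1 : {sigma_finite_measure set T1 -> \bar R})
  (m2 : {sigma_finite_measure set T2 -> \bar R}) (f : T1 -> T2 -> \bar R).
Variables (D1 : set T1) (D2 : set T2).
Hypotheses (mD1 : measurable D1) (mD2 : measurable D2).
Hypothesis mf : measurable_fun [set: T1 * T2] (fun p => f p.1 p.2).
Hypothesis f0 : forall x y, 0 <= f x y.

Let h x y := f x y * (\1_D1 x * \1_D2 y : R)%:E.

Let mh : measurable_fun [set: T1 * T2] (fun p => h p.1 p.2).
Proof.
apply: emeasurable_funM => //; apply/measurable_EFinP; apply: measurable_funM.
  by apply: (measurableT_comp (measurable_indic mD1)); meas.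
by apply: (measurableT_comp (measurable_indic mD2)); meas.
Qed.

Let h0 x y : 0 <= h x y.
Proof. by rewrite mule_ge0// lee_fin mulr_ge0. Qed.

Let mf1 x : measurable_fun [set: T2] (fun y => f x y).
Proof. exact: (measurable_fun_pair2 x mf). Qed.

Let mf2 y : measurable_fun [set: T1] (fun x => f x y).
Proof. exact: (measurable_fun_pair1 y mf). Qed.

Let eqL : \int[m1]_(x in D1) \int[m2]_(y in D2) f x y = \int[m1]_x \int[m2]_y h x y.
Proof.
rewrite integral_mkcond epatch_indic; apply: eq_integral => x _ /=.
rewrite integral_mkcond epatch_indic -ge0_integralZr//.
- by apply: eq_integral => y _; rewrite /h/= -muleA -EFinM [in RHS]mulrC.
- apply: emeasurable_funM => //; apply/measurable_EFinP; exact: measurable_indic.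
- by move=> y _; rewrite mule_ge0// lee_fin.
Qed.

Let eqR : \int[m2]_(y in D2) \int[m1]_(x in D1) f x y = \int[m2]_y \int[m1]_x h x y.
Proof.
rewrite integral_mkcond epatch_indic; apply: eq_integral => y _ /=.
rewrite integral_mkcond epatch_indic -ge0_integralZr//.
- by apply: eq_integral => x _; rewrite /h/= EFinM muleA.
- apply: emeasurable_funM => //; apply/measurable_EFinP; exact: measurable_indic.
- by move=> x _; rewrite mule_ge0// lee_fin.
Qed.

Lemma tonelli_swapD : \int[m1]_(x in D1) \int[m2]_(y in D2) f x y =
  \int[m2]_(y in D2) \int[m1]_(x in D1) f x y.
Proof. by rewrite eqL eqR (tonelli_swap m1 m2 mh); last exact: h0. Qed.

Lemma measurable_tonelliD : measurable_fun [set: T1] (fun x => \int[m2]_(y in D2) f x y).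
Proof.
under eq_fun do rewrite integral_mkcond epatch_indic.
apply: (@measurable_tonelli _ _ _ _ _ m2 (fun x y => f x y * (\1_D2 y)%:E)).
  apply: emeasurable_funM => //; apply/measurable_EFinP.
  by apply: (measurableT_comp (measurable_indic mD2)); meas.
by move=> x y; rewrite mule_ge0// lee_fin.
Qed.

End tonelliD.

Section chi.
Local Open Scope ereal_scope.
Context {R : realType}.
Local Notation mu := (@lebesgue_measure R).
Local Notation mR := (measurableTypeR R).
Local Notation gamma := (@normal_prob R 0 1).

Definition hyp (p : mR * mR) : mR := Num.sqrt (p.1 ^+ 2 + p.2 ^+ 2)%R.

Lemma measurable_hyp : measurable_fun [set: mR * mR] hyp.
Proof. by rewrite /hyp; meas. Qed.

HB.instance Definition _ := isMeasurableFun.Build _ _ _ _ hyp measurable_hyp.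

Definition hyp_law (m : probability mR R) : probability mR R :=
  distribution (m \x gamma : probability (mR * mR)%type R) hyp.

(** The law of the norm of [j] independent standard normal variables, starting from the point mass
    at 0. Each step of the recursion is the very operation that a new observation performs on a
    diagonal entry of the triangular array, so the law of that entry needs no further
    identification. *)
Fixpoint chi_law (j : nat) : probability mR R :=
  if j is j'.+1 then hyp_law (chi_law j') else \d_(0%R : mR).

Lemma integral_hyp_law (m : probability mR R) (f : R -> \bar R) :
  measurable_fun [set: R] f -> (forall x, 0 <= f x) ->
  \int[hyp_law m]_x f x = \int[m]_r \int[gamma]_z f (hyp (r, z)).
Proof.
move=> mf f0.
have mfh : measurable_fun [set: mR * mR] (fun p => f (hyp (p.1, p.2))).
  by apply: (measurableT_comp mf); apply: (measurableT_comp measurable_hyp); meas.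
rewrite -(tonelli_product m gamma mfh); last by [].
by rewrite ge0_integral_distribution.
Qed.

Lemma integral_chi_law0 (f : R -> \bar R) :
  measurable_fun [set: R] f -> (forall x, 0 <= f x) ->
  \int[chi_law 0]_x f x = f 0%R.
Proof. by move=> mf f0; rewrite integral_dirac// diracT mul1e. Qed.

(* The constant [k] need not be computed: it is recovered from the total mass. *)
Definition has_chi_density (m : {measure set mR -> \bar R}) (p k : R) :=
  (0 < k)%R /\ forall f : R -> \bar R,
  measurable_fun [set: R] f -> (forall x, 0 <= f x) ->
  \int[m]_x f x = k%:E *
    \int[mu]_(u in `]0%R, +oo[) (f u * (u `^ p * expR (- (u ^+ 2 / 2)))%:E).

Lemma measurable_chi_weight (p : R) :
  measurable_fun [set: R] (fun u : R => u `^ p * expR (- (u ^+ 2 / 2)))%R.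
Proof. by meas; exact: measurable_powR. Qed.

Lemma chi_weight_ge0 (p u : R) : (0 <= u `^ p * expR (- (u ^+ 2 / 2)))%R.
Proof. by rewrite mulr_ge0 ?powR_ge0 ?expR_ge0. Qed.

Lemma has_chi_density1 : exists k, has_chi_density (chi_law 1) 0 k.
Proof.
have pk0 : (0 < normal_peak (1 : R))%R by rewrite normal_peak_gt0// oner_eq0.
exists (2 * normal_peak 1)%R; split; first by rewrite mulr_gt0.
move=> f mf f0.
pose g (z : R) := f `|z|%R * (normal_pdf 0 1 z)%:E.
have mphi : measurable_fun [set: R] (@normal_pdf R 0 1) by exact: measurable_normal_pdf.
have mg : measurable_fun [set: R] g.
  apply: emeasurable_funM; last exact/measurable_EFinP.
  by apply: (measurableT_comp mf); meas.
have g0 z : 0 <= g z by rewrite mule_ge0// lee_fin normal_pdf_ge0.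
have gE z : g (- z)%R = g z by rewrite /g normrN !normal_pdf01E sqrrN.
rewrite [chi_law 1]/= integral_hyp_law//.
rewrite (_ : (fun r => _) = (fun r : R => \int[gamma]_z f (hyp (r, z))))//.
rewrite integral_chi_law0; last 2 first.
- apply: measurable_tonelli => //.
  by apply: (measurableT_comp mf); apply: (measurableT_comp measurable_hyp); meas.
- by move=> x; exact: integral_ge0.
rewrite integral_gamma//; last first.
  by apply: (measurableT_comp mf); apply: (measurableT_comp measurable_hyp); meas.
transitivity (\int[mu]_z g z).
  by apply: eq_integral => z _; rewrite /hyp/= expr0n/= add0r sqrtr_sqr.
(* The integrand is even, so both half-lines contribute equally; this is the factor 2 in the
   constant. *)
transitivity (\int[mu]_(z in `]0%R, +oo[) g z + \int[mu]_(z in `]0%R, +oo[) g z).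
  rewrite -[in LHS](setUv `[0%R, +oo[%classic) ge0_integral_setU//=; last 3 first.
  - exact: measurableC.
  - exact: measurable_funTS.
  - by rewrite disj_set2E setICr.
  rewrite setCitvr integral_itv_bndo_bndc; last exact: measurable_funTS.
  rewrite (_ : \int[mu]_(x in `]-oo, 0%R]) g x = \int[mu]_(x in `]-oo, 0%R]) g (- x)%R); last first.
    by apply: eq_integral => x _; rewrite gE.
  rewrite -ge0_integration_by_substitution0// -integral_itv_obnd_cbnd//.
  exact: measurable_funTS.
rewrite -ge0_integralD//; last 2 first.
- exact: measurable_funTS.
- exact: measurable_funTS.
rewrite -ge0_integralZl//; last 3 first.
- apply: measurable_funTS; apply: emeasurable_funM => //; apply/measurable_EFinP.
  exact: measurable_chi_weight.
- by move=> x _; rewrite mule_ge0// lee_fin chi_weight_ge0.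
- by rewrite lee_fin mulr_ge0// ltW.
apply: eq_integral => z; rewrite inE/= in_itv/= andbT => z0.
have w0 : (0 <= normal_peak 1 * expR (- (z ^+ 2 / 2)))%R by rewrite mulr_ge0 ?expR_ge0 ?ltW.
rewrite /g gtr0_norm// normal_pdf01E powRr0 mul1r -ge0_muleDr ?lee_fin//.
by rewrite -EFinD muleCA -EFinM; congr (_ * _%:E); ring.
Qed.

(* The substitution [z = r t] followed by [v = r * sqrt (1 + t ^ 2)]. *)
Lemma ge0_integral_ratio (p : R) (F : R * R -> \bar R) :
  measurable_fun [set: R * R] F -> (forall x, 0 <= F x) ->
  \int[mu]_(r in `]0%R, +oo[) \int[mu]_z
    (F (r, z) * (r `^ p * expR (- (r ^+ 2 / 2)) * expR (- (z ^+ 2 / 2)))%:E) =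
  \int[mu]_t \int[mu]_(v in `]0%R, +oo[)
    (F (v / Num.sqrt (1 + t ^+ 2), v * t / Num.sqrt (1 + t ^+ 2))%R *
     ((Num.sqrt (1 + t ^+ 2)) `^ (- (p + 2)) * (v `^ (p + 1) * expR (- (v ^+ 2 / 2))))%:E).
Proof.
move=> mF F0.
pose q (t : R) := Num.sqrt (1 + t ^+ 2)%R.
have q0 t : (0 < q t)%R := sqrt1_sqr_gt0 t.
pose G (r t : R) := F (r, r * t)%R *
  (r `^ (p + 1) * expR (- (r ^+ 2 / 2)) * expR (- ((r * t) ^+ 2 / 2)))%:E.
transitivity (\int[mu]_(r in `]0%R, +oo[) \int[mu]_t G r t).
  apply: eq_integral => r; rewrite inE/= in_itv/= andbT => r0.
  pose H z := F (r, z) * (r `^ p * expR (- (r ^+ 2 / 2)) * expR (- (z ^+ 2 / 2)))%:E.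
  have mH : measurable_fun [set: R] H.
    apply: emeasurable_funM; first by apply: (measurableT_comp mF); meas.
    by apply/measurable_EFinP; meas.
  have H0 z : 0 <= H z by rewrite mule_ge0// lee_fin !mulr_ge0 ?powR_ge0 ?expR_ge0.
  have r_neq0 : (r != 0)%R by rewrite gt_eqF.
  have := ge0_integral_affine 0 r_neq0 mH H0; rewrite (gtr0_norm r0) => Hr.
  transitivity (r%:E * \int[mu]_t H (r * t + 0)%R).
    by rewrite Hr muleA -EFinM divff ?mul1e.
  have mHr : measurable_fun [set: R] (fun t => H (r * t + 0)%R).
    by apply: (measurableT_comp mH); meas.
  rewrite -(ge0_integralZl mu measurableT mHr); last 2 first.
  - by move=> t _; exact: H0.
  - by rewrite lee_fin ltW.
  apply: eq_integral => t _; rewrite /G /H addr0 muleCA -EFinM; congr (_ * _%:E).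
  rewrite powRD; last by rewrite r_neq0 implybT.
  by rewrite powRr1 ?ltW//; ring.
have mG : measurable_fun [set: mR * mR] (fun p => G p.1 p.2).
  apply: emeasurable_funM; first by apply: (measurableT_comp mF); meas.
  apply/measurable_EFinP; meas.
  by apply: (measurableT_comp (measurable_powR _)); meas.
rewrite (tonelli_swapD mu mu (measurable_itv `]0%R, +oo[) measurableT mG); last first.
  by move=> r t; rewrite mule_ge0// lee_fin !mulr_ge0 ?powR_ge0 ?expR_ge0.
apply: eq_integral => t _; rewrite -/(q t).
have qt0 : (q t != 0)%R by rewrite gt_eqF.
pose g (v : R) := F (v / q t, v * t / q t)%R * ((v / q t) `^ (p + 1) * expR (- (v ^+ 2 / 2)))%:E.
have mg : measurable_fun [set: R] g.
  apply: emeasurable_funM; first by apply: (measurableT_comp mF); meas.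
  by apply/measurable_EFinP; meas; apply: (measurableT_comp (measurable_powR _)); meas.
have g0 v : 0 <= g v by rewrite mule_ge0// lee_fin !mulr_ge0 ?powR_ge0 ?expR_ge0.
transitivity (\int[mu]_(r in `]0%R, +oo[) g (q t * r)%R).
  apply: eq_integral => r _; rewrite /G /g.
  have -> : (q t * r / q t = r)%R by field.
  have -> : (q t * r * t / q t = r * t)%R by field.
  rewrite -mulrA -expRD; congr (_ * (_ * expR _)%:E).
  have -> : ((q t * r) ^+ 2 = (1 + t ^+ 2) * r ^+ 2)%R by rewrite exprMn /q sqr_sqrt1_sqr.
  by field.
rewrite (ge0_integral_itv0y_scale (q0 t) mg g0).
rewrite -ge0_integralZl//; last 2 first.
- exact: measurable_funTS.
- by rewrite lee_fin invr_ge0 ltW.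
apply: eq_integral => v; rewrite inE/= in_itv/= andbT => v0.
rewrite muleCA -EFinM; congr (_ * _%:E).
rewrite [(v / q t)%R]mulrC powRM ?invr_ge0 ?ltW// -powR_inv1 ?ltW// -powRrM.
rewrite !mulrA; congr (_ * _ * _)%R.
rewrite -powRD; last by rewrite qt0 implybT.
by congr (_ `^ _)%R; ring.
Qed.

(** Up to scale and a constant, the density of Student's t law with [p + 1] degrees of freedom. *)
Let ratio_weight (p : R) (t : R) := ((Num.sqrt (1 + t ^+ 2)) `^ (- (p + 2)))%R.

Let measurable_ratio_weight p : measurable_fun [set: R] (ratio_weight p).
Proof. by apply: (measurableT_comp (measurable_powR _)); meas. Qed.

(** In the coordinates [t = z / r] and [v = hyp (r, z)] the joint density factors. For [F] depending
    on [v] alone this yields the recursion of chi densities, for [F] depending on [t] alone the law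
    of the ratio. *)
Lemma integral_chi_gamma (m : {measure set mR -> \bar R}) (p k : R)
    (F : R * R -> \bar R) : has_chi_density m p k ->
  measurable_fun [set: R * R] F -> (forall x, 0 <= F x) ->
  \int[m]_r \int[gamma]_z F (r, z) = (k * normal_peak 1)%:E *
  \int[mu]_t \int[mu]_(v in `]0%R, +oo[)
    (F (v / Num.sqrt (1 + t ^+ 2), v * t / Num.sqrt (1 + t ^+ 2))%R *
     ((Num.sqrt (1 + t ^+ 2)) `^ (- (p + 2)) * (v `^ (p + 1) * expR (- (v ^+ 2 / 2))))%:E).
Proof.
move=> [k0 mE] mF F0.
have mFr (r : R) : measurable_fun [set: R] (fun z => F (r, z)).
  by apply: (measurableT_comp mF); meas.
have mF2 : measurable_fun [set: mR * mR] (fun q => F (q.1, q.2)).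
  by apply: (measurableT_comp mF); meas.
rewrite mE; last 2 first.
- exact: (measurable_tonelli gamma mF2).
- by move=> r; exact: integral_ge0.
rewrite -(ge0_integral_ratio _ mF F0) EFinM -muleA; congr (_ * _).
have mz r : measurable_fun [set: mR]
  (fun z => F (r, z) * (r `^ p * expR (- (r ^+ 2 / 2)) * expR (- (z ^+ 2 / 2)))%:E).
  by apply: emeasurable_funM; [exact: mFr|apply/measurable_EFinP; meas].
have z0 r z : 0 <= F (r, z) * (r `^ p * expR (- (r ^+ 2 / 2)) * expR (- (z ^+ 2 / 2)))%:E.
  by rewrite mule_ge0// lee_fin !mulr_ge0 ?powR_ge0 ?expR_ge0.
rewrite -ge0_integralZl; last 4 first.
- exact: measurable_itv.
- apply: measurable_funTS.
  apply: (@measurable_tonelli _ _ _ _ _ mu (fun r z : mR =>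
   F (r, z) * (r `^ p * expR (- (r ^+ 2 / 2)) * expR (- (z ^+ 2 / 2)))%:E)) => //.
  apply: emeasurable_funM; first exact: mF2.
  by apply/measurable_EFinP; meas; apply: (measurableT_comp (measurable_powR _)); meas.
- by move=> r _; exact: integral_ge0.
- by rewrite lee_fin normal_peak_ge0.
apply: eq_integral => r _; rewrite (integral_gamma (mFr r))//.
rewrite -ge0_integralZr//; last 3 first.
- apply: emeasurable_funM; first exact: mFr.
  by apply/measurable_EFinP; exact: measurable_normal_pdf.
- by move=> z _; rewrite mule_ge0// lee_fin normal_pdf_ge0.
- by rewrite lee_fin chi_weight_ge0.
rewrite -ge0_integralZl//; last by rewrite lee_fin normal_peak_ge0.
apply: eq_integral => z _; rewrite normal_pdf01E -muleA -EFinM muleCA -EFinM.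
by congr (_ * _%:E); ring.
Qed.

(** As [0 * +oo] is [0] in the extended reals, a product equal to 1 excludes both values for either
    factor. This turns total mass one into finiteness and positivity of an unevaluated normalising
    constant. *)
Lemma ge0_mule_eq1 (x y : \bar R) : 0 <= x -> 0 <= y -> x * y = 1 ->
  exists2 r : R, (0 < r)%R & x = r%:E.
Proof.
move: x => [r| |]// r0 y0 xy1.
- exists r => //; rewrite lt_neqAle -lee_fin r0 andbT eq_sym.
  apply/eqP => rE; move: xy1; rewrite rE mul0e => /eqP.
  by rewrite eq_sym onee_eq0.
- move: xy1; have [->|yn0] := eqVneq y 0.
    by rewrite mule0 => /eqP; rewrite eq_sym onee_eq0.
  by rewrite gt0_mulye// lt0e yn0.
Qed.

(** The integral over [t] splits off as a factor [C], possibly infinite at first; the test function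
    1 has integral 1, which forces the resulting constant to be a positive real. *)
Lemma has_chi_density_hyp_law (m : probability mR R) (p k : R) :
  has_chi_density m p k -> exists k', has_chi_density (hyp_law m) (p + 1)%R k'.
Proof.
move=> mE; have [k0 _] := mE.
pose C := \int[mu]_t (ratio_weight p t)%:E.
have C0 : 0 <= C by apply: integral_ge0 => t _; rewrite lee_fin powR_ge0.
pose kp := (k * normal_peak 1)%R.
have kp0 : (0 < kp)%R by rewrite mulr_gt0// normal_peak_gt0// oner_eq0.
have H (f : R -> \bar R) : measurable_fun [set: R] f -> (forall x, 0 <= f x) ->
    \int[hyp_law m]_x f x = (kp%:E * C) *
    \int[mu]_(u in `]0%R, +oo[) (f u * (u `^ (p + 1) * expR (- (u ^+ 2 / 2)))%:E).
  move=> mf f0; rewrite (integral_hyp_law m mf f0).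
  have mfh : measurable_fun [set: R * R] (fun q => f (hyp q)).
    by apply: (measurableT_comp mf); exact: measurable_hyp.
  rewrite (integral_chi_gamma mE mfh); last by [].
  rewrite -/kp -muleA; congr (_ * _); rewrite -ge0_integralZr; last 4 first.
  - exact: measurableT.
  - by apply/measurable_EFinP; exact: measurable_ratio_weight.
  - by move=> t _; rewrite lee_fin powR_ge0.
  - by apply: integral_ge0 => u _; rewrite mule_ge0// lee_fin chi_weight_ge0.
  apply: eq_integral => t _; rewrite -ge0_integralZl; last 4 first.
  - exact: measurable_itv.
  - apply: measurable_funTS; apply: emeasurable_funM => //.
    by apply/measurable_EFinP; exact: measurable_chi_weight.
  - by move=> u _; rewrite mule_ge0// lee_fin chi_weight_ge0.
  - by rewrite lee_fin powR_ge0.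
  apply: eq_integral => v; rewrite inE/= in_itv/= andbT => v0.
  rewrite [RHS]muleCA -EFinM; congr (f _ * _).
  rewrite /hyp/=; set q := Num.sqrt (1 + t ^+ 2).
  have qn0 : (q != 0)%R by rewrite gt_eqF// sqrt1_sqr_gt0.
  have -> : ((v / q) ^+ 2 + (v * t / q) ^+ 2 = v ^+ 2 * (1 + t ^+ 2) / q ^+ 2)%R by field.
  rewrite sqr_sqrt1_sqr mulfK ?sqrtr_sqr ?gtr0_norm//.
  by rewrite gt_eqF// ltr_pwDl// sqr_ge0.
have := H (cst 1) (measurable_cst _) (fun _ => lee01).
rewrite integral_cst; last exact: measurableT.
rewrite mul1e [in LHS]/=.
set I := \int[mu]_(u in _) _; rewrite probability_setT => /esym HI.
have I0 : 0 <= I.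
  by apply: integral_ge0 => u _; rewrite mule_ge0 ?lee01// lee_fin chi_weight_ge0.
have kC0 : 0 <= kp%:E * C by rewrite mule_ge0// lee_fin ltW.
have [k' k'0 k'E] := ge0_mule_eq1 kC0 I0 HI.
exists k'; split => // f mf f0.
by rewrite -k'E; exact: H.
Qed.

Lemma has_chi_density_chi_law (j : nat) : exists k, has_chi_density (chi_law j.+1) j%:R k.
Proof.
elim: j => [|j [k IH]]; first exact: has_chi_density1.
have [k' IH'] := has_chi_density_hyp_law IH.
by exists k'; rewrite -natr1.
Qed.

(** Here it is the integral over [v] that splits off, and total mass one again makes the constant a
    positive real. *)
Lemma integral_ratio_law (m : probability mR R) (p k : R) :
  has_chi_density m p k -> exists2 C : R, (0 < C)%R &
  forall f : R -> \bar R, measurable_fun [set: R] f -> (forall x, 0 <= f x) ->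
    \int[m]_r \int[gamma]_z f (z / r)%R =
    C%:E * \int[mu]_t (f t * ((Num.sqrt (1 + t ^+ 2)) `^ (- (p + 2)))%:E).
Proof.
move=> mE; have [k0 _] := mE.
pose J := \int[mu]_(v in `]0%R, +oo[) (v `^ (p + 1) * expR (- (v ^+ 2 / 2)))%:E.
have J0 : 0 <= J by apply: integral_ge0 => t _; rewrite lee_fin chi_weight_ge0.
pose kp := (k * normal_peak 1)%R.
have kp0 : (0 < kp)%R by rewrite mulr_gt0// normal_peak_gt0// oner_eq0.
have H (f : R -> \bar R) : measurable_fun [set: R] f -> (forall x, 0 <= f x) ->
    \int[m]_r \int[gamma]_z f (z / r)%R = (kp%:E * J) *
    \int[mu]_t (f t * (ratio_weight p t)%:E).
  move=> mf f0.
  have mfh : measurable_fun [set: R * R] (fun q => f (q.2 / q.1)%R).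
    by apply: (measurableT_comp mf); meas.
  rewrite (integral_chi_gamma mE mfh); last by [].
  rewrite -/kp -muleA; congr (_ * _); rewrite -ge0_integralZl; last 4 first.
  - exact: measurableT.
  - apply: emeasurable_funM; first exact: mf.
    by apply/measurable_EFinP; exact: measurable_ratio_weight.
  - by move=> t _; rewrite mule_ge0// lee_fin powR_ge0.
  - exact: J0.
  apply: eq_integral => t _; rewrite -ge0_integralZr; last 4 first.
  - exact: measurable_itv.
  - by apply: measurable_funTS; apply/measurable_EFinP; exact: measurable_chi_weight.
  - by move=> u _; rewrite lee_fin chi_weight_ge0.
  - by rewrite mule_ge0// lee_fin powR_ge0.
  apply: eq_integral => v; rewrite inE/= in_itv/= andbT => v0.
  set q := Num.sqrt (1 + t ^+ 2).
  have qn0 : (q != 0)%R by rewrite gt_eqF// sqrt1_sqr_gt0.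
  have -> : (v * t / q / (v / q) = t)%R by field; rewrite qn0 gt_eqF.
  by rewrite EFinM muleA [RHS]muleC.
have := H (cst 1) (measurable_cst _) (fun _ => lee01).
under eq_integral do rewrite integral_cst ?measurableT//.
rewrite [in LHS]/= !probability_setT mul1e integral_cst; last exact: measurableT.
rewrite [1 * m _]mul1e (probability_setT m : m setT = 1).
set I := \int[mu]_t _ => /esym HI.
have I0 : 0 <= I.
  by apply: integral_ge0 => u _; rewrite mule_ge0 ?lee01// lee_fin powR_ge0.
have kC0 : 0 <= kp%:E * J by rewrite mule_ge0// lee_fin ltW.
have [C C0 CE] := ge0_mule_eq1 kC0 I0 HI.
by exists C => // f mf f0; rewrite -CE; exact: H.
Qed.

End chi.

(** * Givens rotations *)

Ltac setac := rewrite predeqE => ? /=; tauto.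

Section independent_laws.
Local Open Scope ereal_scope.
Context {R : realType}.
Local Notation mR := (measurableTypeR R).
Local Notation gamma := (@normal_prob R 0 1).

(** Real-valued probabilities let [ring] reorder the long products that express joint
    independence. *)
Definition pr d (S : measurableType d) (m : probability S R) (A : set S) : R :=
  fine (m A).

Lemma prE d (S : measurableType d) (m : probability S R) (A : set S) :
  measurable A -> m A = (pr m A)%:E.
Proof. by move=> mA; rewrite /pr fineK// fin_num_measure. Qed.

Lemma pr_ge0 d (S : measurableType d) (m : probability S R) (A : set S) :
  (0 <= pr m A)%R.
Proof. by rewrite fine_ge0. Qed.

Definition rot (c s : R) (p : mR * mR) : mR * mR :=
  (c * p.1 + s * p.2, - s * p.1 + c * p.2)%R.

Lemma measurable_rot c s : measurable_fun [set: mR * mR] (rot c s).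
Proof. by rewrite /rot; meas. Qed.

Lemma gamma2_rot (c s : R) (C : set (mR * mR)) : (c ^+ 2 + s ^+ 2 = 1)%R ->
  measurable C -> (gamma \x gamma) (rot c s @^-1` C) = (gamma \x gamma) C.
Proof.
move=> cs mC.
have mrC : measurable (rot c s @^-1` C).
  by rewrite -[X in measurable X]setTI; exact: measurable_rot.
pose f (p : mR * mR) : \bar R := (\1_C p)%:E.
have mf : measurable_fun [set: mR * mR] f by apply/measurable_EFinP; exact: measurable_indic.
have f0 p : 0 <= f p by rewrite lee_fin.
have mfp : measurable_fun [set: mR * mR] (fun p => f (p.1, p.2)).
  by apply: (measurableT_comp mf); meas.
have mfr : measurable_fun [set: mR * mR] (fun p => f (rot c s (p.1, p.2))).
  by apply: (measurableT_comp mf); apply: (measurableT_comp (measurable_rot c s)); meas.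
transitivity (\int[gamma]_x \int[gamma]_y f (x, y)); last first.
  rewrite -(tonelli_product gamma gamma mfp); last by [].
  rewrite -[in RHS](setIT C) -integral_indic//.
  by apply: eq_integral => -[].
rewrite -(ge0_integral_rot cs mf f0) -(tonelli_product gamma gamma mfr); last by [].
by rewrite -[in LHS](setIT (_ @^-1` _)) -integral_indic.
Qed.

Context dT (T : measurableType dT) (P : probability T R).

Lemma pair_prob d1 d2 (S1 : measurableType d1) (S2 : measurableType d2)
  (mu : probability S1 R) (nu : probability S2 R)
  (U : T -> S1) (V : T -> S2) (E : set T) (q : R) :
  measurable_fun [set: T] U -> measurable_fun [set: T] V -> measurable E ->
  (0 <= q)%R ->
  (forall A B, measurable A -> measurable B ->
    P (U @^-1` A `&` V @^-1` B `&` E) = (pr mu A * pr nu B * q)%:E) ->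
  forall C, measurable C ->
    P ((fun w => (U w, V w)) @^-1` C `&` E) = (mu \x nu) C * q%:E.
Proof.
move=> mU mV mE q0 H C mC; apply: (pair_law mU mV mE) => // A B mA mB.
apply: (etrans (H _ _ mA mB)); by rewrite !EFinM -!prE.
Qed.

Lemma measurable_preimageT d1 (S1 : measurableType d1) (U : T -> S1) (A : set S1) :
  measurable_fun [set: T] U -> measurable A -> measurable (U @^-1` A).
Proof. by move=> mU mA; rewrite -[X in measurable X]setTI; exact: mU. Qed.

Lemma rot_prob (U V : T -> mR) (E : set T) (q c s : R) :
  measurable_fun [set: T] U -> measurable_fun [set: T] V -> measurable E ->
  (0 <= q)%R -> (c ^+ 2 + s ^+ 2 = 1)%R ->
  (forall a b, measurable a -> measurable b ->
    P (U @^-1` a `&` V @^-1` b `&` E) = (pr gamma a * pr gamma b * q)%:E) ->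
  forall a b, measurable a -> measurable b ->
    P ((fun w => c * U w + s * V w)%R @^-1` a `&`
       (fun w => - s * U w + c * V w)%R @^-1` b `&` E) =
    (pr gamma a * pr gamma b * q)%:E.
Proof.
move=> mU mV mE q0 cs H a b ma mb.
have mab : measurable (a `*` b) by exact: measurableX.
have mr : measurable (rot c s @^-1` (a `*` b)).
  by rewrite -[X in measurable X]setTI; exact: measurable_rot.
have := pair_prob mU mV mE q0 H mr; rewrite (gamma2_rot cs mab) product_measure1E//.
by rewrite EFinM EFinM -!prE.
Qed.

Lemma hyp_prob (beta : probability mR R) (U V : T -> mR) (E : set T) (q : R) :
  measurable_fun [set: T] U -> measurable_fun [set: T] V -> measurable E ->
  (0 <= q)%R ->
  (forall a b, measurable a -> measurable b ->
    P (U @^-1` a `&` V @^-1` b `&` E) = (pr beta a * pr gamma b * q)%:E) ->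
  forall a, measurable a ->
    P ((fun w => hyp (U w, V w)) @^-1` a `&` E) = (pr (hyp_law beta) a * q)%:E.
Proof.
move=> mU mV mE q0 H a ma.
have mh : measurable (@hyp R @^-1` a).
  by rewrite -[X in measurable X]setTI; exact: measurable_hyp.
by have := pair_prob mU mV mE q0 H mh; rewrite EFinM -prE.
Qed.

(* The angle of the rotation that maps [(x, y)] to [(hyp (x, y), 0)]; any
   angle does at the origin. *)
Definition gcos (p : mR * mR) : R := if hyp p == 0%R then 1%R else (p.1 / hyp p)%R.
Definition gsin (p : mR * mR) : R := if hyp p == 0%R then 0%R else (p.2 / hyp p)%R.

Lemma gcos_gsin p : (gcos p ^+ 2 + gsin p ^+ 2 = 1)%R.
Proof.
rewrite /gcos /gsin; case: eqP => [_|/eqP h0]; first by rewrite expr1n expr0n addr0.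
have h2 : (hyp p ^+ 2 = p.1 ^+ 2 + p.2 ^+ 2)%R by rewrite sqr_sqrtr// addr_ge0 ?sqr_ge0.
rewrite !expr_div_n -mulrDl -h2 divff// expf_neq0//.
Qed.

Lemma hyp_gcos p : (hyp p * gcos p = p.1)%R.
Proof.
rewrite /gcos; case: eqP => [h0|/eqP h0]; last by field.
have /eqP := h0; rewrite sqrtr_eq0 => h.
have p10 : (p.1 ^+ 2 = 0)%R.
  by apply/eqP; rewrite eq_le sqr_ge0 andbT (le_trans _ h)// lerDl sqr_ge0.
by move/eqP : p10; rewrite h0 mul0r sqrf_eq0 => /eqP ->.
Qed.

Lemma hyp_gsin p : (hyp p * gsin p = p.2)%R.
Proof.
rewrite /gsin; case: eqP => [h0|/eqP h0]; last by field.
have /eqP := h0; rewrite sqrtr_eq0 => h.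
have p10 : (p.2 ^+ 2 = 0)%R.
  by apply/eqP; rewrite eq_le sqr_ge0 andbT (le_trans _ h)// lerDr sqr_ge0.
by move/eqP : p10; rewrite h0 mul0r sqrf_eq0 => /eqP ->.
Qed.

Lemma measurable_hyp_eq0 : measurable (@hyp R @^-1` [set 0%R]).
Proof. by rewrite -[X in measurable X]setTI; apply: measurable_hyp => //; exact: measurable_set1. Qed.

Lemma gcosE p : gcos p = (\1_(@hyp R @^-1` [set 0%R]) p + p.1 / hyp p)%R.
Proof.
rewrite /gcos indicE; case: eqP => h0.
  by rewrite mem_set// h0 invr0 mulr0 addr0.
by rewrite memNset// add0r.
Qed.

Lemma measurable_gcos : measurable_fun [set: mR * mR] gcos.
Proof.
rewrite (_ : gcos = fun p => \1_(@hyp R @^-1` [set 0%R]) p + p.1 / hyp p)%R; last first.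
  by apply/funext => p; exact: gcosE.
apply: measurable_funD; first by apply: measurable_indic; exact: measurable_hyp_eq0.
by meas; exact: measurable_hyp.
Qed.

Lemma measurable_gsin : measurable_fun [set: mR * mR] gsin.
Proof.
rewrite (_ : gsin = fun p => p.2 / hyp p)%R; first by meas; exact: measurable_hyp.
by apply/funext => p; rewrite /gsin; case: eqP => // ->; rewrite invr0 mulr0.
Qed.

(** The angle is random but depends only on [(A, D)], which is independent of [(U, V)]. At each
    fixed value of [(A, D)] the rotated pair keeps its normal law, so it is independent of [(A, D)]
    and in particular of [hyp (A, D)]. Sections of the product measure make this precise. *)
Lemma givens_prob (alpha : probability mR R) (A D U V : T -> mR) (E : set T) (q : R) :
  measurable_fun [set: T] A -> measurable_fun [set: T] D ->
  measurable_fun [set: T] U -> measurable_fun [set: T] V -> measurable E ->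
  (0 <= q)%R ->
  (forall a b c d, measurable a -> measurable b -> measurable c -> measurable d ->
    P (A @^-1` a `&` (D @^-1` b `&` (U @^-1` c `&` (V @^-1` d `&` E)))) =
    (pr alpha a * pr gamma b * pr gamma c * pr gamma d * q)%:E) ->
  let co w := gcos (A w, D w) in let si w := gsin (A w, D w) in
  forall a c d, measurable a -> measurable c -> measurable d ->
    P ((fun w => hyp (A w, D w)) @^-1` a `&`
       ((fun w => co w * U w + si w * V w)%R @^-1` c `&`
       ((fun w => - si w * U w + co w * V w)%R @^-1` d `&` E))) =
    (pr (hyp_law alpha) a * pr gamma c * pr gamma d * q)%:E.
Proof.
move=> mA mD mU mV mE q0 H co si a c d ma mc md.
pose ag := (alpha \x gamma : probability (mR * mR)%type R).
pose gg := (gamma \x gamma : probability (mR * mR)%type R).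
have mAD : measurable_fun [set: T] (fun w => (A w, D w)) by exact: measurable_fun_pair.
have mUV : measurable_fun [set: T] (fun w => (U w, V w)) by exact: measurable_fun_pair.
have H1 X c' d' : measurable X -> measurable c' -> measurable d' ->
    P ((fun w => (A w, D w)) @^-1` X `&` (U @^-1` c' `&` (V @^-1` d' `&` E))) =
    (pr ag X * (pr gamma c' * pr gamma d' * q))%:E.
  move=> mX mc' md'; rewrite EFinM -(prE ag mX).
  apply: pair_prob => //.
  - by apply: measurableI; [exact: measurable_preimageT|apply: measurableI => //; exact: measurable_preimageT].
  - by rewrite !mulr_ge0// pr_ge0.
  - by move=> a' b' ma' mb'; rewrite -setIA H//; congr _%:E; ring.
have H2 X Y : measurable X -> measurable Y ->
    P ((fun w => (A w, D w)) @^-1` X `&` (fun w => (U w, V w)) @^-1` Y `&` E) =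
    (pr ag X * pr gg Y * q)%:E.
  move=> mX mY.
  rewrite (_ : _ `&` E = (fun w => (U w, V w)) @^-1` Y `&`
    ((fun w => (A w, D w)) @^-1` X `&` E)); last by setac.
  rewrite [RHS](_ : _ = gg Y * (pr ag X * q)%:E); last first.
    by rewrite (prE gg mY) -EFinM; congr _%:E; ring.
  apply: pair_prob => //.
  - by apply: measurableI => //; exact: measurable_preimageT.
  - by rewrite mulr_ge0// pr_ge0.
  - move=> c' d' mc' md'; rewrite (_ : _ `&` (_ `&` E) =
      (fun w => (A w, D w)) @^-1` X `&` (U @^-1` c' `&` (V @^-1` d' `&` E))); last by setac.
    by rewrite H1//; congr _%:E; ring.
pose th (p : (mR * mR) * (mR * mR)) := (hyp p.1, rot (gcos p.1) (gsin p.1) p.2).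
have mth : measurable_fun [set: (mR * mR) * (mR * mR)] th.
  rewrite /th /rot/=; meas.
  - by apply: (measurableT_comp measurable_hyp); meas.
  - by apply: (measurableT_comp measurable_gcos); meas.
  - by apply: (measurableT_comp measurable_gsin); meas.
  - by apply: (measurableT_comp measurable_gsin); meas.
  - by apply: (measurableT_comp measurable_gcos); meas.
pose W := th @^-1` (a `*` (c `*` d)).
have mW : measurable W.
  rewrite -[X in measurable X]setTI; apply: mth => //.
  by apply: measurableX => //; exact: measurableX.
have WE : (ag \x gg) W = (pr (hyp_law alpha) a * (pr gamma c * pr gamma d))%:E.
  rewrite /product_measure1/=.
  have mh : measurable (@hyp R @^-1` a).
    by rewrite -[X in measurable X]setTI; exact: measurable_hyp.
  (* Over [p] the section is either empty or the preimage of [c] times [d] under a fixed rotation,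
     whose mass does not depend on the angle. *)
  transitivity (\int[ag]_p ((\1_(@hyp R @^-1` a) p)%:E * (pr gamma c * pr gamma d)%:E)).
    apply: eq_integral => p _ /=.
    have [pa|pa] := boolP (p \in @hyp R @^-1` a).
      rewrite (_ : xsection W p = rot (gcos p) (gsin p) @^-1` (c `*` d)).
        rewrite gamma2_rot ?gcos_gsin//; last exact: measurableX.
        by rewrite product_measure1E// indicE pa mul1e EFinM -!prE.
      rewrite /xsection predeqE => u; rewrite /= inE /W/th/=; split => [[]//|h].
      by split => //; exact: set_mem pa.
    rewrite (_ : xsection W p = set0) ?measure0 ?indicE ?(negbTE pa) ?mul0e//.
    rewrite predeqE => u; rewrite /xsection/= inE /W/th/=; split => // -[+ _].
    by move=> h; move: pa; rewrite mem_set.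
  rewrite ge0_integralZr//; last 2 first.
  - by apply/measurable_EFinP; exact: measurable_indic.
  - by rewrite lee_fin mulr_ge0// pr_ge0.
  by rewrite integral_indic// setIT [RHS]EFinM -(prE (hyp_law alpha) ma).
rewrite [LHS](_ : _ = P ((fun w => ((A w, D w), (U w, V w))) @^-1` W `&` E)); last first.
  by congr (P _); rewrite predeqE => w; rewrite /W /th /rot /co /si /=; tauto.
rewrite (pair_prob mAD mUV mE q0 H2 mW) WE -EFinM; congr _%:E; ring.
Qed.

End independent_laws.

(** * Absorbing one observation into the triangular array *)

Section state_step.
Local Open Scope ereal_scope.
Context {R : realType}.
Local Notation mR := (measurableTypeR R).
Local Notation gamma := (@normal_prob R 0 1).
Context dT (T : measurableType dT) (P : probability T R).
Variables (alpha beta : probability mR R) (A M1 B t M2 z1 z2 : T -> mR).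
Variables (E : set T) (q c s : R).
Hypotheses (mA : measurable_fun [set: T] A) (mM1 : measurable_fun [set: T] M1)
  (mB : measurable_fun [set: T] B) (mt : measurable_fun [set: T] t)
  (mM2 : measurable_fun [set: T] M2) (mz1 : measurable_fun [set: T] z1)
  (mz2 : measurable_fun [set: T] z2) (mE : measurable E) (q0 : (0 <= q)%R)
  (cs : (c ^+ 2 + s ^+ 2 = 1)%R).

Let M1' w := (c * M1 w + s * z1 w)%R.
Let D w := (- s * M1 w + c * z1 w)%R.
Let M2' w := (c * M2 w + s * z2 w)%R.
Let V w := (- s * M2 w + c * z2 w)%R.
Let t' w := (gcos (A w, D w) * t w + gsin (A w, D w) * V w)%R.
Let e w := (- gsin (A w, D w) * t w + gcos (A w, D w) * V w)%R.

Hypothesis H : forall a m1 b u m2 x y : set mR, measurable a -> measurable m1 ->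
  measurable b -> measurable u -> measurable m2 -> measurable x -> measurable y ->
  P (A @^-1` a `&` (M1 @^-1` m1 `&` (B @^-1` b `&` (t @^-1` u `&` (M2 @^-1` m2 `&`
    (z1 @^-1` x `&` (z2 @^-1` y `&` E))))))) =
  (pr alpha a * pr gamma m1 * pr beta b * pr gamma u * pr gamma m2 *
   pr gamma x * pr gamma y * q)%:E.

Let mM1' : measurable_fun [set: T] M1'. Proof. by rewrite /M1'; meas. Qed.
Let mD : measurable_fun [set: T] D. Proof. by rewrite /D; meas. Qed.
Let mM2' : measurable_fun [set: T] M2'. Proof. by rewrite /M2'; meas. Qed.
Let mV : measurable_fun [set: T] V. Proof. by rewrite /V; meas. Qed.
Let mAD : measurable_fun [set: T] (fun w => (A w, D w)).
Proof. exact: measurable_fun_pair. Qed.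
Let mt' : measurable_fun [set: T] t'.
Proof.
rewrite /t'; meas; first [exact: (measurableT_comp measurable_gcos mAD) |
  exact: (measurableT_comp measurable_gsin mAD) | exact: mt | exact: mV].
Qed.
Let me : measurable_fun [set: T] e.
Proof.
rewrite /e; meas; first [exact: (measurableT_comp measurable_gcos mAD) |
  exact: (measurableT_comp measurable_gsin mAD) | exact: mt | exact: mV].
Qed.

Let transfer (X Y : set T) (x y : R) : P Y = y%:E -> X = Y -> x = y -> P X = x%:E.
Proof. by move=> ? -> ->. Qed.

Local Ltac mset := repeat (apply: measurableI; first exact: measurable_preimageT); try exact: mE.
Local Ltac prods := rewrite ?mulr_ge0 ?pr_ge0 ?q0.

Let H1 a m1 b u m2 x y : measurable a -> measurable m1 ->
  measurable b -> measurable u -> measurable m2 -> measurable x -> measurable y ->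
  P (A @^-1` a `&` (M1' @^-1` m1 `&` (B @^-1` b `&` (t @^-1` u `&` (M2 @^-1` m2 `&`
    (D @^-1` x `&` (z2 @^-1` y `&` E))))))) =
  (pr alpha a * pr gamma m1 * pr beta b * pr gamma u * pr gamma m2 *
   pr gamma x * pr gamma y * q)%:E.
Proof.
move=> ma mm1 mb mu mm2 mx my.
pose F := A @^-1` a `&` (B @^-1` b `&` (t @^-1` u `&` (M2 @^-1` m2 `&` (z2 @^-1` y `&` E)))).
pose r := (pr alpha a * pr beta b * pr gamma u * pr gamma m2 * pr gamma y * q)%R.
have mF : measurable F by rewrite /F; mset.
have r0 : (0 <= r)%R by rewrite /r; prods.
rewrite [LHS](_ : _ = P (M1' @^-1` m1 `&` D @^-1` x `&` F)); last first.
  by congr (P _); rewrite /F; setac.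
rewrite (rot_prob mM1 mz1 mF r0 cs)//; first by congr _%:E; rewrite /r; ring.
move=> f g mf mg; apply: (transfer (H ma mf mb mu mm2 mg my)); [by rewrite /F; setac|by rewrite /r; ring].
Qed.

Let H2 a m1 b u m2 x y : measurable a -> measurable m1 ->
  measurable b -> measurable u -> measurable m2 -> measurable x -> measurable y ->
  P (A @^-1` a `&` (M1' @^-1` m1 `&` (B @^-1` b `&` (t @^-1` u `&` (M2' @^-1` m2 `&`
    (D @^-1` x `&` (V @^-1` y `&` E))))))) =
  (pr alpha a * pr gamma m1 * pr beta b * pr gamma u * pr gamma m2 *
   pr gamma x * pr gamma y * q)%:E.
Proof.
move=> ma mm1 mb mu mm2 mx my.
pose F := A @^-1` a `&` (B @^-1` b `&` (t @^-1` u `&` (M1' @^-1` m1 `&` (D @^-1` x `&` E)))).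
pose r := (pr alpha a * pr beta b * pr gamma u * pr gamma m1 * pr gamma x * q)%R.
have mF : measurable F by rewrite /F; mset.
have r0 : (0 <= r)%R by rewrite /r; prods.
rewrite [LHS](_ : _ = P (M2' @^-1` m2 `&` V @^-1` y `&` F)); last first.
  by congr (P _); rewrite /F; setac.
rewrite (rot_prob mM2 mz2 mF r0 cs)//; first by congr _%:E; rewrite /r; ring.
move=> f g mf mg; apply: (transfer (H1 ma mm1 mb mu mf mx mg)); [by rewrite /F; setac|by rewrite /r; ring].
Qed.

Let H3 a m1 b u m2 x : measurable a -> measurable m1 ->
  measurable b -> measurable u -> measurable m2 -> measurable x ->
  P ((fun w => hyp (A w, D w)) @^-1` a `&` (M1' @^-1` m1 `&` (B @^-1` b `&`
    (t' @^-1` u `&` (M2' @^-1` m2 `&` (e @^-1` x `&` E)))))) =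
  (pr (hyp_law alpha) a * pr gamma m1 * pr beta b * pr gamma u * pr gamma m2 *
   pr gamma x * q)%:E.
Proof.
move=> ma mm1 mb mu mm2 mx.
pose F := M1' @^-1` m1 `&` (B @^-1` b `&` (M2' @^-1` m2 `&` E)).
pose r := (pr gamma m1 * pr beta b * pr gamma m2 * q)%R.
have mF : measurable F by rewrite /F; mset.
have r0 : (0 <= r)%R by rewrite /r; prods.
rewrite [LHS](_ : _ = P ((fun w => hyp (A w, D w)) @^-1` a `&`
   (t' @^-1` u `&` (e @^-1` x `&` F)))); last first.
  by congr (P _); rewrite /F; setac.
rewrite (givens_prob (alpha := alpha) mA mD mt mV mF r0)//; first by congr _%:E; rewrite /r; ring.
move=> f g h i mf mg mh mi; apply: (transfer (H2 mf mm1 mb mh mm2 mg mi)); [by rewrite /F; setac|by rewrite /r; ring].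
Qed.

(** Rotation by the fixed [c] and [s] separates the new means from the residuals [D] and [V] ([H1],
    [H2]). The Givens rotation absorbs [D] into [A] and replaces [(t, V)] by [(t', e)] ([H3]).
    Finally [B] absorbs [e]. At each stage the untouched coordinates are moved into the event
    [F]. *)
Lemma state_step_prob a m1 b u m2 : measurable a -> measurable m1 ->
  measurable b -> measurable u -> measurable m2 ->
  P ((fun w => hyp (A w, D w)) @^-1` a `&` (M1' @^-1` m1 `&`
    ((fun w => hyp (B w, e w)) @^-1` b `&` (t' @^-1` u `&` (M2' @^-1` m2 `&` E))))) =
  (pr (hyp_law alpha) a * pr gamma m1 * pr (hyp_law beta) b * pr gamma u * pr gamma m2 * q)%:E.
Proof.
move=> ma mm1 mb mu mm2.
have mAh : measurable_fun [set: T] (fun w => hyp (A w, D w)).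
  by apply: (measurableT_comp measurable_hyp).
pose F := (fun w => hyp (A w, D w)) @^-1` a `&` (M1' @^-1` m1 `&` (t' @^-1` u `&` (M2' @^-1` m2 `&` E))).
pose r := (pr (hyp_law alpha) a * pr gamma m1 * pr gamma u * pr gamma m2 * q)%R.
have mF : measurable F by rewrite /F; mset.
have r0 : (0 <= r)%R by rewrite /r; prods.
rewrite [LHS](_ : _ = P ((fun w => hyp (B w, e w)) @^-1` b `&` F)); last first.
  by congr (P _); rewrite /F; setac.
rewrite (hyp_prob (beta := beta) mB me mF r0)//; first by congr _%:E; rewrite /r; ring.
move=> f g mf mg; apply: (transfer (H3 ma mm1 mf mu mm2 mg)); [by rewrite /F; setac|by rewrite /r; ring].
Qed.

End state_step.

Section state.
Context {R : realType}.
Local Notation mR := (measurableTypeR R).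
Implicit Types (z : nat -> mR * mR) (j k : nat).

(* A state [(A, m1, B, t, m2)] encodes the triangular factor of the QR
   decomposition of the matrix with rows [(1, z_i.1, z_i.2)]; see [state_spec]. *)
Definition state : Type := (mR * mR * mR * mR * mR)%type.

(** Two observations leave a single degree of freedom beyond the means, so the entry [B] is 0. The
    entry [A] is still signed here; it becomes nonnegative when [hyp] is first applied. *)
Definition state_init (z0 z1 : mR * mR) : state :=
  let q := (Num.sqrt 2)^-1 in
  (- q * z0.1 + q * z1.1, q * z0.1 + q * z1.1, 0,
   - q * z0.2 + q * z1.2, q * z0.2 + q * z1.2).

(** [k] counts the observations already absorbed. The entry for a mean is the sum divided by the
    root of [k], and [c], [s] are the Helmert weights that update it to the sum of [k + 1] terms
    divided by the root of [k + 1]. As two observations are needed to start, [state_of j] has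
    absorbed [j + 2] of them. *)
Definition state_next k (S : state) (y : mR * mR) : state :=
  let c := Num.sqrt (k%:R / k.+1%:R) in
  let s := Num.sqrt (k.+1%:R^-1) in
  let d1 := - s * S.1.1.1.2 + c * y.1 in
  let d2 := - s * S.2 + c * y.2 in
  let p := (S.1.1.1.1, d1) in
  (hyp p, c * S.1.1.1.2 + s * y.1,
   hyp (S.1.1.2, - gsin p * S.1.2 + gcos p * d2),
   gcos p * S.1.2 + gsin p * d2, c * S.2 + s * y.2).

Fixpoint state_of j z : state :=
  if j is j'.+1 then state_next j'.+2 (state_of j' z) (z j'.+2)
  else state_init (z 0%N) (z 1%N).

Lemma sqrt_step k : let c := Num.sqrt (k%:R / k.+1%:R) in
  let s : R := Num.sqrt (k.+1%:R^-1) in c ^+ 2 + s ^+ 2 = 1.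
Proof.
rewrite /= !sqr_sqrtr ?divr_ge0 ?invr_ge0//.
by rewrite -[X in _ + X]mul1r -mulrDl natr1 divff// pnatr_eq0.
Qed.

Lemma hyp_sqr (p : mR * mR) : hyp p ^+ 2 = p.1 ^+ 2 + p.2 ^+ 2.
Proof. by rewrite sqr_sqrtr// addr_ge0 ?sqr_ge0. Qed.

(** Rotations of the rows preserve the Gram matrix of the columns [1], [z.1], [z.2]; the five
    equations are its entries, read off from the triangular factor with corner entry the root of
    [j + 2]. *)
Lemma state_spec j z S : state_of j z = S -> let: (A, m1, B, t, m2) := S in
  [/\ Num.sqrt j.+2%:R * m1 = \sum_(i < j.+2) (z i).1,
      Num.sqrt j.+2%:R * m2 = \sum_(i < j.+2) (z i).2,
      m1 ^+ 2 + A ^+ 2 = \sum_(i < j.+2) (z i).1 ^+ 2,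
      m1 * m2 + A * t = \sum_(i < j.+2) (z i).1 * (z i).2 &
      m2 ^+ 2 + t ^+ 2 + B ^+ 2 = \sum_(i < j.+2) (z i).2 ^+ 2].
Proof.
move=> <-; elim: j => [|j IH].
  rewrite /= !big_ord_recl !big_ord0/= /bump/= !addr0.
  set q := (Num.sqrt 2)^-1.
  have s2 : Num.sqrt 2 * q = 1 :> R by rewrite /q divff// sqrtr_eq0 -ltNge.
  have q2 : q ^+ 2 = 2^-1 :> R by rewrite /q exprVn sqr_sqrtr.
  move: (z 0%N) (z 1%N) => [x0 y0] [x1 y1] /=.
  split.
  - by transitivity (Num.sqrt 2 * q * (x0 + x1)); [ring|rewrite s2 mul1r].
  - by transitivity (Num.sqrt 2 * q * (y0 + y1)); [ring|rewrite s2 mul1r].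
  - by transitivity (2 * q ^+ 2 * (x0 ^+ 2 + x1 ^+ 2)); [ring|rewrite q2; field].
  - by transitivity (2 * q ^+ 2 * (x0 * y0 + x1 * y1)); [ring|rewrite q2; field].
  - by transitivity (2 * q ^+ 2 * (y0 ^+ 2 + y1 ^+ 2)); [ring|rewrite q2; field].
rewrite [state_of j.+1 z]/= -/state_of.
case: (state_of j z) IH => [[[[A m1] B] t] m2] [I1 I2 I3 I4 I5] /=.
have sumS (F : nat -> R) : \sum_(i < j.+3) F i = \sum_(i < j.+2) F i + F j.+2.
  by rewrite big_ord_recr.
rewrite (sumS (fun i => (z i).1)) (sumS (fun i => (z i).2)) (sumS (fun i => (z i).1 ^+ 2)).
rewrite (sumS (fun i => (z i).1 * (z i).2)) (sumS (fun i => (z i).2 ^+ 2)).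
rewrite -I1 -I2 -I3 -I4 -I5.
move: (z j.+2) => [x y] /=.
have := sqrt_step j.+2.
have ck : Num.sqrt j.+3%:R * Num.sqrt (j.+2%:R / j.+3%:R) = Num.sqrt j.+2%:R :> R.
  by rewrite -sqrtrM// mulrC divfK// pnatr_eq0.
have sk : Num.sqrt j.+3%:R * Num.sqrt (j.+3%:R^-1) = 1 :> R.
  by rewrite -sqrtrM// divff ?sqrtr1// pnatr_eq0.
move: ck sk; set c := Num.sqrt (_ / _); set s := Num.sqrt (_^-1) => ck sk /= cs.
set d1 := - s * m1 + c * x; set d2 := - s * m2 + c * y.
have := gcos_gsin (A, d1); have := hyp_gcos (A, d1); have := hyp_gsin (A, d1).
move: (gcos _) (gsin _) => g h /= hd hA gh.
rewrite !hyp_sqr/=; split.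
- by rewrite mulrDr !mulrA ck sk mul1r.
- by rewrite mulrDr !mulrA ck sk mul1r.
- transitivity ((c ^+ 2 + s ^+ 2) * (m1 ^+ 2 + x ^+ 2) + A ^+ 2); first by rewrite /d1; ring.
  by rewrite cs; ring.
(* The products [hyp * g] and [hyp * h] are [A] and [d1], so the new product of [A] and [t] equals
   [A t + d1 d2]. *)
- transitivity ((c * m1 + s * x) * (c * m2 + s * y) + (hyp (A, d1) * g * t + hyp (A, d1) * h * d2)).
    by ring.
  rewrite hA hd; transitivity ((c ^+ 2 + s ^+ 2) * (m1 * m2 + x * y) + A * t).
    by rewrite /d1 /d2; ring.
  by rewrite cs; ring.
- transitivity ((c * m2 + s * y) ^+ 2 + (g ^+ 2 + h ^+ 2) * (t ^+ 2 + d2 ^+ 2) + B ^+ 2); first by ring.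
  rewrite gh; transitivity ((c ^+ 2 + s ^+ 2) * (m2 ^+ 2 + y ^+ 2) + t ^+ 2 + B ^+ 2).
    by rewrite /d2; ring.
  by rewrite cs; ring.
Qed.

End state.

(** * Joint law of the triangular array *)

Section sequential.
Local Open Scope ereal_scope.
Context {R : realType}.
Local Notation mR := (measurableTypeR R).
Local Notation gamma := (@normal_prob R 0 1).
Context dT (T : measurableType dT) (P : probability T R).
Variables (Z : nat -> T -> mR * mR) (n : nat).
Hypothesis mZ : forall k, measurable_fun [set: T] (Z k).

(** Conditions on the observations not yet absorbed. Carrying them through the induction takes the
    place of conditioning on the past. *)
Definition tail (k : nat) (Bs : nat -> set (mR * mR)) : set T :=
  [set w | forall j, (k <= j < n)%N -> Bs j (Z j w)].

Hypothesis lawZ : forall k a b, (k < n)%N -> measurable a -> measurable b ->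
  P (Z k @^-1` (a `*` b)) = (pr gamma a * pr gamma b)%:E.
Hypothesis indepZ : forall k Bs, (k < n)%N -> (forall j, measurable (Bs j)) ->
  P (tail k Bs) = P (Z k @^-1` Bs k) * P (tail k.+1 Bs).

Lemma measurable_tail k Bs : (forall j, measurable (Bs j)) -> measurable (tail k Bs).
Proof.
move=> mBs; rewrite (_ : tail k Bs = \bigcap_(j in [set j | (k <= j < n)%N]) (Z j @^-1` Bs j)).
  by apply: bigcap_measurableType => j _; exact: measurable_preimageT.
by rewrite predeqE => w; split.
Qed.

Let update (k : nat) (X : set (mR * mR)) Bs j := if j == k then X else Bs j.

Let measurable_update k X Bs : measurable X -> (forall j, measurable (Bs j)) ->
  forall j, measurable (update k X Bs j).
Proof. by move=> mX mBs j; rewrite /update; case: ifP. Qed.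

Let tail_update k X Bs : (k < n)%N ->
  tail k (update k X Bs) = Z k @^-1` X `&` tail k.+1 Bs.
Proof.
move=> kn; rewrite predeqE => w; split.
  move=> h; split.
    by have := h k; rewrite /update leqnn kn eqxx; apply.
  move=> j /andP[kj jn]; have := h j.
  by rewrite /update jn (ltnW kj) gtn_eqF//; apply.
move=> [/= Xw h] j /andP[kj jn]; rewrite /update; case: eqP => [->//|/eqP jk].
by apply: h; rewrite jn andbT ltn_neqAle eq_sym jk.
Qed.

Lemma tail_prob k X Bs : (k < n)%N -> measurable X -> (forall j, measurable (Bs j)) ->
  P (Z k @^-1` X `&` tail k.+1 Bs) = P (Z k @^-1` X) * P (tail k.+1 Bs).
Proof.
move=> kn mX mBs; rewrite -(tail_update _ _ kn) indepZ//; last exact: measurable_update.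
congr (P _ * P _); first by rewrite /update eqxx.
rewrite predeqE => w; split => h j /[dup] jk /h; rewrite /update.
  by rewrite gtn_eqF//; case/andP: jk.
by rewrite gtn_eqF//; case/andP: jk.
Qed.

Lemma prob_transfer (X Y : set T) (x y : R) :
  P Y = y%:E -> X = Y -> x = y -> P X = x%:E.
Proof. by move=> ? -> ->. Qed.

Lemma measurable_state_next k (S : T -> state) (y : T -> mR * mR) :
  measurable_fun [set: T] S -> measurable_fun [set: T] y ->
  measurable_fun [set: T] (fun w => state_next k (S w) (y w)).
Proof.
move=> mS my.
have md1 : measurable_fun [set: T] (fun w => - Num.sqrt (k.+1%:R^-1) * (S w).1.1.1.2 +
    Num.sqrt (k%:R / k.+1%:R) * (y w).1)%R by meas.
have md2 : measurable_fun [set: T] (fun w => - Num.sqrt (k.+1%:R^-1) * (S w).2 +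
    Num.sqrt (k%:R / k.+1%:R) * (y w).2)%R by meas.
have mp : measurable_fun [set: T] (fun w => ((S w).1.1.1.1, - Num.sqrt (k.+1%:R^-1) * (S w).1.1.1.2 +
    Num.sqrt (k%:R / k.+1%:R) * (y w).1)%R) by apply: measurable_fun_pair => //; meas.
have mg := measurableT_comp measurable_gcos mp.
have mh := measurableT_comp measurable_gsin mp.
rewrite /state_next; cbv zeta.
apply: measurable_fun_pair; last by meas.
apply: measurable_fun_pair; last first.
  by apply: measurable_funD; apply: measurable_funM; [exact: mg|by meas|exact: mh|exact: md2].
apply: measurable_fun_pair; last first.
  apply: (measurableT_comp measurable_hyp); apply: measurable_fun_pair; first by meas.
  apply: measurable_funD; apply: measurable_funM; [|by meas|exact: mg|exact: md2].
  exact: (measurableT_comp (@oppr_measurable _ setT) mh).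
apply: measurable_fun_pair; last by meas.
by apply: (measurableT_comp measurable_hyp).
Qed.

Lemma measurable_state_of j : measurable_fun [set: T] (fun w => state_of j (Z^~ w)).
Proof.
elim: j => [|j IH].
  rewrite /= /state_init; meas; exact: mZ.
exact: measurable_state_next.
Qed.

(** The statement is for arbitrary [Bs], so that the event on the next observation can be inserted
    into the tail of the induction hypothesis. After [j + 2] observations [A] comes from [j + 1]
    normal variables and [B] from [j]: the degrees of freedom are the sample size minus one and
    minus two. *)
Lemma state_of_prob j Bs : (forall i, measurable (Bs i)) -> (j.+2 <= n)%N ->
  forall a m1 b u m2, measurable a -> measurable m1 -> measurable b ->
    measurable u -> measurable m2 ->
  P ((fun w => (state_of j (Z^~ w)).1.1.1.1) @^-1` a `&`
    ((fun w => (state_of j (Z^~ w)).1.1.1.2) @^-1` m1 `&`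
    ((fun w => (state_of j (Z^~ w)).1.1.2) @^-1` b `&`
    ((fun w => (state_of j (Z^~ w)).1.2) @^-1` u `&`
    ((fun w => (state_of j (Z^~ w)).2) @^-1` m2 `&` tail j.+2 Bs))))) =
  (pr (iter j hyp_law gamma) a * pr gamma m1 * pr (chi_law j) b * pr gamma u *
   pr gamma m2 * pr P (tail j.+2 Bs))%:E.
Proof.
elim: j Bs => [|j IH] Bs mBs jn a m1 b u m2 ma mm1 mb mu mm2.
  have n0 : (0 < n)%N by exact: ltnW.
  pose q : R := ((Num.sqrt 2)^-1)%R.
  have q2 : (q ^+ 2 + q ^+ 2 = 1)%R by rewrite /q exprVn sqr_sqrtr//; field.
  pose E := tail 2 Bs.
  have mE : measurable E by exact: measurable_tail.
  have mZ0 := mZ 0%N; have mZ1 := mZ 1%N.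
  have H x0 y0 x1 y1 : measurable x0 -> measurable y0 -> measurable x1 -> measurable y1 ->
    P ((fun w => (Z 0%N w).1) @^-1` x0 `&` ((fun w => (Z 0%N w).2) @^-1` y0 `&`
      ((fun w => (Z 1%N w).1) @^-1` x1 `&` ((fun w => (Z 1%N w).2) @^-1` y1 `&` E)))) =
    (pr gamma x0 * pr gamma y0 * pr gamma x1 * pr gamma y1 * pr P E)%:E.
    move=> mx0 my0 mx1 my1.
    have m0 : measurable (x0 `*` y0) by exact: measurableX.
    have m1' : measurable (x1 `*` y1) by exact: measurableX.
    have := tail_prob n0 m0 (measurable_update 1 m1' mBs).
    rewrite (tail_update _ _ jn) tail_prob// !lawZ// (prE P mE) -!EFinM => h.
    by apply: (prob_transfer h); [setac|ring].
  have H1 x0 y0 x1 y1 : measurable x0 -> measurable y0 -> measurable x1 -> measurable y1 ->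
    P ((fun w => q * (Z 0%N w).1 + q * (Z 1%N w).1)%R @^-1` x0 `&`
      ((fun w => - q * (Z 0%N w).1 + q * (Z 1%N w).1)%R @^-1` x1 `&`
      ((fun w => (Z 0%N w).2) @^-1` y0 `&` ((fun w => (Z 1%N w).2) @^-1` y1 `&` E)))) =
    (pr gamma x0 * pr gamma y0 * pr gamma x1 * pr gamma y1 * pr P E)%:E.
    move=> mx0 my0 mx1 my1; rewrite setIA.
    pose F := (fun w => (Z 0%N w).2) @^-1` y0 `&` ((fun w => (Z 1%N w).2) @^-1` y1 `&` E).
    pose r := (pr gamma y0 * pr gamma y1 * pr P E)%R.
    have mF : measurable F.
      by apply: measurableI; [|apply: measurableI => //]; apply: measurable_preimageT => //; meas.
    have r0 : (0 <= r)%R by rewrite !mulr_ge0 ?pr_ge0.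
    rewrite (rot_prob (q := r) _ _ mF r0 q2)//; [by congr _%:E; rewrite /r; ring|by meas|by meas|].
    move=> f g mf mg; apply: (prob_transfer (H _ _ _ _ mf my0 mg my1)); last by rewrite /r; ring.
    by rewrite /F; setac.
  have H2 x0 y0 x1 y1 : measurable x0 -> measurable y0 -> measurable x1 -> measurable y1 ->
    P ((fun w => q * (Z 0%N w).2 + q * (Z 1%N w).2)%R @^-1` y0 `&`
      ((fun w => - q * (Z 0%N w).2 + q * (Z 1%N w).2)%R @^-1` y1 `&`
      ((fun w => q * (Z 0%N w).1 + q * (Z 1%N w).1)%R @^-1` x0 `&`
      ((fun w => - q * (Z 0%N w).1 + q * (Z 1%N w).1)%R @^-1` x1 `&` E)))) =
    (pr gamma x0 * pr gamma y0 * pr gamma x1 * pr gamma y1 * pr P E)%:E.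
    move=> mx0 my0 mx1 my1; rewrite setIA.
    pose F := (fun w => q * (Z 0%N w).1 + q * (Z 1%N w).1)%R @^-1` x0 `&`
      ((fun w => - q * (Z 0%N w).1 + q * (Z 1%N w).1)%R @^-1` x1 `&` E).
    pose r := (pr gamma x0 * pr gamma x1 * pr P E)%R.
    have mF : measurable F.
      by apply: measurableI; [|apply: measurableI => //]; apply: measurable_preimageT => //; meas.
    have r0 : (0 <= r)%R by rewrite !mulr_ge0 ?pr_ge0.
    rewrite (rot_prob (q := r) _ _ mF r0 q2)//; [by congr _%:E; rewrite /r; ring|by meas|by meas|].
    move=> f g mf mg; apply: (prob_transfer (H1 _ _ _ _ mx0 mf mx1 mg)); last by rewrite /r; ring.
    by rewrite /F; setac.
  have h := H2 _ _ _ _ mm1 mm2 ma mu.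
  (* [B] is identically 0 at the start, so its event is everything or nothing, just as for the point
     mass [chi_law 0]. *)
  have [b0|b0] := pselect (b 0%R).
    apply: (prob_transfer h); first by rewrite predeqE => w /=; rewrite -/E; tauto.
    have -> : pr (chi_law 0) b = 1%R.
      by rewrite /pr -[chi_law 0 b]/(\d_(0%R : mR) b) diracE mem_set.
    by rewrite [iter _ _ _]/=; ring.
  rewrite (_ : _ `&` _ = set0); last by rewrite predeqE => w /=; tauto.
  have -> : pr (chi_law 0) b = 0%R.
    by rewrite /pr -[chi_law 0 b]/(\d_(0%R : mR) b) diracE memNset.
  by rewrite measure0 mulr0 !mul0r.
pose St w := state_of j (Z^~ w).
have mSt : measurable_fun [set: T] St by exact: measurable_state_of.
have jn' : (j.+2 < n)%N by [].
pose E := tail j.+3 Bs.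
have mE : measurable E by exact: measurable_tail.
have H a' m1' b' u' m2' x y : measurable a' -> measurable m1' -> measurable b' ->
  measurable u' -> measurable m2' -> measurable x -> measurable y ->
  P ((fun w => (St w).1.1.1.1) @^-1` a' `&` ((fun w => (St w).1.1.1.2) @^-1` m1' `&`
    ((fun w => (St w).1.1.2) @^-1` b' `&` ((fun w => (St w).1.2) @^-1` u' `&`
    ((fun w => (St w).2) @^-1` m2' `&` ((fun w => (Z j.+2 w).1) @^-1` x `&`
    ((fun w => (Z j.+2 w).2) @^-1` y `&` E))))))) =
  (pr (iter j (@hyp_law R) gamma) a' * pr gamma m1' * pr (chi_law j) b' * pr gamma u' *
   pr gamma m2' * pr gamma x * pr gamma y * pr P E)%:E.
  move=> ma' mm1' mb' mu' mm2' mx my.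
  have mxy : measurable (x `*` y) by exact: measurableX.
  (* The induction hypothesis is applied with the event on observation [j.+2] placed in the tail,
     from which [tail_update] then extracts it. *)
  have := IH _ (measurable_update j.+2 mxy mBs) (ltnW jn) _ _ _ _ _ ma' mm1' mb' mu' mm2'.
  rewrite (tail_update _ _ jn').
  rewrite [pr P (_ `&` _)](_ : _ = pr gamma x * pr gamma y * pr P E)%R; last first.
    by rewrite /pr tail_prob// lawZ// fineM// fin_num_measure.
  move=> h; apply: (prob_transfer h); [by setac|by ring].
have := @state_step_prob R _ T P (iter j (@hyp_law R) gamma) (chi_law j)
  (fun w => (St w).1.1.1.1) (fun w => (St w).1.1.1.2) (fun w => (St w).1.1.2)
  (fun w => (St w).1.2) (fun w => (St w).2) (fun w => (Z j.+2 w).1)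
  (fun w => (Z j.+2 w).2) E (pr P E) (Num.sqrt (j.+2%:R / j.+3%:R)) (Num.sqrt (j.+3%:R^-1)).
apply=> //; try by (have := mZ j.+2 => mZj; meas).
- exact: pr_ge0.
- exact: sqrt_step.
Qed.

End sequential.

(** * Sums of squares and products of a normal sample *)

Section bvn.
Context {R : realType}.
Local Notation mR := (measurableTypeR R).
Local Notation mu := (@lebesgue_measure R).
Local Notation gamma := (@normal_prob R 0 1).
Variables (m1 m2 s1 s2 rho : R).
Hypotheses (s1_gt0 : 0 < s1) (s2_gt0 : 0 < s2) (rho1 : -1 < rho < 1).

Let tau := Num.sqrt (1 - rho ^+ 2).

Lemma onem_sqr_gt0 (r : R) : -1 < r < 1 -> 0 < 1 - r ^+ 2.
Proof. by move=> /andP[? ?]; nra. Qed.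

Lemma sqrt_onem_sqr_gt0 (r : R) : -1 < r < 1 -> 0 < Num.sqrt (1 - r ^+ 2).
Proof. by move=> /onem_sqr_gt0; rewrite sqrtr_gt0. Qed.

Lemma sqr_sqrt_onem_sqr (r : R) : -1 < r < 1 -> Num.sqrt (1 - r ^+ 2) ^+ 2 = 1 - r ^+ 2.
Proof. by move=> /onem_sqr_gt0 r1; rewrite sqr_sqrtr// ltW. Qed.

Let tau0 : 0 < tau. Proof. exact: sqrt_onem_sqr_gt0. Qed.

Lemma det_bvn_cov : \det (bvn_cov s1 s2 rho) = (s1 * s2) ^+ 2 * (1 - rho ^+ 2).
Proof.
rewrite (expand_det_row _ ord0) !big_ord_recl big_ord0 /cofactor !det_mx11 !mxE/=.
by rewrite /bump/= /bvn_cov ?mxE/=; ring.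
Qed.

Lemma invmx_bvn_cov : invmx (bvn_cov s1 s2 rho) =
  \matrix_(i, j) ((if i == j then (vec2 s1 s2 i 0) ^- 2 else - (rho / (s1 * s2))) / (1 - rho ^+ 2)).
Proof.
set B := \matrix_(_, _) _.
have SB : bvn_cov s1 s2 rho *m B = 1%:M.
  apply/matrixP => i j; rewrite !mxE !big_ord_recl big_ord0 !mxE.
  have r0 : 1 - rho ^+ 2 != 0 by rewrite gt_eqF// onem_sqr_gt0.
  have s10 : s1 != 0 by rewrite gt_eqF.
  have s20 : s2 != 0 by rewrite gt_eqF.
  case: i => [[|[|//]] ?]; case: j => [[|[|//]] ?]; rewrite /= ?mxE/=; field; rewrite ?r0 ?s10 ?s20//.
have [uS _] := mulmx1_unit SB.
by rewrite -[LHS]mulmx1 -SB mulmxA mulVmx// mul1mx.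
Qed.

(** Inverse of the Cholesky parametrisation [x.1 = m1 + s1 z1], [x.2 = m2 + s2 (rho z1 + tau z2)]:
    [std2] is the normalised residual of the second coordinate after regression on the first. *)
Definition std1 (x : mR * mR) : mR := (x.1 - m1) / s1.
Definition std2 (x : mR * mR) : mR := ((x.2 - m2) / s2 - rho * std1 x) / tau.

Lemma bvn_quad (x : R * R) : let y := vec2 x.1 x.2 - vec2 m1 m2 in
  (y^T *m invmx (bvn_cov s1 s2 rho) *m y) 0 0 = std1 x ^+ 2 + std2 x ^+ 2.
Proof.
rewrite invmx_bvn_cov /= !mxE !big_ord_recl !big_ord0 !mxE !big_ord_recl !big_ord0 !mxE/=.
have tau2 : tau ^+ 2 = 1 - rho ^+ 2 := sqr_sqrt_onem_sqr rho1.
rewrite /std2 (expr_div_n _ tau) tau2 /std1.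
by field; rewrite !gt_eqF//= onem_sqr_gt0.
Qed.

Lemma obs_pdfE (x : R * R) : obs_pdf (m1, m2, s1, s2, rho) x =
  (normal_peak 1) ^+ 2 * expR (- ((std1 x ^+ 2 + std2 x ^+ 2) / 2)) / (s1 * s2 * tau).
Proof.
rewrite /obs_pdf /bvn_pdf bvn_quad det_bvn_cov sqrtrM ?sqr_ge0// sqrtr_sqr gtr0_norm ?mulr_gt0//.
have -> : (normal_peak 1) ^+ 2 = (2 * pi)^-1 :> R.
  rewrite /normal_peak exprVn sqr_sqrtr ?expr1n ?mul1r; first by rewrite mulr_natl.
  by rewrite mulrn_wge0// pi_ge0.
have -> : - 2^-1 * (std1 x ^+ 2 + std2 x ^+ 2) = - ((std1 x ^+ 2 + std2 x ^+ 2) / 2) by field.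
by rewrite -/tau !invfM; ring.
Qed.

Lemma measurable_std1 : measurable_fun [set: mR * mR] std1.
Proof. by rewrite /std1; meas. Qed.

Lemma measurable_std2 : measurable_fun [set: mR * mR] std2.
Proof. by rewrite /std2; meas; exact: measurable_std1. Qed.

(** The standardisation is affine and triangular, so an affine substitution in [y] followed by one
    in [x] is enough; their factors [s2 tau] and [s1] cancel the denominator of the density. *)
Lemma obs_pdf_law (a b : set mR) : measurable a -> measurable b ->
  (\int[mu \x mu]_(x in (fun x => (std1 x, std2 x)) @^-1` (a `*` b))
    (obs_pdf (m1, m2, s1, s2, rho) x)%:E = (pr gamma a * pr gamma b)%:E)%E.
Proof.
move=> ma mb.
have mstd : measurable_fun [set: mR * mR] (fun x => (std1 x, std2 x)).
  by apply: measurable_fun_pair; [exact: measurable_std1|exact: measurable_std2].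
have mab : measurable ((fun x => (std1 x, std2 x)) @^-1` (a `*` b)).
  by rewrite -[X in measurable X]setTI; apply: mstd => //; exact: measurableX.
have s1n0 : s1 != 0 by rewrite gt_eqF.
have s2n0 : s2 != 0 by rewrite gt_eqF.
have tn0 : tau != 0 by rewrite gt_eqF.
pose f (z : mR) : \bar R := (\1_a z * normal_pdf 0 1 z)%:E.
pose g (z : mR) : \bar R := (\1_b z * normal_pdf 0 1 z)%:E.
have mf : measurable_fun [set: mR] f.
  apply/measurable_EFinP; apply: measurable_funM; first exact: measurable_indic.
  exact: measurable_normal_pdf.
have mg : measurable_fun [set: mR] g.
  apply/measurable_EFinP; apply: measurable_funM; first exact: measurable_indic.
  exact: measurable_normal_pdf.
have f0 z : (0 <= f z)%E by rewrite lee_fin mulr_ge0// normal_pdf_ge0.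
have g0 z : (0 <= g z)%E by rewrite lee_fin mulr_ge0// normal_pdf_ge0.
have fint (c : set mR) : measurable c ->
    (\int[mu]_z (\1_c z * normal_pdf 0 1 z)%:E = (pr gamma c)%:E)%E.
  move=> mc; rewrite -(prE gamma mc) /normal_prob [RHS]integral_mkcond epatch_indic.
  by apply: eq_integral => z _; rewrite /= -EFinM mulrC.
pose h (x y : mR) : \bar R := (f (std1 (x, y)) * g (std2 (x, y)) * ((s1 * s2 * tau)^-1)%:E)%E.
have mh : measurable_fun [set: mR * mR] (fun p => h p.1 p.2).
  rewrite /h; apply: emeasurable_funM => //; apply: emeasurable_funM.
    apply: (measurableT_comp mf); apply: (measurableT_comp measurable_std1); meas.
  apply: (measurableT_comp mg); apply: (measurableT_comp measurable_std2); meas.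
have h0 x y : (0 <= h x y)%E.
  by rewrite !mule_ge0// lee_fin invr_ge0 !mulr_ge0// ltW.
transitivity (\int[mu \x mu]_p h p.1 p.2)%E.
  rewrite integral_mkcond epatch_indic; apply: eq_integral => -[x y] _.
  rewrite /h /f /g obs_pdfE/= indicE.
  have -> : ((x, y) \in (fun x => (std1 x, std2 x)) @^-1` (a `*` b))%:R =
      \1_a (std1 (x, y)) * \1_b (std2 (x, y)) :> R.
    rewrite !indicE -natrM mulnb; congr (nat_of_bool _)%:R.
    apply/idP/idP; first by move=> /set_mem [/= xa yb]; rewrite !mem_set.
    by move=> /andP[/set_mem xa /set_mem yb]; apply/mem_set.
  rewrite -!EFinM; congr _%:E.
  rewrite !normal_pdf01E [(_ + _) / 2]mulrDl opprD expRD; ring.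
rewrite (tonelli_product mu mu mh h0).
transitivity (\int[mu]_x ((s1^-1 * pr gamma b)%:E * f (s1^-1 * x + - m1 / s1)%R))%E.
  apply: eq_integral => x _.
  have mgs : measurable_fun [set: mR] (fun y => g (std2 (x, y))).
    apply: (measurableT_comp mg); apply: (measurableT_comp measurable_std2).
    by apply: measurable_fun_pair; meas.
  (* [std1] reads only the first coordinate; the 0 is a placeholder showing that the factor is
     constant in [y]. *)
  transitivity (\int[mu]_y ((f (std1 (x, 0%R)) * ((s1 * s2 * tau)^-1)%:E) * g (std2 (x, y))))%E.
    by apply: eq_integral => y _; rewrite /h muleAC.
  rewrite ge0_integralZl; last 4 first.
  - exact: measurableT.
  - exact: mgs.
  - by move=> y _; exact: g0.
  - by rewrite mule_ge0// lee_fin invr_ge0 !mulr_ge0// ltW.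
  have cn0 : (s2 * tau)^-1 != 0 by rewrite invr_neq0// mulf_neq0.
  rewrite (_ : (\int[mu]_y g (std2 (x, y)))%E =
    (\int[mu]_y g ((s2 * tau)^-1 * y + (- m2 / s2 - rho * std1 (x, 0)) / tau)%R)%E); last first.
    apply: eq_integral => y _.
    have -> // : std2 (x, y) = (s2 * tau)^-1 * y + (- m2 / s2 - rho * std1 (x, 0)) / tau.
    by rewrite /std2 /std1/=; move: tn0; move: (tau) => t t0; field; rewrite s1n0 t0.
  rewrite (ge0_integral_affine _ cn0 mg g0) fint// gtr0_norm ?invr_gt0 ?mulr_gt0//.
  rewrite [LHS]muleC muleCA [RHS]muleC; congr (_ * _)%E.
    by congr f; rewrite /std1/=; field.
  rewrite -!EFinM; congr _%:E; field.
  by rewrite s1n0 s2n0 tn0.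
have s1in0 : s1^-1 != 0 by rewrite invr_neq0.
rewrite ge0_integralZl; last 4 first.
- exact: measurableT.
- by apply: (measurableT_comp mf); meas.
- by move=> y _; exact: f0.
- by rewrite lee_fin mulr_ge0 ?invr_ge0 ?pr_ge0// ltW.
rewrite (ge0_integral_affine _ s1in0 mf f0) fint// gtr0_norm ?invr_gt0//.
by rewrite -!EFinM; congr _%:E; field.
Qed.

End bvn.

Section sscp.
Context {R : realType} {n : nat}.
Implicit Types u v : 'I_n.+1 -> R.

Lemma smean_affine (m a b : R) u v :
  smean (fun k => m + (a * u k + b * v k)) = m + (a * smean u + b * smean v).
Proof.
rewrite /smean !big_split/= -!mulr_sumr sumr_const card_ord -(mulr_natr m).
have : n.+1%:R != 0 :> R by rewrite pnatr_eq0.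
by move: n.+1%:R => q q0; field.
Qed.

Lemma sscpE u v : sscp u v = \sum_k u k * v k - (\sum_k u k) * (\sum_k v k) / n.+1%:R.
Proof.
rewrite /sscp; set a := smean u; set b := smean v.
transitivity (\sum_k (u k * v k + (- a * v k + (- b * u k + a * b)))).
  by apply: eq_bigr => k _; ring.
rewrite !big_split/= sumr_const card_ord -!mulr_sumr -(mulr_natr (a * b)) /a /b /smean.
have : n.+1%:R != 0 :> R by rewrite pnatr_eq0.
by move: n.+1%:R => q q0; field.
Qed.

Lemma sscp_lin (a b c d m m' : R) u v :
  sscp (fun k => m + (a * u k + b * v k)) (fun k => m' + (c * u k + d * v k)) =
  a * c * sscp u u + (a * d + b * c) * sscp u v + b * d * sscp v v.
Proof.
rewrite /sscp !smean_affine !mulr_sumr -!big_split/=.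
by apply: eq_bigr => k _; ring.
Qed.

End sscp.

Section sample.
Local Open Scope ereal_scope.
Context {R : realType} {N : nat}.
Local Notation n := N.+3.
Local Notation mR := (measurableTypeR R).
Local Notation gamma := (@normal_prob R 0 1).
Context dT (T : measurableType dT) (P : probability T R).
Variables (X : 'I_n -> {mfun T >-> (R * R)%type}) (m1 m2 s1 s2 rho : R).
Hypotheses (s1_gt0 : (0 < s1)%R) (s2_gt0 : (0 < s2)%R) (rho1 : (-1 < rho < 1)%R).
Hypothesis X_iid : iid_sample P X (m1, m2, s1, s2, rho).

Let stdp (x : mR * mR) : mR * mR := (std1 m1 s1 x, std2 m1 m2 s1 s2 rho x).

Let mstdp : measurable_fun [set: mR * mR] stdp.
Proof. by apply: measurable_fun_pair; [exact: measurable_std1|exact: measurable_std2]. Qed.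

(** Natural number indices suit the recursion. Beyond the sample [inord] falls back on index 0, but
    only indices below the sample size are read by the array and by [tail]. *)
Definition Zstd (k : nat) (w : T) : mR * mR := stdp (X (inord k) w).

Lemma measurable_Zstd k : measurable_fun [set: T] (Zstd k).
Proof. by apply: (measurableT_comp mstdp); exact: (@measurable_funPT _ _ _ _ (X (inord k))). Qed.

Let mstdpre (C : set (mR * mR)) : measurable C -> measurable (stdp @^-1` C).
Proof. by move=> mC; rewrite -[X in measurable X]setTI; exact: mstdp. Qed.

Lemma Zstd_law k a b : measurable a -> measurable b ->
  P (Zstd k @^-1` (a `*` b)) = (pr gamma a * pr gamma b)%:E.
Proof.
move=> ma mb; have [_ Xd] := X_iid.
rewrite -(obs_pdf_law m1 m2 s1_gt0 s2_gt0 rho1 ma mb).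
by apply: (Xd (inord k) (stdp @^-1` (a `*` b))); apply: mstdpre; exact: measurableX.
Qed.

(** Both tails are instances of the product rule for the entire family, with the full space at the
    earlier indices; the two products differ in the factor at [k] only. *)
Lemma Zstd_indep k Bs : (k < n)%N -> (forall j, measurable (Bs j)) ->
  P (tail Zstd n k Bs) = P (Zstd k @^-1` Bs k) * P (tail Zstd n k.+1 Bs).
Proof.
move=> kn mBs; have [Xi _] := X_iid.
pose C (l : nat) (i : 'I_n) : set (R * R) := if (l <= i)%N then stdp @^-1` Bs i else setT.
have mC l i : measurable (C l i) by rewrite /C; case: ifP => // _; exact: mstdpre.
have tailE l : P (tail Zstd n l Bs) = \prod_i P (X i @^-1` C l i).
  rewrite -(Xi _ (mC l)); congr (P _); rewrite predeqE => w; split.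
    move=> h i _; rewrite /C /=; case: ifP => // li.
    by have := h i; rewrite li ltn_ord /Zstd inord_val; apply.
  move=> h j /andP[lj jn]; have := h (inord j) I.
  by rewrite /C /= inordK// lj.
have ki : nat_of_ord (inord k : 'I_n) = k by rewrite inordK.
rewrite !tailE (bigD1 (inord k))//= [in RHS](bigD1 (inord k))//=.
rewrite {1}/C ki leqnn [X in _ * (P X * _)](_ : _ = setT); last first.
  by rewrite /C ki ltnn preimage_setT.
rewrite probability_setT mul1e; congr (_ * _).
apply: eq_bigr => i ik; rewrite /C [(k < i)%N]ltn_neqAle.
case: eqP => // kE; move: ik; rewrite (_ : i = inord k) ?eqxx//.
by apply/val_inj; rewrite /= ki.
Qed.

Let St (w : T) := state_of N.+1 (Zstd^~ w).
Definition stA w := (St w).1.1.1.1.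
Definition stt w := (St w).1.2.
Definition stB w := (St w).1.1.2.

Let mSt : measurable_fun [set: T] St.
Proof. by apply: measurable_state_of => k; exact: measurable_Zstd. Qed.

Lemma measurable_stA : measurable_fun [set: T] stA.
Proof. by rewrite /stA; meas. Qed.
Lemma measurable_stt : measurable_fun [set: T] stt.
Proof. by rewrite /stt; meas. Qed.
Lemma measurable_stB : measurable_fun [set: T] stB.
Proof. by rewrite /stB; meas. Qed.

Lemma st_law a b u : measurable a -> measurable b -> measurable u ->
  P (stA @^-1` a `&` (stt @^-1` u `&` stB @^-1` b)) =
  (pr (iter N.+1 (@hyp_law R) gamma) a * (pr gamma u * pr (chi_law N.+1) b))%:E.
Proof.
move=> ma mb mu.
have h := @state_of_prob _ _ _ _ Zstd n measurable_Zstd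
  (fun k a b _ => @Zstd_law k a b) Zstd_indep N.+1 (fun=> setT)
  (fun=> measurableT) (leqnn _) _ _ _ _ _ ma measurableT mb mu measurableT.
apply: (prob_transfer h).
  rewrite !preimage_setT predeqE => w; split=> /=; last by case=> ? [_ [? []]].
  by case=> ? [? ?]; do 5 split => //.
have tT : tail Zstd n N.+3 (fun=> setT) = setT by rewrite predeqE => w; split.
have -> : pr P (tail Zstd n N.+3 (fun=> setT)) = 1%R by rewrite tT /pr probability_setT.
have -> : pr gamma setT = 1%R by rewrite /pr probability_setT.
by ring.
Qed.

Lemma s_stE w : let tau := Num.sqrt (1 - rho ^+ 2) in
  let x k := X k w in
  [/\ s11 x = s1 ^+ 2 * stA w ^+ 2,
      s12 x = s1 * s2 * stA w * (rho * stA w + tau * stt w) &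
      s22 x = s2 ^+ 2 * ((rho * stA w + tau * stt w) ^+ 2 + (tau * stB w) ^+ 2)]%R.
Proof.
move=> tau x.
pose z1 (k : 'I_n) := (Zstd k w).1; pose z2 (k : 'I_n) := (Zstd k w).2.
have tn0 : (tau != 0)%R by rewrite gt_eqF// sqrt_onem_sqr_gt0.
have x1E : fst \o x = (fun k => m1 + (s1 * z1 k + 0 * z2 k))%R.
  apply/funext => k; rewrite /z1 /Zstd /= /std1 inord_val /x.
  by field; rewrite gt_eqF.
have x2E : snd \o x = (fun k => m2 + (s2 * rho * z1 k + s2 * tau * z2 k))%R.
  apply/funext => k; rewrite /z1 /z2 /Zstd /= /std2 /std1 inord_val /x.
  by rewrite -/tau; move: (tau) tn0 => q q0; field; rewrite q0 !gt_eqF.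
have [S SE] : exists S, state_of N.+1 (Zstd^~ w) = S by exists (state_of N.+1 (Zstd^~ w)).
have := state_spec SE.
rewrite /stA /stB /stt /St; rewrite SE; move: S {SE} => [[[[A M1] B] t] M2].
move=> [I1 I2 I3 I4 I5] /=.
have nn : (Num.sqrt n%:R ^+ 2 = n%:R :> R)%R by rewrite sqr_sqrtr.
have n0 : (n%:R != 0 :> R)%R by rewrite pnatr_eq0.
(* The correction divided by the sample size in [sscpE] is exactly the contribution of [M1] and [M2]
   to the Gram matrix, so centring just removes the means from the array. *)
have z11 : (sscp z1 z1 = A ^+ 2)%R.
  rewrite sscpE -/(z1 _) -I1 (_ : \sum_k _ = M1 ^+ 2 + A ^+ 2)%R; last first.
    by rewrite I3; apply: eq_bigr => k _; rewrite expr2.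
  have -> : (Num.sqrt n%:R * M1 * (Num.sqrt n%:R * M1) = Num.sqrt n%:R ^+ 2 * M1 ^+ 2 :> R)%R by ring.
  by rewrite nn; field.
have z12 : (sscp z1 z2 = A * t)%R.
  rewrite sscpE -I1 -I2 -I4.
  have -> : (Num.sqrt n%:R * M1 * (Num.sqrt n%:R * M2) = Num.sqrt n%:R ^+ 2 * (M1 * M2) :> R)%R by ring.
  by rewrite nn; field.
have z22 : (sscp z2 z2 = t ^+ 2 + B ^+ 2)%R.
  rewrite sscpE -I2 (_ : \sum_k _ = M2 ^+ 2 + t ^+ 2 + B ^+ 2)%R; last first.
    by rewrite I5; apply: eq_bigr => k _; rewrite expr2.
  have -> : (Num.sqrt n%:R * M2 * (Num.sqrt n%:R * M2) = Num.sqrt n%:R ^+ 2 * M2 ^+ 2 :> R)%R by ring.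
  by rewrite nn; field.
rewrite /s11 /s12 /s22 x1E x2E !sscp_lin z11 z12 z22.
by split; ring.
Qed.

End sample.

(** * Quantiles *)

Lemma cvge_gt_ex {R : realType} (u : nat -> \bar R) (l b : \bar R) :
  u @ \oo --> l -> (b < l)%E -> exists n, (b < u n)%E.
Proof.
move=> ul bl; apply: contrapT => h; suff : (l <= b)%E by rewrite leNgt bl.
apply: (cvge_le _ ul); apply: nearW => n; rewrite leNgt; apply/negP => bn.
by apply: h; exists n.
Qed.

Lemma cvge_lt_ex {R : realType} (u : nat -> \bar R) (l b : \bar R) :
  u @ \oo --> l -> (l < b)%E -> exists n, (u n < b)%E.
Proof.
move=> ul bl; apply: contrapT => h; suff : (b <= l)%E by rewrite leNgt bl.
apply: (cvge_ge _ ul); apply: nearW => n; rewrite leNgt; apply/negP => bn.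
by apply: h; exists n.
Qed.

Section level_sets.
Context {R : realType} d (T : measurableType d) (W : T -> R).
Hypothesis mW : measurable_fun [set: T] W.

Lemma measurable_le_set x : measurable [set w | W w <= x].
Proof.
rewrite (_ : [set w | _] = W @^-1` `]-oo, x]); first exact: measurable_preimageT.
by rewrite predeqE => w; rewrite /= in_itv.
Qed.

Lemma measurable_lt_set x : measurable [set w | W w < x].
Proof.
rewrite (_ : [set w | _] = W @^-1` `]-oo, x[); first exact: measurable_preimageT.
by rewrite predeqE => w; rewrite /= in_itv.
Qed.

Lemma measurable_gt_set x : measurable [set w | x < W w].
Proof.
rewrite (_ : [set w | _] = W @^-1` `]x, +oo[); first exact: measurable_preimageT.
by rewrite predeqE => w; rewrite /= in_itv/= andbT.
Qed.

Lemma measurable_eq_set x : measurable [set w | W w = x].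
Proof. exact: (measurable_preimageT mW (measurable_set1 x)). Qed.

Lemma measurable_itv_set x y : measurable [set w | x < W w < y].
Proof.
rewrite (_ : [set w | _] = W @^-1` `]x, y[); first exact: measurable_preimageT.
by rewrite predeqE => w; rewrite /= in_itv.
Qed.

End level_sets.

Section quantiles.
Local Open Scope ereal_scope.
Context {R : realType} d (T : measurableType d) (P : probability T R).
Variable W : T -> R.
Hypothesis mW : measurable_fun [set: T] W.

Let F (x : R) := P [set w | (W w <= x)%R].

Lemma prob_le_homo x y : (x <= y)%R -> F x <= F y.
Proof.
move=> xy; apply: le_measure; rewrite ?inE; try exact: measurable_le_set.
by move=> w /= /le_trans; apply.
Qed.

Let X : {mfun T >-> R} := mfun_Sub (mem_set mW).

Let cdfE x : cdf (X : {RV P >-> R}) x = F x.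
Proof. by rewrite /cdf /distribution /pushforward /F; congr (P _). Qed.

Variable beta : R.
Hypothesis beta01 : (0 < beta < 1)%R.

Let S := [set w : R | beta%:E <= F w].

Let S_neq0 : S !=set0.
Proof.
have := cvg_cdfy1 (X : {RV P >-> R}); case/andP: beta01 => b0 b1.
move=> /cvge_pinftyP/(_ (fun n => n%:R)%R) H.
have {}H : cdf (X : {RV P >-> R}) n%:R @[n --> \oo] --> 1.
  by apply: H; exact/cvgryPge/nbhs_infty_ger.
have [|n hn] := cvge_gt_ex H (b := beta%:E); first by rewrite lte_fin.
by exists n%:R; rewrite /S /= -cdfE ltW.
Qed.

Let S_lbound : exists x, F x < beta%:E.
Proof.
have := cvg_cdfNy0 (X : {RV P >-> R}); case/andP: beta01 => b0 b1.
move=> /cvge_ninftyP/(_ (fun n => - n%:R)%R) H.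
have {}H : cdf (X : {RV P >-> R}) (- n%:R) @[n --> \oo] --> 0.
  by apply: H; apply/cvgNrNy; exact: cvgr_idn.
have [|n hn] := cvge_lt_ex H (b := beta%:E); first by rewrite lte_fin.
by exists (- n%:R)%R; rewrite -cdfE.
Qed.

Let S_has_lbound : has_lbound S.
Proof.
have [x Fx] := S_lbound; exists x => y Sy.
rewrite leNgt; apply/negP => yx.
have := le_lt_trans (le_trans Sy (prob_le_homo (ltW yx))) Fx.
by rewrite ltxx.
Qed.

(** Right continuity of the distribution function places the infimum inside the set over which it is
    taken. *)
Lemma quantile_le g : (quantile P W beta <= g)%R = (beta%:E <= F g).
Proof.
apply/idP/idP => [qg|bg]; last by apply: ge_inf.
have H e : (0 < e)%R -> beta%:E <= F (g + e)%R.
  move=> e0; have : (inf S < g + e)%R by rewrite (le_lt_trans qg)// ltrDl.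
  move=> /(inf_lt S_neq0) [x Sx xg].
  by rewrite (le_trans Sx)// prob_le_homo// ltW.
have c : F (g + n.+1%:R^-1)%R @[n --> \oo] --> F g.
  have := @cdf_right_continuous _ _ _ P X g; rewrite /= cdfE.
  have Fg : F g = (fine (F g))%:E by rewrite fineK// fin_num_measure//; exact: measurable_le_set.
  rewrite Fg => /cvge_at_rightP h.
  suff : cdf (X : {RV P >-> R}) (g + n.+1%:R^-1)%R @[n --> \oo] --> (fine (F g))%:E.
    by under eq_fun do rewrite cdfE.
  apply: h; split; first by move=> n; rewrite ltrDl.
  rewrite -[X in _ --> X]addr0; apply: (@cvgD _ R^o); first exact: cvg_cst.
  exact: cvg_harmonic.
apply: (cvge_ge _ c); apply: nearW => n; exact: H.
Qed.

Hypothesis no_atom : forall x, P [set w | W w = x] = 0.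
Hypothesis interval_gt0 : forall x y, (x < y)%R -> 0 < P [set w | (x < W w < y)%R].

Lemma prob_lt_le x : P [set w | (W w < x)%R] = F x.
Proof.
rewrite /F (_ : [set w | (W w <= x)%R] = [set w | (W w < x)%R] `|` [set w | W w = x]).
  have mx := measurable_eq_set mW x.
  rewrite measureU//; [by rewrite [X in _ + X]no_atom adde0|exact: measurable_lt_set|].
  by rewrite predeqE => w; split => //= -[] /[swap] ->; rewrite ltxx.
rewrite predeqE => w /=; rewrite le_eqVlt; split; last by case=> [->|->]; rewrite ?orbT ?eqxx.
by case/orP => [/eqP ->|->]; [right|left].
Qed.

Lemma prob_lt_homo x y : (x < y)%R -> F x < F y.
Proof.
move=> xy.
have mI := measurable_itv_set mW x y.
apply: (@lt_le_trans _ _ (F x + P [set w | (x < W w < y)%R])).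
  rewrite lteDl; first exact: interval_gt0.
  by rewrite fin_num_measure//; exact: measurable_le_set.
rewrite -measureU//; last 2 first.
- exact: measurable_le_set.
- by rewrite predeqE => w; split => //= -[] ? /andP[]; rewrite ltNge => /negP.
apply: le_measure; rewrite ?inE; [|exact: measurable_le_set|].
- by apply: measurableU => //; exact: measurable_le_set.
- by move=> w /= [/le_trans|/andP[_ /ltW]]//; apply; exact: ltW.
Qed.

(** The strict version needs more: positive mass on intervals makes the distribution function
    strictly increasing, and absence of atoms makes it left continuous. *)
Lemma quantile_lt g : (quantile P W beta < g)%R = (beta%:E < F g).
Proof.
apply/idP/idP => [qg|].
  apply: (@le_lt_trans _ _ (F (quantile P W beta))); last exact: prob_lt_homo.
  by rewrite -quantile_le.
move=> bg.
have c : F (g - n.+1%:R^-1)%R @[n --> \oo] --> F g.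
  rewrite -prob_lt_le.
  rewrite (_ : [set w | (W w < g)%R] = \bigcup_n [set w | (W w <= g - n.+1%:R^-1)%R]); last first.
    rewrite predeqE => w; split => /= [Wg|[n _ /= /le_lt_trans]]; last first.
      by apply; rewrite ltrBlDr ltrDl.
    have /ltr_add_invr [n hn] : (0 < g - W w)%R by rewrite subr_gt0.
    by exists n => //=; rewrite lerBrDr -lerBrDl ltW// (le_lt_trans _ hn)// add0r.
  apply: nondecreasing_cvg_mu.
  - by move=> n; exact: measurable_le_set.
  - by apply: bigcup_measurable => n _; exact: measurable_le_set.
  - move=> n m nm; apply/subsetPset => w /= /le_trans; apply.
    by rewrite lerD2l lerN2 lef_pV2 ?posrE// ler_nat.
have [n /ltW] := cvge_gt_ex c bg.
by rewrite -quantile_le => /le_lt_trans; apply; rewrite ltrBlDr ltrDl.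
Qed.

Lemma prob_quantile : F (quantile P W beta) = beta%:E.
Proof.
apply/eqP; rewrite eq_le leNgt -quantile_lt ltxx/=.
by rewrite -quantile_le.
Qed.

End quantiles.

(** Every real is a quantile, at the level given by the distribution function; the level lies
    strictly between 0 and 1 because there is mass on both sides. A statement about all levels
    thereby becomes one about all arguments of a distribution function. *)
Lemma quantile_prob {R : realType} d (T : measurableType d) (P : probability T R)
    (W : T -> R) (g beta : R) : measurable_fun [set: T] W ->
  (forall x, P [set w | W w = x] = 0%E) ->
  (forall x y, (x < y)%R -> (0 < P [set w | (x < W w < y)%R])%E) ->
  P [set w | W w <= g] = beta%:E -> 0 < beta < 1 /\ quantile P W beta = g.
Proof.
move=> mW n0 i0 Fg.
have b01 : 0 < beta < 1.
  rewrite -!lte_fin -Fg; apply/andP; split.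
    by apply: (le_lt_trans _ (prob_lt_homo mW i0 (_ : g - 1 < g))); rewrite ?ltrBlDr ?ltrDl.
  apply: (lt_le_trans (prob_lt_homo mW i0 (_ : g < g + 1))); first by rewrite ltrDl.
  by apply: probability_le1; exact: measurable_le_set.
split=> //; apply/eqP; rewrite eq_le.
by rewrite (quantile_le P mW b01) Fg lexx/= leNgt (quantile_lt mW b01)// Fg ltxx.
Qed.

(** * Pivots *)

Lemma integral_gt0 {R : realType} d (T : measurableType d)
    (m : {measure set T -> \bar R}) (D : set T) (f : T -> \bar R) :
  measurable D -> measurable_fun D f -> (forall x, D x -> (0 < f x)%E) ->
  (0 < m D)%E -> (0 < \int[m]_(x in D) f x)%E.
Proof.
move=> mD mf f0 mD0; rewrite lt0e; apply/andP; split; last first.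
  by apply: integral_ge0 => x /f0 /ltW.
apply/eqP => If.
have : (\int[m]_(x in D) `|f x| = 0)%E.
  rewrite -[RHS]If; apply: eq_integral => x /set_mem/f0/ltW fx; exact: gee0_abs.
move=> /(ae_eq_integral_abs m mD mf) [N [mN mN0 DN]].
move: mD0; rewrite ltNge => /negP; apply; rewrite -mN0.
apply: le_measure; rewrite ?inE// => x Dx; apply: DN => /=.
by move=> /(_ Dx) fx; have := f0 x Dx; rewrite fx ltxx.
Qed.

Section chi_density.
Local Open Scope ereal_scope.
Context {R : realType}.
Local Notation mu := (@lebesgue_measure R).
Local Notation mR := (measurableTypeR R).
Local Notation gamma := (@normal_prob R 0 1).

(** [hyp] ignores signs, so starting from a normal variable or from its absolute value gives the
    same law, and [hyp_law gamma] agrees with [chi_law 2]. This removes the sign of the initial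
    entry [A]. *)
Lemma has_chi_density_hyp_gamma : exists k, has_chi_density (@hyp_law R gamma) 1 k.
Proof.
have [k [k0 kE]] := @has_chi_density_chi_law R 1.
exists k; split; [exact: k0|move=> f mf f0].
rewrite -(kE f mf f0).
have mh : measurable_fun [set: mR * mR] (fun p => f (hyp (p.1, p.2))).
  by apply: (measurableT_comp mf); apply: (measurableT_comp measurable_hyp); meas.
pose g (r : mR) := \int[gamma]_z f (hyp (r, z)).
have mg : measurable_fun [set: mR] g by apply: measurable_tonelli; [exact: mh|by []].
have g0 r : 0 <= g r by exact: integral_ge0.
have mgh : measurable_fun [set: mR * mR] (fun p => g (hyp (p.1, p.2))).
  by apply: (measurableT_comp mg); apply: (measurableT_comp measurable_hyp); meas.
rewrite [chi_law 2]/= (integral_hyp_law _ mf f0) (integral_hyp_law _ mf f0).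
rewrite -[in RHS]/(g _) (integral_hyp_law _ mg g0).
rewrite (@integral_chi_law0 R (fun r => \int[gamma]_z g (hyp (r, z)))); last 2 first.
- by apply: measurable_tonelli; [exact: mgh|].
- by move=> r; exact: integral_ge0.
apply: eq_integral => s _; rewrite -/(g s) /g; apply: eq_integral => z _.
by rewrite /hyp/= expr0n/= add0r sqrtr_sqr real_normK ?num_real.
Qed.

Lemma has_chi_density_iter_hyp (j : nat) :
  exists k, has_chi_density (iter j.+1 (@hyp_law R) gamma) j.+1%:R k.
Proof.
elim: j => [|j [k IH]]; first exact: has_chi_density_hyp_gamma.
have [k' IH'] := has_chi_density_hyp_law IH.
by exists k'; rewrite -natr1.
Qed.

Lemma has_chi_density_mass (m : probability mR R) (p k : R) (J := cst 1 : R -> \bar R) :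
  has_chi_density m p k ->
  1 = k%:E * \int[mu]_(u in `]0%R, +oo[) (J u * (u `^ p * expR (- (u ^+ 2 / 2)))%:E).
Proof.
move=> [_ mE]; rewrite -(mE _ (measurable_cst 1) (fun=> lee01)).
rewrite integral_cst; last exact: measurableT.
by rewrite mul1e; exact: (esym (probability_setT m)).
Qed.

(** Total mass one fixes the constant, hence the exponent alone fixes the law. This identifies the
    laws built from the sample with those of the square roots of the auxiliary chi-squared
    variables. *)
Lemma has_chi_density_unique (m m' : probability mR R) (p k k' : R) :
  has_chi_density m p k -> has_chi_density m' p k' ->
  k = k' /\ forall A, measurable A -> m A = m' A.
Proof.
move=> [k0 mE] [k'0 mE'].
have H := has_chi_density_mass (conj k0 mE).
have H' := has_chi_density_mass (conj k'0 mE').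
have kk : k = k'.
  move: H H'; set I := \int[mu]_(u in _) _ => /esym H /esym H'.
  have I0 : 0 <= I.
    by apply: integral_ge0 => u _; rewrite mule_ge0 ?lee01// lee_fin chi_weight_ge0.
  have [r r0 Ir] : exists2 r, (0 < r)%R & I = r%:E.
    by apply: (ge0_mule_eq1 I0 (_ : 0 <= k%:E)); rewrite ?lee_fin ?ltW// muleC.
  move: H H'; rewrite Ir -!EFinM => -[kr] [k'r].
  by apply: (mulIf (lt0r_neq0 r0)); rewrite kr k'r.
split; first exact: kk.
move=> A mA; rewrite -[A in m A]setIT -[A in m' A]setIT -!integral_indic//.
have mI : measurable_fun [set: R] (fun x : R => (\1_A x : R)%:E).
  by apply/measurable_EFinP; exact: measurable_indic.
by rewrite (mE _ mI)// (mE' _ mI)// kk.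
Qed.

Lemma has_chi_density_itv (m : probability mR R) (p k : R) :
  has_chi_density m p k -> m `]0%R, +oo[%classic = 1.
Proof.
move=> [k0 mE].
have mI : measurable_fun [set: R] (fun x : R => (\1_(`]0%R, +oo[%classic : set R) x : R)%:E).
  by apply/measurable_EFinP; exact: measurable_indic.
rewrite (has_chi_density_mass (conj k0 mE)).
rewrite -[X in m X]setIT -integral_indic; last 2 first.
- exact: measurableT.
- exact: measurable_itv.
rewrite (mE _ mI); last by move=> x; rewrite lee_fin.
congr (_ * _); apply: eq_integral => u u0.
by rewrite /= indicE u0.
Qed.

(** Nothing is lost by integrating over positive values only, where dividing by the chi variable is
    legitimate. *)
Lemma has_chi_density_integral (m : probability mR R) (p k : R) (f : mR -> \bar R) :
  has_chi_density m p k -> measurable_fun [set: mR] f -> (forall v, 0 <= f v) ->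
  \int[m]_v f v = \int[m]_(v in `]0%R, +oo[) f v.
Proof.
move=> [_ mE] mf f0.
have mI : measurable_fun [set: R] (fun v => f v * (\1_(`]0%R, +oo[%classic : set R) v : R)%:E).
  by apply: emeasurable_funM => //; apply/measurable_EFinP; exact: measurable_indic.
rewrite [RHS]integral_mkcond epatch_indic (mE _ mf f0) (mE _ mI); last first.
  by move=> x; rewrite mule_ge0// lee_fin.
congr (_ * _); apply: eq_integral => v v0.
by rewrite /= indicE v0 mule1.
Qed.

Lemma gamma_itv_gt0 (x y : R) : (x < y)%R -> 0 < gamma `]x, y[%classic.
Proof.
move=> xy; rewrite /normal_prob; apply: integral_gt0 => //.
- by apply: measurable_funTS; apply/measurable_EFinP; exact: measurable_normal_pdf.
- move=> z _; rewrite lte_fin normal_pdf01E mulr_gt0 ?expR_gt0//.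
  by rewrite normal_peak_gt0// oner_eq0.
- rewrite [X in 0 < X](_ : _ = mu (`]x, y[%classic : set R))//.
  by rewrite lebesgue_measure_itv/= lte_fin xy EFinN sube_gt0 lte_fin.
Qed.

Lemma gamma_set1 (x : R) : gamma [set x] = 0.
Proof. exact: integral_set1. Qed.

End chi_density.

Section triple.
Local Open Scope ereal_scope.
Context {R : realType}.
Local Notation mu := (@lebesgue_measure R).
Local Notation mR := (measurableTypeR R).
Local Notation gamma := (@normal_prob R 0 1).
Implicit Types m : probability mR R.

Lemma triple_prob m1 m2 dT (T : measurableType dT) (P : probability T R)
    (U V Z : T -> mR) :
  measurable_fun [set: T] U -> measurable_fun [set: T] V ->
  measurable_fun [set: T] Z ->
  (forall a b c, measurable a -> measurable b -> measurable c ->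
    P (U @^-1` a `&` (V @^-1` b `&` Z @^-1` c)) =
    (pr m1 a * (pr m2 b * pr gamma c))%:E) ->
  forall C, measurable C ->
    P [set w | C (U w, (V w, Z w))] = (m1 \x (m2 \x gamma)) C.
Proof.
move=> mU mV mZ H C mC.
have H1 a D : measurable a -> measurable D ->
    P (U @^-1` a `&` (fun w => (V w, Z w)) @^-1` D `&` setT) =
    (pr m1 a * pr (m2 \x gamma : probability (mR * mR)%type R) D * 1)%:E.
  move=> ma mD; rewrite setIT setIC mulr1 [in RHS]mulrC EFinM -prE//.
  apply: (pair_prob mV mZ) => //; first exact: measurable_preimageT.
    exact: pr_ge0.
  move=> b c mb mc; apply: (prob_transfer (H _ _ _ ma mb mc)); first by setac.
  by rewrite mulrC.
have mVZ : measurable_fun [set: T] (fun w => (V w, Z w)) by exact: measurable_fun_pair.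
by have := pair_prob mU mVZ measurableT ler01 H1 mC; rewrite setIT mule1.
Qed.

Lemma tripleE m1 m2 C : (m1 \x (m2 \x gamma)) C =
  \int[m1]_u \int[m2]_v gamma (xsection (xsection C u) v).
Proof. by []. Qed.

Lemma measurable_triple_inner m2 C : measurable C ->
  measurable_fun [set: mR] (fun u : mR => \int[m2]_v gamma (xsection (xsection C u) v)).
Proof. move=> mC; exact: (measurable_fun_xsection (m2 \x gamma : probability (mR * mR)%type R) mC). Qed.

Variables (c d : R).
Hypothesis c0 : (c != 0)%R.

(* [(c Z + d U) / V] as a function of [(U, (V, Z))]. *)
Definition ratio (p : mR * (mR * mR)) : mR := ((c * p.2.2 + d * p.1) / p.2.1)%R.

Lemma measurable_ratio : measurable_fun [set: mR * (mR * mR)] ratio.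
Proof. by rewrite /ratio; meas. Qed.

Variables (m1 m2 : probability mR R) (p2 k2 : R).
Hypothesis m2E : has_chi_density m2 p2 k2.

(** For fixed [u] and positive [v] the ratio is affine in [z] with nonzero slope, so a level set is
    a single point, which the normal law does not charge. *)
Lemma triple_ratio_eq x : (m1 \x (m2 \x gamma)) [set p | ratio p = x] = 0.
Proof.
have mC : measurable [set p | ratio p = x] := measurable_eq_set measurable_ratio x.
rewrite tripleE; apply: integral0_eq => u _.
rewrite (has_chi_density_integral m2E); last 2 first.
- by apply: measurable_fun_xsection; exact: measurable_xsection.
- by [].
apply: integral0_eq => v; rewrite /= in_itv/= andbT => v0.
rewrite (_ : xsection _ _ = [set (x * v - d * u) / c]%R) ?gamma_set1//.
rewrite predeqE => z; split => [/xsectionP/xsectionP /= <-|/= ->].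
  by rewrite /ratio/=; field; rewrite c0 gt_eqF.
apply/xsectionP/xsectionP => /=.
by rewrite /ratio/=; field; rewrite c0 gt_eqF.
Qed.

(** For fixed [u] and positive [v] the admissible [z] contain an open interval, with end points in
    reversed order when [c] is negative, and the normal law charges it. *)
Lemma triple_ratio_itv_gt0 x y : (x < y)%R ->
  0 < (m1 \x (m2 \x gamma)) [set p | (x < ratio p < y)%R].
Proof.
move=> xy.
have mC : measurable [set p | (x < ratio p < y)%R] := measurable_itv_set measurable_ratio x y.
rewrite tripleE; apply: integral_gt0 => //.
- exact: measurable_triple_inner.
- move=> u _; rewrite (has_chi_density_integral m2E); last 2 first.
  + by apply: measurable_fun_xsection; exact: measurable_xsection.
  + by [].
  apply: integral_gt0 => //.
  + apply: measurable_funTS.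
    by apply: measurable_fun_xsection; exact: measurable_xsection.
  + move=> v; rewrite /= in_itv/= andbT => v0.
    have [l [h [lh sub]]] : exists l h : R, (l < h)%R /\
        forall z, (l < z < h -> x < ratio (u, (v, z)) < y)%R.
      rewrite /ratio/=; have [cp|cn|ce] := ltgtP 0%R c; last by move: (c0); rewrite -ce eqxx.
        exists ((x * v - d * u) / c)%R, ((y * v - d * u) / c)%R; split.
          by rewrite ltr_pM2r ?invr_gt0// ltrD2r ltr_pM2r.
        move=> z; rewrite ltr_pdivrMr// ltr_pdivlMr// ltr_pdivlMr// ltr_pdivrMr//.
        by rewrite ltrBlDr ltrBrDr [(z * c)%R]mulrC.
      exists ((y * v - d * u) / c)%R, ((x * v - d * u) / c)%R; split.
        by rewrite ltr_nM2r ?invr_lt0// ltrD2r ltr_pM2r.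
      move=> z; rewrite ltr_ndivrMr// ltr_ndivlMr// ltr_pdivlMr// ltr_pdivrMr//.
      by rewrite ltrBlDr ltrBrDr [(z * c)%R]mulrC andbC.
    apply: lt_le_trans (gamma_itv_gt0 lh) _; apply: le_measure; rewrite ?inE//.
      by apply: measurable_xsection; exact: measurable_xsection.
    move=> z; rewrite /= in_itv/= => /sub xry.
    by apply/xsectionP/xsectionP.
  + by apply: (lt_le_trans lte01); rewrite -(has_chi_density_itv m2E).
- by apply: (lt_le_trans lte01); rewrite -(probability_setT m1).
Qed.

End triple.

Section chi2.
Local Open Scope ereal_scope.
Context {R : realType}.
Local Notation mu := (@lebesgue_measure R).
Local Notation mR := (measurableTypeR R).
Local Notation gamma := (@normal_prob R 0 1).

Lemma Gamma_ge0 (s : R) : (0 <= Gamma s)%R.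
Proof.
apply: fine_ge0; apply: integral_ge0 => t; rewrite /= in_itv/= andbT => t0.
by rewrite lee_fin mulr_ge0 ?powR_ge0 ?expR_ge0.
Qed.

Lemma chi2_pdf_ge0 (m x : R) : (0 <= chi2_pdf m x)%R.
Proof.
rewrite /chi2_pdf /gamma_pdf; case: ifP => // x0.
by rewrite !mulr_ge0 ?powR_ge0 ?expR_ge0// invr_ge0 Gamma_ge0.
Qed.

Lemma measurable_chi2_pdf (m : R) : measurable_fun [set: R] (chi2_pdf m).
Proof.
rewrite /chi2_pdf /gamma_pdf; apply: measurable_fun_ifT.
- by apply: measurable_fun_ltr; [exact: measurable_cst|exact: measurable_id].
- apply: measurable_funM; last exact: measurable_cst.
  apply: measurable_funM; first by apply: measurable_funM; [exact: measurable_cst|exact: measurable_powR].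
  by meas.
- exact: measurable_cst.
Qed.

Context d (T : measurableType d) (Q : probability T R).

Definition law_of (f : T -> mR) (mf : measurable_fun [set: T] f) : probability mR R :=
  distribution Q (@mfun_Sub _ _ T mR f (mem_set mf)).

Lemma integral_law_of (f : T -> mR) (mf : measurable_fun [set: T] f) (g : mR -> \bar R) :
  measurable_fun [set: mR] g -> (forall x, 0 <= g x) ->
  \int[law_of mf]_x g x = \int[Q]_w g (f w).
Proof. by move=> mg g0; rewrite ge0_integral_distribution. Qed.

(** The substitution [x = u ^ 2] lowers the exponent bookkeeping to [m - 1], and [dx = 2 u du] gives
    the factor 2 in [c]. Only nonnegativity of [Gamma] is known at this point; that [c] is positive
    follows from total mass one. *)
Lemma sqrt_chi2_law (C : {RV Q >-> R}) (m : R) : has_density Q C (chi2_pdf m) ->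
  exists (M : probability mR R) (k : R), has_chi_density M (m - 1) k /\
    forall A, measurable A -> M A = Q ((fun w => Num.sqrt (C w)) @^-1` A).
Proof.
move=> CE.
have mS : measurable_fun [set: T] (fun w => Num.sqrt (C w) : mR).
  by apply: (measurableT_comp measurable_sqrt); exact: (@measurable_funPT _ _ _ _ C).
have mC : measurable_fun [set: T] (C : T -> mR) by exact: (@measurable_funPT _ _ _ _ C).
pose c := (2 * (2^-1 `^ (m / 2) / Gamma (m / 2)))%R : R.
have c_ge0 : (0 <= c)%R by rewrite !mulr_ge0 ?powR_ge0// invr_ge0 Gamma_ge0.
have H (f : R -> \bar R) : measurable_fun [set: R] f -> (forall x, 0 <= f x) ->
  \int[law_of mS]_x f x = c%:E *
    \int[mu]_(u in `]0%R, +oo[) (f u * (u `^ (m - 1) * expR (- (u ^+ 2 / 2)))%:E).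
  move=> mf f0.
  have mfs : measurable_fun [set: R] (fun x => f (Num.sqrt x)).
    by apply: (measurableT_comp mf); exact: measurable_sqrt.
  rewrite integral_law_of; [|exact: mf|exact: f0].
  rewrite -(@integral_law_of _ mC (fun x => f (Num.sqrt x)) mfs); last by [].
  rewrite (@ge0_integral_density _ mR R mu (law_of mC) (chi2_pdf m) (chi2_pdf_ge0 m)
    (measurable_chi2_pdf m) CE _ mfs); last by [].
  pose g x := f (Num.sqrt x) * (chi2_pdf m x)%:E.
  have mg : measurable_fun [set: R] g.
    by apply: emeasurable_funM => //; apply/measurable_EFinP; exact: measurable_chi2_pdf.
  have g0 x : 0 <= g x by rewrite mule_ge0// lee_fin chi2_pdf_ge0.
  transitivity (\int[mu]_(x in `]0%R, +oo[) g x).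
    rewrite [RHS]integral_mkcond epatch_indic; apply: eq_integral => x _ /=.
    rewrite -/(g x) indicE; have [x0|x0] := ltP 0%R x.
      by rewrite mem_set ?mule1//= in_itv/= x0.
    rewrite memNset ?mule0; first by rewrite /g /chi2_pdf /gamma_pdf ltNge x0/= mule0.
    by rewrite /= in_itv/= andbT ltNge x0.
  rewrite -(ge0_integral_sqr mg g0) -ge0_integralZl; last 4 first.
  - exact: measurable_itv.
  - apply: measurable_funTS; apply: emeasurable_funM => //.
    by apply/measurable_EFinP; exact: measurable_chi_weight.
  - by move=> u _; rewrite mule_ge0// lee_fin chi_weight_ge0.
  - by rewrite lee_fin.
  apply: eq_integral => u; rewrite inE/= in_itv/= andbT => u0.
  rewrite /g sqrtr_sqr gtr0_norm// -muleA [RHS]muleCA -!EFinM; congr (_ * _%:E).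
  rewrite /chi2_pdf /gamma_pdf exprn_gt0//.
  have -> : ((u ^+ 2) `^ (m / 2 - 1) = u `^ (m - 1) / u)%R.
    rewrite -powR_mulrn ?ltW// -powRrM mulrBr mulr1 mulrCA divff// mulr1.
    have -> : (m - 2 = (m - 1) + - 1)%R by ring.
    rewrite powRD; last by rewrite (gt_eqF u0) implybT.
    by rewrite powR_inv1// ltW.
  rewrite /c [(2^-1 * u ^+ 2)%R]mulrC.
  move: (_^-1 `^ _)%R ((Gamma _)^-1)%R (u `^ _)%R (expR _) => ? ? ? ?; field.
  by rewrite gt_eqF.
have I0 : 0 <= \int[mu]_(u in `]0%R, +oo[) (cst 1 u * (u `^ (m - 1) * expR (- (u ^+ 2 / 2)))%:E).
  by apply: integral_ge0 => u _; rewrite mule_ge0 ?lee01// lee_fin chi_weight_ge0.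
have := H (cst 1) (measurable_cst _) (fun _ => lee01).
rewrite integral_cst; last exact: measurableT.
rewrite mul1e => /(etrans (esym (probability_setT (law_of mS)))) /esym HI.
have cE0 : 0 <= c%:E by rewrite lee_fin.
have [k k0 kE] := ge0_mule_eq1 cE0 I0 HI.
exists (law_of mS), c; split; last by [].
by split; [case: kE => ->|].
Qed.

Lemma mutually_independent3 (I : finType) (X : I -> {mfun T >-> R}) (i j k : I) :
  mutually_independent Q X -> i != j -> i != k -> j != k ->
  forall a b c, measurable a -> measurable b -> measurable c ->
  Q (X i @^-1` a `&` (X j @^-1` b `&` X k @^-1` c)) =
  Q (X i @^-1` a) * (Q (X j @^-1` b) * Q (X k @^-1` c)).
Proof.
move=> iX ij ik jk a b c ma mb mc.
pose B l : set R := if l == i then a else if l == j then b else if l == k then c else setT.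
have mB l : measurable (B l) by rewrite /B; do !case: ifP => // _.
have Bi : B i = a by rewrite /B eqxx.
have Bj : B j = b by rewrite /B eqxx eq_sym (negbTE ij).
have Bk : B k = c by rewrite /B eqxx eq_sym (negbTE ik) eq_sym (negbTE jk).
have := iX B mB; rewrite (bigD1 i)//= (bigD1 j)/=; last by rewrite eq_sym.
rewrite (bigD1 k)/=; last by rewrite eq_sym ik eq_sym jk.
rewrite Bi Bj Bk big1 ?mule1; last first.
  move=> l /andP[/andP[li lj] lk].
  by rewrite /B (negbTE li) (negbTE lj) (negbTE lk) preimage_setT probability_setT.
move=> <-; congr (Q _); rewrite predeqE => w; split.
  move=> [wi [wj wk]] l _; rewrite /B /=.
  by do !case: eqP => [->//|_].
move=> h; have /= := h k Logic.I; have /= := h j Logic.I; have /= := h i Logic.I.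
by rewrite Bi Bj Bk; split.
Qed.

Lemma chi2_triple (Z C C' : {RV Q >-> R}) (m m' : R) :
  has_density Q Z (normal_pdf 0 1) -> has_density Q C (chi2_pdf m) ->
  has_density Q C' (chi2_pdf m') ->
  (forall a b c, measurable a -> measurable b -> measurable c ->
    Q (C @^-1` a `&` (C' @^-1` b `&` Z @^-1` c)) =
    Q (C @^-1` a) * (Q (C' @^-1` b) * Q (Z @^-1` c))) ->
  exists (M M' : probability mR R) (k k' : R),
    [/\ has_chi_density M (m - 1) k, has_chi_density M' (m' - 1) k' &
     forall D, measurable D ->
       Q [set w | D (Num.sqrt (C w), (Num.sqrt (C' w), Z w))] = (M \x (M' \x gamma)) D].
Proof.
move=> Zd Cd C'd indep.
have [M [k [Mk ME]]] := sqrt_chi2_law Cd.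
have [M' [k' [Mk' ME']]] := sqrt_chi2_law C'd.
exists M, M', k, k'; split; [exact: Mk|exact: Mk'|].
have ms (X : {RV Q >-> R}) : measurable_fun [set: T] (fun w => Num.sqrt (X w) : mR).
  by apply: (measurableT_comp measurable_sqrt); exact: (@measurable_funPT _ _ _ _ X).
apply: triple_prob; [exact: ms|exact: ms|exact: (@measurable_funPT _ _ _ _ Z)|].
move=> a b c ma mb mc.
have ZE : (pr gamma c)%:E = Q (Z @^-1` c).
  by rewrite -(prE gamma mc); exact: (esym (Zd c mc)).
rewrite !EFinM ZE -(prE M ma) -(prE M' mb) (ME _ ma) (ME' _ mb).
have mpre (e : set R) : measurable e -> measurable (@Num.sqrt R @^-1` e).
  by move=> me; rewrite -[X in measurable X]setTI; exact: measurable_sqrt.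
exact: (indep _ _ _ (mpre _ ma) (mpre _ mb) mc).
Qed.

End chi2.

Lemma xsection_xsection T1 T2 T3 (C : set (T1 * (T2 * T3))) u v :
  xsection (xsection C u) v = [set z | C (u, (v, z))].
Proof.
by rewrite predeqE => z; split => [/xsectionP/xsectionP//|h]; apply/xsectionP/xsectionP.
Qed.

(** * Ratio laws determine their degrees of freedom *)

Section ratio_uniqueness.
Local Open Scope ereal_scope.
Context {R : realType}.
Local Notation mu := (@lebesgue_measure R).
Local Notation mR := (measurableTypeR R).
Local Notation gamma := (@normal_prob R 0 1).

(** Each density is the derivative of the common distribution function, by the fundamental theorem
    of calculus at a point of continuity. *)
Lemma continuous_cdf_inj (f g : R -> R) :
  (forall x, 0 <= f x)%R -> (forall x, 0 <= g x)%R -> continuous f -> continuous g ->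
  \int[mu]_x (f x)%:E < +oo -> \int[mu]_x (g x)%:E < +oo ->
  (forall x, \int[mu]_(t in `]-oo, x]) (f t)%:E = \int[mu]_(t in `]-oo, x]) (g t)%:E) ->
  f =1 g.
Proof.
move=> f0 g0 cf cg If Ig H x.
have ii (h : R -> R) : (forall x, 0 <= h x)%R -> continuous h -> \int[mu]_x (h x)%:E < +oo ->
    forall u, mu.-integrable [set` Interval -oo%O (BRight u)] (EFin \o h).
  move=> h0 ch Ih u; apply: (@integrableS _ _ _ mu setT) => //.
  have mh : measurable_fun [set: R] h by exact: continuous_measurable_fun.
  apply/integrableP; split; first exact/measurable_EFinP.
  rewrite (_ : (fun x => _) = (fun x => (h x)%:E))//.
  by apply/funext => y; rewrite /= ger0_norm.
have xx : (x < x + 1)%R by rewrite ltrDl.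
have [|_ <-] := (fun b => continuous_FTC1 xx (ii f f0 cf If _) b (cf x)).
  by rewrite ltNyr.
have [|_ <-] := (fun b => continuous_FTC1 xx (ii g g0 cg Ig _) b (cg x)).
  by rewrite ltNyr.
by congr (derive1 _ x); apply/funext => y; rewrite /Rintegral H.
Qed.

Lemma continuous_ratio_weight (C p : R) :
  continuous (fun t : R => C * (Num.sqrt (1 + t ^+ 2)) `^ (- p))%R.
Proof.
have -> : (fun t : R => C * (Num.sqrt (1 + t ^+ 2)) `^ (- p))%R =
    (fun t : R => C * expR (- p * ln (Num.sqrt (1 + t ^+ 2))))%R.
  by apply/funext => t; rewrite /powR gt_eqF// sqrt1_sqr_gt0.
move=> t; apply: cvgM; first exact: cvg_cst.
apply: (@continuous_comp _ _ _ (fun t : R => - p * ln (Num.sqrt (1 + t ^+ 2)))%R (@expR R)).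
  apply: cvgM; first exact: cvg_cst.
  apply: (@continuous_comp _ _ _ (fun t : R => Num.sqrt (1 + t ^+ 2))%R (@ln R)).
    apply: (@continuous_comp _ _ _ (fun t : R => 1 + t ^+ 2)%R (@Num.sqrt R)).
      by apply: cvgD; [exact: cvg_cst|exact: exprn_continuous].
    exact: sqrt_continuous.
  by apply: continuous_ln; exact: sqrt1_sqr_gt0.
exact: continuous_expR.
Qed.

(** Equal distribution functions give equal continuous densities [C (1 + t ^ 2) ^ (- (p + 2) / 2)].
    At [t = 0] they show that the constants agree, and at [t = 1] the powers of the root of 2 agree,
    hence the exponents. *)
Lemma ratio_law_inj (m m' : probability mR R) (p k p' k' : R) :
  has_chi_density m p k -> has_chi_density m' p' k' ->
  (forall g, \int[m]_r gamma [set z | (z / r <= g)%R] =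
             \int[m']_r gamma [set z | (z / r <= g)%R]) ->
  p = p'.
Proof.
move=> mE mE' H.
have [C C0 CE] := integral_ratio_law mE.
have [C' C'0 CE'] := integral_ratio_law mE'.
pose f (C p t : R) := (C * (Num.sqrt (1 + t ^+ 2)) `^ (- (p + 2)))%R.
have f0 (c q t : R) : (0 < c)%R -> (0 <= f c q t)%R.
  by move=> c0; rewrite mulr_ge0 ?powR_ge0 ?ltW.
have key (M : probability mR R) (c q : R) (c0 : (0 < c)%R)
  (ME : forall h : R -> \bar R, measurable_fun [set: R] h -> (forall x, 0 <= h x) ->
    \int[M]_r \int[gamma]_z h (z / r)%R =
    c%:E * \int[mu]_t (h t * ((Num.sqrt (1 + t ^+ 2)) `^ (- (q + 2)))%:E)) :
  \int[mu]_x (f c q x)%:E < +oo /\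
  forall g, \int[M]_r gamma [set z | (z / r <= g)%R] = \int[mu]_(t in `]-oo, g]) (f c q t)%:E.
  have mw : measurable_fun [set: R] (fun t : R => (Num.sqrt (1 + t ^+ 2)) `^ (- (q + 2)))%R.
    by apply: (measurableT_comp (measurable_powR _)); meas.
  have fE (h : R -> \bar R) : measurable_fun [set: R] h -> (forall x, 0 <= h x) ->
      \int[M]_r \int[gamma]_z h (z / r)%R = \int[mu]_t (h t * (f c q t)%:E).
    move=> mh h0; rewrite (ME _ mh h0) -ge0_integralZl; last 4 first.
    - exact: measurableT.
    - by apply: emeasurable_funM => //; exact/measurable_EFinP.
    - by move=> t _; rewrite mule_ge0// lee_fin powR_ge0.
    - by rewrite lee_fin ltW.
    by apply: eq_integral => t _; rewrite muleCA -EFinM.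
  split.
    have := fE (cst 1) (measurable_cst _) (fun=> lee01).
    under [in RHS]eq_integral do rewrite mul1e.
    move=> <-; rewrite (_ : (fun r => _) = cst 1); last first.
      apply/funext => r; rewrite integral_cst; last exact: measurableT.
      by rewrite mul1e; exact: (probability_setT gamma).
    rewrite integral_cst; last exact: measurableT.
    by rewrite mul1e; apply: (le_lt_trans (probability_le1 M measurableT)); exact: ltry.
  move=> g.
  have mI : measurable_fun [set: R] (fun x : R => (\1_(`]-oo, g]%classic : set R) x : R)%:E).
    by apply/measurable_EFinP; exact: measurable_indic.
  rewrite [RHS]integral_mkcond epatch_indic.
  transitivity (\int[mu]_t (((\1_(`]-oo, g]%classic : set R) t : R)%:E * (f c q t)%:E))); last first.
    by apply: eq_integral => t _; rewrite muleC.
  rewrite -(fE _ mI); last by move=> x; rewrite lee_fin.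
  apply: eq_integral => r _.
  rewrite -[X in gamma X]setIT -integral_indic; last 2 first.
  - exact: measurableT.
  - by apply: measurable_le_set; meas.
  apply: eq_integral => z _; congr (_%:E); rewrite !indicE; congr (nat_of_bool _)%:R.
have [Lf fE] := key m C p C0 CE.
have [Lf' fE'] := key m' C' p' C'0 CE'.
have ff : f C p =1 f C' p'.
  apply: continuous_cdf_inj; [by move=> x; exact: f0|by move=> x; exact: f0|
    exact: continuous_ratio_weight|exact: continuous_ratio_weight|exact: Lf|exact: Lf'|].
  by move=> x; rewrite -fE -fE' H.
have CC : C = C'.
  by have := ff 0%R; rewrite /f expr0n/= addr0 sqrtr1 !powR1 !mulr1.
have := ff 1%R; rewrite /f CC => /(mulfI (lt0r_neq0 C'0)).
have s0 : (0 < Num.sqrt (1 + 1 ^+ 2) :> R)%R by exact: sqrt1_sqr_gt0.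
move=> /(congr1 (@ln R)); rewrite !ln_powR => /mulIf h.
have /oppr_inj/addIr // : (- (p + 2) = - (p' + 2))%R.
apply: h; rewrite gt_eqF// ln_gt0//.
by rewrite -[ltLHS]sqrtr1 ltr_sqrt// ?expr1n ?ltrDl// addr_gt0.
Qed.

(* Since [u] and [v] are positive, [(c z + d u) / v <= 0] means [z / u <= - d / c]. *)
Lemma triple_ratio_le0 (m1 m2 : probability mR R) (p1 k1 p2 k2 c d : R) : (0 < c)%R ->
  has_chi_density m1 p1 k1 -> has_chi_density m2 p2 k2 ->
  (m1 \x (m2 \x gamma)) [set p | (ratio c d p <= 0)%R] =
  \int[m1]_u gamma [set z | (z / u <= - d / c)%R].
Proof.
move=> c0 m1E m2E.
have mC := measurable_le_set (measurable_ratio c d) 0%R.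
have mD : measurable [set q : mR * mR | (q.2 / q.1 <= - d / c)%R].
  by apply: measurable_le_set; meas.
have DE u : xsection [set q : mR * mR | (q.2 / q.1 <= - d / c)%R] u = [set z | (z / u <= - d / c)%R].
  by rewrite predeqE => z; split => [/xsectionP|h]; [|apply/xsectionP].
rewrite tripleE (has_chi_density_integral m1E); last 2 first.
- exact: measurable_triple_inner.
- by move=> u; exact: integral_ge0.
rewrite [RHS](has_chi_density_integral m1E); last 2 first.
- under eq_fun do rewrite -DE.
  exact: measurable_fun_xsection.
- by [].
apply: eq_integral => u; rewrite inE/= in_itv/= andbT => u0.
rewrite (has_chi_density_integral m2E); last 2 first.
- by apply: measurable_fun_xsection; exact: measurable_xsection.
- by [].
transitivity (\int[m2]_(v in `]0%R, +oo[) cst (gamma [set z | (z / u <= - d / c)%R]) v).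
  apply: eq_integral => v; rewrite inE/= in_itv/= andbT => v0; congr (gamma _).
  rewrite xsection_xsection predeqE => z; rewrite /ratio/=.
  rewrite pmulr_lle0 ?invr_gt0// ler_pdivrMr// mulrAC ler_pdivlMr//.
  have -> // : (c * z + d * u <= 0)%R = (z * c <= - d * u)%R.
  by rewrite -[RHS]subr_le0; congr (_ <= _)%R; ring.
rewrite integral_cst; last exact: measurable_itv.
by rewrite -[RHS]mule1; congr (_ * _); exact: (has_chi_density_itv m2E).
Qed.

(** This is the pivot at [rho = 0]: the numerator loses its chi variable, which integrates out, and
    only the denominator's degrees of freedom remain visible. *)
Lemma triple_ratio_snd (m1 m2 : probability mR R) (p2 k2 : R) (g : R) :
  has_chi_density m2 p2 k2 ->
  (m1 \x (m2 \x gamma)) [set p | (ratio 1 0 p <= g)%R] =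
  \int[m2]_u gamma [set z | (z / u <= g)%R].
Proof.
move=> m2E.
rewrite tripleE.
transitivity (\int[m1]_u cst (\int[m2]_v gamma [set z | (z / v <= g)%R]) u).
  apply: eq_integral => u _; apply: eq_integral => v _; congr (gamma _).
  by rewrite xsection_xsection predeqE => z; rewrite /ratio/= mul1r mul0r addr0.
rewrite integral_cst; last exact: measurableT.
by rewrite -[RHS]mule1; congr (_ * _); exact: (probability_setT m1).
Qed.

End ratio_uniqueness.

(** * The posterior distribution *)

Section likelihood.
Context {R : realType} {N : nat}.
Local Notation n := N.+1.
Local Notation mR := (measurableTypeR R).
Variables (a b : R).

(* What remains of likelihood times prior after integrating out the means,
   up to a constant. *)
Definition reduced_density (S11 S12 S22 s1 s2 rho : R) : R :=
  (s1 * s2 * Num.sqrt (1 - rho ^+ 2)) `^ (- N%:R) *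
  expR (- ((S11 / s1 ^+ 2 - 2 * rho * S12 / (s1 * s2) + S22 / s2 ^+ 2) /
           (1 - rho ^+ 2) / 2)) *
  (s1 `^ (3 - a) * s2 `^ (2 - b) * (1 - rho ^+ 2) `^ (2 - b / 2))^-1.

Lemma sum_sqr (u : 'I_n -> R) :
  \sum_k u k ^+ 2 = sscp u u + n%:R * smean u ^+ 2.
Proof.
rewrite sscpE /smean; under eq_bigr do rewrite expr2.
have : n%:R != 0 :> R by rewrite pnatr_eq0.
by move: n%:R => q q0; field.
Qed.

(** Each sum of squares splits into the part about the mean and [n] times the squared mean; only the
    latter involves [m1] and [m2]. One factor [(s1 s2 tau)^-1] is set apart since integrating out
    the means produces its inverse, which is why [reduced_density] carries the power [N = n - 1]. *)
Lemma likelihood_priorE (x : 'I_n -> R * R) (m1 m2 s1 s2 rho : R)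
  (xb := (smean (fst \o x), smean (snd \o x))) : 0 < s1 -> 0 < s2 -> -1 < rho < 1 ->
  likelihood x (m1, m2, s1, s2, rho) * prior a b (m1, m2, s1, s2, rho) =
  (normal_peak 1 ^+ 2) ^+ n * reduced_density (s11 x) (s12 x) (s22 x) s1 s2 rho *
  (s1 * s2 * Num.sqrt (1 - rho ^+ 2))^-1 *
  (expR (- (n%:R * std2 m1 m2 s1 s2 rho xb ^+ 2 / 2)) * expR (- (n%:R * std1 m1 s1 xb ^+ 2 / 2))).
Proof.
move=> s10 s20 r1; set tau := Num.sqrt _.
have tau0 : 0 < tau by exact: sqrt_onem_sqr_gt0.
have tau2 : tau ^+ 2 = 1 - rho ^+ 2 by exact: sqr_sqrt_onem_sqr.
rewrite /likelihood /prior.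
under eq_bigr do rewrite obs_pdfE//.
rewrite -/tau; move: (normal_peak 1) => pk.
have -> : \prod_(k < n) (pk ^+ 2 *
    expR (- ((std1 m1 s1 (x k) ^+ 2 + std2 m1 m2 s1 s2 rho (x k) ^+ 2) / 2)) / (s1 * s2 * tau)) =
    (pk ^+ 2) ^+ n * (s1 * s2 * tau) ^- n *
    expR (- (\sum_k (std1 m1 s1 (x k) ^+ 2) + \sum_k (std2 m1 m2 s1 s2 rho (x k) ^+ 2)) / 2).
  rewrite big_split/= big_split/= !prodr_const card_ord -exprVn -expR_sum.
  rewrite mulrAC; congr (_ * expR _).
  by rewrite -big_split/= mulNr mulr_suml -sumrN.
pose u (k : 'I_n) := std1 m1 s1 (x k); pose v (k : 'I_n) := std2 m1 m2 s1 s2 rho (x k).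
have uE : u = fun k => - m1 / s1 + (s1^-1 * (fst \o x) k + 0 * (snd \o x) k).
  by apply/funext => k; rewrite /u /std1/=; field; rewrite gt_eqF.
have vE : v = fun k => (- m2 / s2 + rho * m1 / s1) / tau +
    (- rho / (s1 * tau) * (fst \o x) k + (s2 * tau)^-1 * (snd \o x) k).
  apply/funext => k; rewrite /v /std2 /std1/= -/tau.
  by move: (tau) tau0 => t t0; field; rewrite !gt_eqF.
rewrite (sum_sqr u) (sum_sqr v).
have -> : smean u = std1 m1 s1 xb.
  by rewrite uE smean_affine /std1/=; field; rewrite gt_eqF.
have -> : smean v = std2 m1 m2 s1 s2 rho xb.
  rewrite vE smean_affine /std2 /std1/= -/tau.
  by move: (tau) tau0 => t t0; field; rewrite !gt_eqF.
have st0 : 0 < s1 * s2 * tau by rewrite !mulr_gt0.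
rewrite /reduced_density -/tau powRN powR_mulrn ?(ltW st0)//.
pose q := (s11 x / s1 ^+ 2 - 2 * rho * s12 x / (s1 * s2) + s22 x / s2 ^+ 2) / (1 - rho ^+ 2) / 2.
have qE : sscp u u + sscp v v = 2 * q.
  rewrite uE vE !sscp_lin -!/(s11 x) -!/(s12 x) -!/(s22 x) /q -tau2.
  (* The square of [rho] is expressed through [tau]; the remaining identity is then rational in
     [tau], with [rho] occurring linearly. *)
  have -> : - rho / (s1 * tau) * (- rho / (s1 * tau)) = (1 - tau ^+ 2) / (s1 * tau) ^+ 2.
    by rewrite tau2; move: (tau) tau0 => t t0; field; rewrite !gt_eqF.
  by move: (tau) tau0 => t t0; field; rewrite !gt_eqF.
rewrite -/q.
have -> : (- (sscp u u + n%:R * std1 m1 s1 xb ^+ 2 +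
      (sscp v v + n%:R * std2 m1 m2 s1 s2 rho xb ^+ 2)) / 2) =
    - q + (- (n%:R * std2 m1 m2 s1 s2 rho xb ^+ 2 / 2) + - (n%:R * std1 m1 s1 xb ^+ 2 / 2)).
  have -> : sscp v v = 2 * q - sscp u u by rewrite -qE; ring.
  by move: (n%:R) => ?; field.
have -> : (s1 * s2 * tau) ^- n = (s1 * s2 * tau) ^- N / (s1 * s2 * tau).
  by rewrite exprS invfM mulrC.
rewrite !expRD; move: (_ ^- N) ((s1 * s2 * tau)^-1) ((_ * _ `^ _)^-1) ((pk ^+ 2) ^+ n) => ? ? ? ?.
by ring.
Qed.

End likelihood.

Section tonelli_iterated.
Local Open Scope ereal_scope.
Context d1 d2 (T1 : measurableType d1) (T2 : measurableType d2) (R : realType).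
Variables (m1 : {sigma_finite_measure set T1 -> \bar R})
  (m2 : {sigma_finite_measure set T2 -> \bar R}).

(* The library only infers this structure for products of finite measures. *)
Definition sigma_finite_prod : {sigma_finite_measure set (T1 * T2)%type -> \bar R} :=
  SigmaFiniteMeasure.Pack (SigmaFiniteMeasure.Class
    (lebesgue_integral_fubini.measure_function_isMeasure__to__measure_function_Content_isMeasure m1 m2)
    (lebesgue_integral_fubini.measure_function_Measure_isSigmaFinite__to__measure_function_isSFinite m1 m2)
    (lebesgue_integral_fubini.measure_function_Measure_isSigmaFinite__to__measure_function_isSigmaFinite m1 m2)).

Lemma tonelli_product_sym (f : T1 -> T2 -> \bar R) :
  measurable_fun [set: T1 * T2] (fun p => f p.1 p.2) -> (forall x y, 0 <= f x y) ->
  \int[m1 \x m2]_p f p.1 p.2 = \int[m2]_y \int[m1]_x f x y.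
Proof. by move=> mf f0; rewrite tonelli_product// tonelli_swap. Qed.

End tonelli_iterated.

Section tonelli5.
Local Open Scope ereal_scope.
Context {R : realType}.
Local Notation mu := (@lebesgue_measure R).
Local Notation mR := (measurableTypeR R).

(** The parameters are listed with the means first. Reversing the outer order puts [rho] outermost
    and the means innermost, where they can be integrated out for fixed scales and correlation. *)
Lemma tonelli5 (f : mR -> mR -> mR -> mR -> mR -> \bar R) :
  measurable_fun [set: mR * mR * mR * mR * mR]
    (fun p => f p.1.1.1.1 p.1.1.1.2 p.1.1.2 p.1.2 p.2) ->
  (forall x y z t u, 0 <= f x y z t u) ->
  \int[mu \x mu \x mu \x mu \x mu]_p f p.1.1.1.1 p.1.1.1.2 p.1.1.2 p.1.2 p.2 =
  \int[mu]_u \int[mu]_t \int[mu]_z \int[mu]_x \int[mu]_y f x y z t u.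
Proof.
move=> mf f0.
pose m2 := sigma_finite_prod mu mu; pose m3 := sigma_finite_prod m2 mu.
pose m4 := sigma_finite_prod m3 mu.
rewrite (@tonelli_product_sym _ _ _ mR R m4 mu
  (fun (p : mR * mR * mR * mR) u => f p.1.1.1 p.1.1.2 p.1.2 p.2 u))//.
apply: eq_integral => u _.
have mfu : measurable_fun [set: mR * mR * mR * mR] (fun p => f p.1.1.1 p.1.1.2 p.1.2 p.2 u).
  exact: (measurable_fun_pair1 u mf).
rewrite (@tonelli_product_sym _ _ _ mR R m3 mu
  (fun (p : mR * mR * mR) t => f p.1.1 p.1.2 p.2 t u))//.
apply: eq_integral => t _.
have mft : measurable_fun [set: mR * mR * mR] (fun p => f p.1.1 p.1.2 p.2 t u).
  exact: (measurable_fun_pair1 t mfu).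
rewrite (@tonelli_product_sym _ _ _ mR R m2 mu (fun (p : mR * mR) z => f p.1 p.2 z t u))//.
apply: eq_integral => z _.
have mfz : measurable_fun [set: mR * mR] (fun p => f p.1 p.2 z t u).
  exact: (measurable_fun_pair1 z mft).
exact: (@tonelli_product _ _ mR mR R mu mu (fun x y => f x y z t u)).
Qed.

End tonelli5.

Lemma measurable_powR_comp {R : realType} dT (T : measurableType dT) (f : T -> R) (p : R) :
  measurable_fun [set: T] f -> measurable_fun [set: T] (fun w => f w `^ p).
Proof. by move=> mf; apply: (measurableT_comp (measurable_powR _)). Qed.

Lemma measurable_indic_comp {R : realType} dT (T : measurableType dT) (f : T -> R) (D : set R) :
  measurable D -> measurable_fun [set: T] f -> measurable_fun [set: T] (fun w => \1_D (f w) : R).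
Proof. by move=> mD mf; apply: (measurableT_comp (measurable_indic mD)). Qed.

Lemma measurable_reduced_density {R : realType} dT (T : measurableType dT) (N : nat) (a b : R)
    (f1 f2 f3 f4 f5 f6 : T -> R) :
  measurable_fun [set: T] f1 -> measurable_fun [set: T] f2 -> measurable_fun [set: T] f3 ->
  measurable_fun [set: T] f4 -> measurable_fun [set: T] f5 -> measurable_fun [set: T] f6 ->
  measurable_fun [set: T]
    (fun w => reduced_density (N := N) a b (f1 w) (f2 w) (f3 w) (f4 w) (f5 w) (f6 w)).
Proof.
move=> mf1 mf2 mf3 mf4 mf5 mf6; rewrite /reduced_density.
by meas; try by []; apply: measurable_powR_comp; meas.
Qed.

Lemma reduced_density_ge0 {R : realType} (N : nat) (a b : R) (S11 S12 S22 s1 s2 rho : R) :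
  0 <= reduced_density (N := N) a b S11 S12 S22 s1 s2 rho.
Proof. by rewrite /reduced_density !mulr_ge0 ?expR_ge0 ?invr_ge0 ?mulr_ge0 ?powR_ge0. Qed.

Lemma integral_support {R : realType} (D : set R) (f g : R -> \bar R) :
  (forall x, x \in D -> f x = g x) -> (forall x, x \notin D -> f x = 0%E) ->
  (\int[lebesgue_measure]_x f x = \int[lebesgue_measure]_(x in D) g x)%E.
Proof.
move=> fg f0; rewrite [RHS]integral_mkcond epatch_indic; apply: eq_integral => x _.
rewrite /= indicE; have [xD|xD] := boolP (x \in D); first by rewrite mule1 fg.
by rewrite mule0 f0.
Qed.

Section posterior_mass.
Local Open Scope ereal_scope.
Context {R : realType} {N : nat}.
Local Notation n := N.+1.
Local Notation mu := (@lebesgue_measure R).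
Local Notation mR := (measurableTypeR R).
Variables (a b : R).

Let phi (z : R) : R := expR (- (n%:R * z ^+ 2 / 2)).

Let phi_gt0 z : (0 < phi z)%R. Proof. exact: expR_gt0. Qed.

Let mphi : measurable_fun [set: R] phi.
Proof. by rewrite /phi; meas. Qed.

Lemma integral_phi : exists2 G : R, (0 < G)%R & \int[mu]_z (phi z)%:E = G%:E.
Proof.
have n0 : (0 < Num.sqrt n%:R :> R)%R by rewrite sqrtr_gt0.
have pk0 : (0 < normal_peak 1 :> R)%R by rewrite normal_peak_gt0// oner_eq0.
exists ((Num.sqrt n%:R)^-1 * (normal_peak 1)^-1)%R; first by apply: mulr_gt0; rewrite invr_gt0; [exact: n0|exact: pk0].
pose g (z : R) : \bar R := ((normal_peak 1)^-1 * normal_pdf 0 1 z)%:E.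
have mg : measurable_fun [set: R] g.
  apply/measurable_EFinP; apply: measurable_funM; first exact: measurable_cst.
  exact: measurable_normal_pdf.
have g0 z : 0 <= g z by rewrite lee_fin mulr_ge0 ?normal_pdf_ge0// invr_ge0 ltW.
transitivity (\int[mu]_z g (Num.sqrt n%:R * z + 0)%R).
  apply: eq_integral => z _; rewrite /g addr0 normal_pdf01E mulrA mulVf ?gt_eqF// mul1r /phi.
  by rewrite exprMn sqr_sqrtr.
have nn0 : (Num.sqrt n%:R != 0 :> R)%R by rewrite gt_eqF.
rewrite (ge0_integral_affine 0 nn0 mg g0) gtr0_norm// EFinM; congr (_ * _).
rewrite /g; under eq_integral do rewrite EFinM.
rewrite ge0_integralZl; last 4 first.
- exact: measurableT.
- by apply/measurable_EFinP; exact: measurable_normal_pdf.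
- by move=> z _; rewrite lee_fin normal_pdf_ge0.
- by rewrite lee_fin invr_ge0 ltW.
by rewrite integral_normal_pdf mule1.
Qed.

Let G : R := fine (\int[mu]_z (phi z)%:E).
Let GE : \int[mu]_z (phi z)%:E = G%:E.
Proof. by rewrite /G; have [g _ ->] := integral_phi. Qed.
Let G0 : (0 < G)%R.
Proof. by rewrite /G; have [g g0 ->] := integral_phi. Qed.

(** Collects the normal peaks of the [n] observations and the two Gaussian integrals over the means.
    Its positivity is all that is used, since it cancels in the posterior. *)
Definition mass_const : R := ((normal_peak 1 ^+ 2) ^+ n * G ^+ 2)%R.

Lemma mass_const_gt0 : (0 < mass_const)%R.
Proof. by rewrite /mass_const mulr_gt0// ?exprn_gt0// normal_peak_gt0// oner_eq0. Qed.

Let integral_means (s1 s2 rho y1 y2 : R) (tau := Num.sqrt (1 - rho ^+ 2)) :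
  (0 < s1)%R -> (0 < s2)%R -> (-1 < rho < 1)%R ->
  \int[mu]_m1 \int[mu]_m2 (phi (std2 m1 m2 s1 s2 rho (y1, y2)) * phi (std1 m1 s1 (y1, y2)))%:E =
  (s1 * s2 * tau * G ^+ 2)%:E.
Proof.
move=> s10 s20 r1.
have t0 : (0 < tau)%R by exact: sqrt_onem_sqr_gt0.
have mpE : measurable_fun [set: R] (fun z => (phi z)%:E) by exact/measurable_EFinP.
have pE0 z : 0 <= (phi z)%:E by rewrite lee_fin ltW.
transitivity (\int[mu]_m1 ((s2 * tau * G)%:E * (phi (- s1^-1 * m1 + y1 / s1))%:E)).
  apply: eq_integral => m1 _.
  have cn0 : (- (s2 * tau)^-1 != 0)%R by rewrite oppr_eq0 invr_eq0 gt_eqF// mulr_gt0.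
  pose d0 := ((y2 / s2 - rho * std1 m1 s1 (y1, y2)) / tau)%R.
  transitivity (\int[mu]_m2 ((phi (- s1^-1 * m1 + y1 / s1))%:E * (phi (- (s2 * tau)^-1 * m2 + d0))%:E)).
    apply: eq_integral => m2 _; rewrite -EFinM mulrC; congr (_%:E).
    congr (phi _ * phi _)%R.
      by rewrite /std1/=; field; rewrite gt_eqF.
    rewrite /std2 /d0 -/tau /=; move: (std1 _ _ _) => q.
    by move: (tau) t0 => t t0; field; rewrite !gt_eqF.
  rewrite ge0_integralZl; last 4 first.
  - exact: measurableT.
  - by apply: (measurableT_comp mpE); meas.
  - by move=> y _; exact: pE0.
  - exact: pE0.
  rewrite (ge0_integral_affine d0 cn0 mpE pE0) GE normrN gtr0_norm ?invr_gt0 ?mulr_gt0//.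
  by rewrite invrK -EFinM muleC.
have cn0 : (- s1^-1 != 0)%R by rewrite oppr_eq0 invr_eq0 gt_eqF.
rewrite ge0_integralZl; last 4 first.
- exact: measurableT.
- by apply: (measurableT_comp mpE); meas.
- by move=> y _; exact: pE0.
- by rewrite lee_fin !mulr_ge0// ltW.
rewrite (ge0_integral_affine _ cn0 mpE pE0) GE normrN gtr0_norm ?invr_gt0//.
by rewrite invrK -!EFinM; congr (_%:E); ring.
Qed.

Definition reduced_mass (I : set R) (S11 S12 S22 : R) : \bar R :=
  \int[mu]_(rho in `](-1)%R, 1%R[) \int[mu]_(s2 in `]0%R, +oo[) \int[mu]_(s1 in `]0%R, +oo[)
    (mass_const * (\1_I rho * reduced_density (N := N) a b S11 S12 S22 s1 s2 rho))%:E.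

Lemma posterior_massE (x : 'I_n -> R * R) (I : set R) : measurable I ->
  posterior_mass a b x [set th | I th.2] = reduced_mass I (s11 x) (s12 x) (s22 x).
Proof.
move=> mI.
pose y1 := smean (fst \o x); pose y2 := smean (snd \o x).
(* The indicators of the parameter space are built into [A], because Tonelli's theorem is applied on
   the full space, where for instance the inverse of [s1 s2 tau] could be negative. *)
pose A (s1 s2 rho : R) : R := (\1_(`](-1)%R, 1%R[%classic : set R) rho *
  \1_(`]0%R, +oo[%classic : set R) s2 * \1_(`]0%R, +oo[%classic : set R) s1 *
  (\1_I rho * ((normal_peak 1 ^+ 2) ^+ n *
     reduced_density (N := N) a b (s11 x) (s12 x) (s22 x) s1 s2 rho *
     (s1 * s2 * Num.sqrt (1 - rho ^+ 2))^-1)))%R.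
have A0 s1 s2 rho : (0 <= A s1 s2 rho)%R.
  rewrite /A !indicE; have [s10|] := boolP (s1 \in _); last by rewrite mulr0 mul0r.
  have [s20|] := boolP (s2 \in _); last by rewrite mulr0 !mul0r.
  move: s10 s20 => /set_mem; rewrite /= in_itv/= andbT => s10 /set_mem; rewrite /= in_itv/= andbT => s20.
  have := reduced_density_ge0 N a b (s11 x) (s12 x) (s22 x) s1 s2 rho.
  move: (reduced_density _ _ _ _ _ _ _ _) (normal_peak_ge0 (1 : R)) => q; move: (normal_peak 1) => pk pk0 q0.
  by rewrite !mulr_ge0// ?exprn_ge0 ?invr_ge0 ?mulr_ge0 ?sqrtr_ge0 ?(ltW s10) ?(ltW s20).
pose f m1 m2 s1 s2 rho : \bar R := (A s1 s2 rho)%:E *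
  (phi (std2 m1 m2 s1 s2 rho (y1, y2)) * phi (std1 m1 s1 (y1, y2)))%:E.
have f0 m1 m2 s1 s2 rho : 0 <= f m1 m2 s1 s2 rho.
  by rewrite mule_ge0// lee_fin// mulr_ge0// ltW.
have mf : measurable_fun [set: mR * mR * mR * mR * mR]
    (fun p => f p.1.1.1.1 p.1.1.1.2 p.1.1.2 p.1.2 p.2).
  rewrite /f /A; apply: emeasurable_funM; apply/measurable_EFinP.
    apply: measurable_funM; last first.
      apply: measurable_funM; first by apply: (measurable_indic_comp mI); meas.
      apply: measurable_funM; last by meas.
      apply: measurable_funM; first exact: measurable_cst.
      by apply: measurable_reduced_density; meas.
    by apply: measurable_funM; first apply: measurable_funM; apply: measurable_indic_comp; meas.
  by rewrite /std1 /std2 /std1; apply: measurable_funM; apply: (measurableT_comp mphi); meas.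
transitivity (\int[mu \x mu \x mu \x mu \x mu]_p f p.1.1.1.1 p.1.1.1.2 p.1.1.2 p.1.2 p.2).
  rewrite /posterior_mass integral_mkcond epatch_indic.
  apply: eq_integral => -[[[[m1 m2] s1] s2] rho] _.
  transitivity ((likelihood x (m1, m2, s1, s2, rho) * prior a b (m1, m2, s1, s2, rho))%:E *
    (\1_(param_space `&` [set th | I th.2]) (m1, m2, s1, s2, rho))%:E); first by [].
  transitivity (f m1 m2 s1 s2 rho); last by [].
  rewrite /f /A !indicE; have [|/negP th] := boolP (_ \in param_space `&` _).
    move=> /set_mem [[/= s10 s20 r1] Ir]; move: r1; rewrite ltr_norml => r1.
    have r1' : rho \in (`](-1)%R, 1%R[%classic : set R) by rewrite mem_set//= in_itv.
    have s10' : s1 \in (`]0%R, +oo[%classic : set R) by rewrite mem_set//= in_itv/= s10.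
    have s20' : s2 \in (`]0%R, +oo[%classic : set R) by rewrite mem_set//= in_itv/= s20.
    rewrite likelihood_priorE// r1' s10' s20' (mem_set Ir) mule1 -EFinM.
    rewrite -!/(phi _) -/y1 -/y2.
    move: (reduced_density _ _ _ _ _ _ _ _) (normal_peak 1) (phi _) (phi _) => ? ? ? ?.
    by rewrite !mulr1n !mul1r.
  rewrite mule0; apply/esym.
  have [r1|] := boolP (rho \in (`]_, _[%classic : set R)); last by rewrite !mul0r mul0e.
  have [s20|] := boolP (s2 \in _); last by rewrite mulr0 !mul0r mul0e.
  have [s10|] := boolP (s1 \in _); last by rewrite mulr0 !mul0r mul0e.
  have [Ir|] := boolP (rho \in I); last by rewrite !mul0r mulr0 mul0e.
  exfalso; apply: th; apply/mem_set; split; last by move/set_mem: Ir.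
  move: r1 s20 s10 => /set_mem; rewrite /= !in_itv/= => r1 /set_mem; rewrite /= !in_itv/= andbT.
  by move=> s20 /set_mem; rewrite /= !in_itv/= andbT ltr_norml.
rewrite (tonelli5 mf f0) /reduced_mass.
have inner s1 s2 rho : \int[mu]_m1 \int[mu]_m2 f m1 m2 s1 s2 rho =
    ((\1_(`](-1)%R, 1%R[%classic : set R) rho *
  \1_(`]0%R, +oo[%classic : set R) s2 * \1_(`]0%R, +oo[%classic : set R) s1 *
  (mass_const * (\1_I rho * reduced_density (N := N) a b (s11 x) (s12 x) (s22 x) s1 s2 rho)))%R)%:E.
  have mg : measurable_fun [set: mR * mR] (fun p : mR * mR =>
      (phi (std2 p.1 p.2 s1 s2 rho (y1, y2)) * phi (std1 p.1 s1 (y1, y2)))%:E).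
    apply/measurable_EFinP; rewrite /std1 /std2 /std1.
    by apply: measurable_funM; apply: (measurableT_comp mphi); meas.
  have g0 m1 m2 : 0 <= (phi (std2 m1 m2 s1 s2 rho (y1, y2)) * phi (std1 m1 s1 (y1, y2)))%:E.
    by rewrite lee_fin mulr_ge0// ltW.
  transitivity ((A s1 s2 rho)%:E * \int[mu]_m1 \int[mu]_m2
      (phi (std2 m1 m2 s1 s2 rho (y1, y2)) * phi (std1 m1 s1 (y1, y2)))%:E).
    rewrite -ge0_integralZl; last 4 first.
    - exact: measurableT.
    - by apply: measurable_tonelli; [exact: mg|].
    - by move=> m1 _; exact: integral_ge0.
    - by rewrite lee_fin.
    apply: eq_integral => m1 _; rewrite -ge0_integralZl; last 4 first.
    - exact: measurableT.
    - exact: (measurable_fun_pair2 m1 mg).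
    - by move=> m2 _; exact: g0.
    - by rewrite lee_fin.
    by [].
  rewrite /A !indicE.
  have [r1|] := boolP (rho \in _); last by rewrite !mul0r mul0e.
  have [s20|] := boolP (s2 \in _); last by rewrite mulr0 !mul0r mul0e.
  have [s10|] := boolP (s1 \in _); last by rewrite mulr0 !mul0r mul0e.
  move: r1 s20 s10 => /set_mem; rewrite /= !in_itv/= => r1 /set_mem; rewrite /= !in_itv/= andbT.
  move=> s20 /set_mem; rewrite /= !in_itv/= andbT => s10.
  rewrite integral_means// -EFinM; congr (_%:E); rewrite /mass_const.
  have := sqrt_onem_sqr_gt0 r1; move: (Num.sqrt (1 - _)) => t t0.
  move: (reduced_density _ _ _ _ _ _ _ _) (normal_peak 1) (G) => ? ? ?.
  by field; rewrite !gt_eqF.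
apply: integral_support => rho r1; last first.
  rewrite integral0_eq// => s2 _; rewrite integral0_eq// => s1 _.
  by rewrite inner indicE (negbTE r1) !mul0r.
apply: integral_support => s2 s20; last first.
  rewrite integral0_eq// => s1 _.
  by rewrite inner !indicE (negbTE s20) mulr0 !mul0r.
apply: integral_support => s1 s10; rewrite inner; last first.
  by rewrite !indicE (negbTE s10) mulr0 mul0r.
by rewrite 3!{1}indicE r1 s20 s10 !mulr1n !mul1r.
Qed.

End posterior_mass.

Section iterated_scaling.
Local Open Scope ereal_scope.
Context {R : realType}.
Local Notation mu := (@lebesgue_measure R).
Local Notation mR := (measurableTypeR R).
Variables (D1 D2 D3 : set mR) (f : mR -> mR -> mR -> R).
Hypotheses (mD1 : measurable D1) (mD2 : measurable D2) (mD3 : measurable D3).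
Hypothesis mf : measurable_fun [set: mR * mR * mR] (fun p => f p.1.1 p.1.2 p.2).
Hypothesis f0 : forall x y z, (0 <= f x y z)%R.

Let mfE : measurable_fun [set: mR * mR * mR] (fun p => (f p.1.1 p.1.2 p.2)%:E).
Proof. exact/measurable_EFinP. Qed.

Lemma measurable_integral3_2 :
  measurable_fun [set: mR * mR] (fun p => \int[mu]_(z in D3) (f p.1 p.2 z)%:E).
Proof.
apply: (@measurable_tonelliD _ _ (mR * mR)%type mR R mu
  (fun (p : mR * mR) z => (f p.1 p.2 z)%:E) D3 mD3); first exact: mfE.
by move=> p z; rewrite lee_fin.
Qed.

Lemma measurable_integral3_1 :
  measurable_fun [set: mR] (fun x => \int[mu]_(y in D2) \int[mu]_(z in D3) (f x y z)%:E).
Proof.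
apply: (@measurable_tonelliD _ _ mR mR R mu
  (fun x y => \int[mu]_(z in D3) (f x y z)%:E) D2 mD2); first exact: measurable_integral3_2.
by move=> x y; apply: integral_ge0 => z _; rewrite lee_fin.
Qed.

Lemma ge0_integralZl3 (c : R) : (0 <= c)%R ->
  \int[mu]_(x in D1) \int[mu]_(y in D2) \int[mu]_(z in D3) (c * f x y z)%:E =
  c%:E * \int[mu]_(x in D1) \int[mu]_(y in D2) \int[mu]_(z in D3) (f x y z)%:E.
Proof.
move=> c0; have mf2 := measurable_integral3_2; have mf1 := measurable_integral3_1.
have i0 x y : 0 <= \int[mu]_(z in D3) (f x y z)%:E.
  by apply: integral_ge0 => z _; rewrite lee_fin.
rewrite -ge0_integralZl; last 4 first.
- exact: mD1.
- exact: measurable_funTS.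
- by move=> x _; apply: integral_ge0 => y _.
- by rewrite lee_fin.
apply: eq_integral => x _; rewrite -ge0_integralZl; last 4 first.
- exact: mD2.
- by apply: measurable_funTS; exact: (measurable_fun_pair2 x mf2).
- by move=> y _.
- by rewrite lee_fin.
apply: eq_integral => y _; rewrite -ge0_integralZl; last 4 first.
- exact: mD3.
- by apply: measurable_funTS; exact: (measurable_fun_pair2 (x, y) mfE).
- by move=> z _; rewrite lee_fin.
- by rewrite lee_fin.
by apply: eq_integral => z _; rewrite EFinM.
Qed.

End iterated_scaling.

Section substitution_identity.
Context {R : realType} {N : nat}.
Local Notation n := N.+1.
Variables (a b : R).

Lemma expR_powR (x p : R) : expR x `^ p = expR (p * x).
Proof. by rewrite /powR gt_eqF ?expR_gt0// expRK. Qed.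

Lemma ex_expR (x : R) : 0 < x -> exists y, x = expR y.
Proof. by move=> x0; exists (ln x); rewrite lnK// posrE. Qed.

(* Substituting s1 = al / u, s2 = be q / w and rho = psi y, where al and be are
   the root sums of squares, turns the exponent into
   - (u^2 + (u y - r w)^2 + (1 - r^2) w^2) / 2, and all powers of 1 - rho^2 cancel. *)
Lemma reduced_density_subst (al be r u w y : R) (q := Num.sqrt (1 + y ^+ 2)) :
  0 < al -> 0 < be -> 0 < u -> 0 < w ->
  reduced_density (N := N) a b (al ^+ 2) (r * al * be) (be ^+ 2)
    (al / u) (be * q / w) (psi y) * (al / u ^+ 2) * (be * q / w ^+ 2) * (q ^+ 3)^-1 =
  al `^ (a - n%:R - 1) * be `^ (b - n%:R) *
  (u `^ (n%:R - a) * w `^ (n%:R - b - 1) *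
   expR (- ((u ^+ 2 + (r * w - u * y) ^+ 2 + (1 - r ^+ 2) * w ^+ 2) / 2))).
Proof.
move=> al0 be0 u0 w0.
have q0 : 0 < q by exact: sqrt1_sqr_gt0.
have q2 : q ^+ 2 = 1 + y ^+ 2 by exact: sqr_sqrt1_sqr.
have tE : 1 - psi y ^+ 2 = q ^- 2 by rewrite onem_psi_sqr.
have stE : Num.sqrt (1 - psi y ^+ 2) = q^-1.
  by rewrite tE -exprVn sqrtr_sqr gtr0_norm// invr_gt0.
rewrite /reduced_density stE tE /psi -/q.
have -> : ((al ^+ 2 / (al / u) ^+ 2 - 2 * (y / q) * (r * al * be) / (al / u * (be * q / w)) +
    be ^+ 2 / (be * q / w) ^+ 2) / q ^- 2 / 2) =
    (u ^+ 2 + (r * w - u * y) ^+ 2 + (1 - r ^+ 2) * w ^+ 2) / 2.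
  (* Replacing [q ^+ 2] by [1 + y ^+ 2] then allows completing the square in [r w - u y]. *)
  transitivity ((u ^+ 2 * q ^+ 2 - 2 * y * r * u * w + w ^+ 2) / 2).
    by field; rewrite !gt_eqF.
  by rewrite q2; field.
move: (expR _) => e.
(* Once all positive quantities are exponentials, the identity between real powers is a linear
   identity between exponents. *)
have [A ->] := ex_expR al0; have [B ->] := ex_expR be0; have [U ->] := ex_expR u0.
have [W ->] := ex_expR w0; have [Q ->] := ex_expR q0.
rewrite -!expRM_natl -!expRN -!expRD !expR_powR -?expRN -!expRD -!expRN.
rewrite !(mulrAC _ e) -!expRD mulrA -!expRD; congr (expR _ * e).
have -> : n%:R = N%:R + 1 :> R by rewrite natr1.
by field.
Qed.

End substitution_identity.

Section reduced_mass_law.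
Local Open Scope ereal_scope.
Context {R : realType} {N : nat}.
Local Notation n := N.+1.
Local Notation mu := (@lebesgue_measure R).
Local Notation mR := (measurableTypeR R).
Local Notation gamma := (@normal_prob R 0 1).
Local Notation pos := (`]0%R, +oo[%classic : set mR).
Variables (a b : R).

(** The unnormalised joint density of [v], [u], [z], chi with [n - b] and [n - a] degrees of freedom
    and normal, on the event that [psi] of [(- z + k v) / u], that is of [Y*], lies in [I]. *)
Definition chi_weight3 (I : set R) (k v u z : R) : R :=
  (\1_I (psi ((- 1 * z + k * v) / u)) *
   (u `^ (n%:R - a - 1) * expR (- (u ^+ 2 / 2)) * (v `^ (n%:R - b - 1) * expR (- (v ^+ 2 / 2))) *
    expR (- (z ^+ 2 / 2))))%R.

Lemma chi_weight3_ge0 I k v u z : (0 <= chi_weight3 I k v u z)%R.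
Proof. by rewrite !mulr_ge0 ?expR_ge0 ?powR_ge0. Qed.

Lemma measurable_psi_comp dT (T : measurableType dT) (f : T -> R) :
  measurable_fun [set: T] f -> measurable_fun [set: T] (fun w => psi (f w)).
Proof. by move=> mf; rewrite /psi; meas. Qed.

Lemma measurable_chi_weight3 I k : measurable I ->
  measurable_fun [set: mR * mR * mR] (fun p => chi_weight3 I k p.1.1 p.1.2 p.2).
Proof.
move=> mI; rewrite /chi_weight3; apply: measurable_funM.
  by apply: (measurable_indic_comp mI); apply: measurable_psi_comp; meas.
by meas; try by []; apply: measurable_powR_comp; meas.
Qed.

Definition chi_integral3 (I : set R) (k : R) : \bar R :=
  \int[mu]_(v in pos) \int[mu]_(u in pos) \int[mu]_z (chi_weight3 I k v u z)%:E.

(** The point is that [c] does not depend on [I], so it cancels against the total mass. Besides the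
    changes of variable that decouple the density, a last scaling [v = ka w] with [ka] the root of
    [1 - r ^ 2] is needed to give the chi variable unit scale; it is the source of
    [r / Num.sqrt (1 - r ^+ 2)]. *)
Lemma reduced_massE (S11 S12 S22 : R) (r := (S12 / Num.sqrt (S11 * S22))%R) :
  (0 < S11)%R -> (0 < S22)%R -> (-1 < r < 1)%R ->
  exists2 c : R, (0 < c)%R & forall I, measurable I ->
    reduced_mass (N := N) a b I S11 S12 S22 = c%:E * chi_integral3 I (r / Num.sqrt (1 - r ^+ 2)).
Proof.
move=> S110 S220 r1.
pose al := Num.sqrt S11; pose be := Num.sqrt S22.
have al0 : (0 < al)%R by rewrite sqrtr_gt0.
have be0 : (0 < be)%R by rewrite sqrtr_gt0.
have S11E : S11 = (al ^+ 2)%R by rewrite sqr_sqrtr// ltW.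
have S22E : S22 = (be ^+ 2)%R by rewrite sqr_sqrtr// ltW.
have S12E : S12 = (r * al * be)%R.
  by rewrite -mulrA /r /al /be -sqrtrM ?(ltW S110)// divfK// gt_eqF// sqrtr_gt0 mulr_gt0.
pose ka := Num.sqrt (1 - r ^+ 2).
have ka0 : (0 < ka)%R by exact: sqrt_onem_sqr_gt0.
have ka2 : (ka ^+ 2 = 1 - r ^+ 2)%R by exact: sqr_sqrt_onem_sqr.
pose p := (n%:R - b - 1)%R.
have [K [K0 KE]] : exists K : R, (0 < K)%R /\ @mass_const R N = K.
  by exists (@mass_const R N); split; [exact: mass_const_gt0|].
have [c1 [c10 c1E]] : exists c1, (0 < c1)%R /\
    c1 = (K * (al `^ (a - n%:R - 1) * be `^ (b - n%:R)))%R.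
  exists (K * (al `^ (a - n%:R - 1) * be `^ (b - n%:R)))%R; split=> //.
  by rewrite !mulr_gt0 ?powR_gt0.
(* [c1] gathers the constants of the first substitutions; [ka^-1] is the Jacobian of [v = ka w], and
   the other power of [ka] comes from rewriting [w] to the power [p] in terms of [v]. *)
exists (ka^-1 * (c1 * ka `^ (- p)))%R.
  by rewrite mulr_gt0 ?invr_gt0// mulr_gt0// powR_gt0.
move=> I mI; rewrite /reduced_mass KE.
pose h rho s2 s1 := (K * (\1_I rho * reduced_density (N := N) a b S11 S12 S22 s1 s2 rho))%R.
have h0 rho s2 s1 : (0 <= h rho s2 s1)%R.
  apply: mulr_ge0; [exact: ltW|apply: mulr_ge0; [by rewrite indicE|exact: reduced_density_ge0]].
have mh : measurable_fun [set: mR * mR * mR] (fun q => h q.1.1 q.1.2 q.2).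
  apply: measurable_funM; first exact: measurable_cst.
  apply: measurable_funM; first by apply: (measurable_indic_comp mI); meas.
  by apply: measurable_reduced_density; meas.
have mpos : measurable pos by exact: measurable_itv.
pose q (y : R) := Num.sqrt (1 + y ^+ 2)%R.
have q0 y : (0 < q y)%R by exact: sqrt1_sqr_gt0.
pose ex (y w u : R) := (u ^+ 2 + (r * w - u * y) ^+ 2 + (1 - r ^+ 2) * w ^+ 2)%R.
pose g y w u := (c1 * (\1_I (psi y) * (u `^ (n%:R - a) * w `^ p * expR (- (ex y w u / 2)))))%R.
have g0 y w u : (0 <= g y w u)%R by rewrite !mulr_ge0 ?expR_ge0 ?powR_ge0// ltW.
have mg : measurable_fun [set: mR * mR * mR] (fun t => g t.1.1 t.1.2 t.2).
  apply: measurable_funM; first exact: measurable_cst.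
  apply: measurable_funM.
    by apply: (measurable_indic_comp mI); apply: measurable_psi_comp; meas.
  by rewrite /ex; meas; try by []; apply: measurable_powR_comp; meas.
transitivity (\int[mu]_y \int[mu]_(w in pos) \int[mu]_(u in pos) (g y w u)%:E).
  (* The correlation is substituted first because the scale [be * q y] used for [s2] depends on
     [y]. *)
  rewrite -(ge0_integral_psi (g := fun rho => \int[mu]_(s2 in pos) \int[mu]_(s1 in pos) (h rho s2 s1)%:E)); last 2 first.
  - exact: (measurable_integral3_1 mpos mpos mh h0).
  - by move=> rho; apply: integral_ge0 => s2 _; apply: integral_ge0 => s1 _; rewrite lee_fin.
  apply: eq_integral => y _; rewrite -/(q y).
  have kq0 : (0 < be * q y)%R by rewrite mulr_gt0.
  have mh2 : measurable_fun [set: mR] (fun s2 => \int[mu]_(s1 in pos) (h (psi y) s2 s1)%:E).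
    exact: (measurable_fun_pair2 (psi y : mR) (measurable_integral3_2 mpos mh h0)).
  have h20 s2 : 0 <= \int[mu]_(s1 in pos) (h (psi y) s2 s1)%:E.
    by apply: integral_ge0 => s1 _; rewrite lee_fin.
  rewrite -(ge0_integral_inv kq0 mh2 h20) -ge0_integralZr; last 4 first.
  - exact: mpos.
  - apply: measurable_funTS; apply: emeasurable_funM.
      have mk : measurable_fun [set: mR] (fun x : mR => be * q y / x)%R.
        by meas; exact: measurable_inv.
      exact: (measurableT_comp mh2 mk).
    by apply/measurable_EFinP; meas.
  - by move=> w w0; rewrite mule_ge0// lee_fin divr_ge0 ?sqr_ge0// ltW.
  - by rewrite lee_fin invr_ge0 exprn_ge0// ltW.
  apply: eq_integral => w; rewrite inE/= in_itv/= andbT => w0.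
  have mh1 : measurable_fun [set: mR] (fun s1 => (h (psi y) (be * q y / w) s1)%:E).
    apply/measurable_EFinP.
    exact: (measurable_fun_pair2 ((psi y, be * q y / w) : mR * mR)%R mh).
  have h10 s1 : 0 <= (h (psi y) (be * q y / w) s1)%:E by rewrite lee_fin.
  rewrite -(ge0_integral_inv al0 mh1 h10) -muleA -EFinM -ge0_integralZr; last 4 first.
  - exact: mpos.
  - apply: measurable_funTS; apply: emeasurable_funM.
      have mk : measurable_fun [set: mR] (fun x : mR => al / x)%R.
        by meas; exact: measurable_inv.
      exact: (measurableT_comp mh1 mk).
    by apply/measurable_EFinP; meas.
  - by move=> u _; rewrite mule_ge0// lee_fin divr_ge0 ?sqr_ge0// ltW.
  - by rewrite lee_fin mulr_ge0 ?invr_ge0 ?exprn_ge0 ?divr_ge0 ?sqr_ge0 ?ltW.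
  apply: eq_integral => u; rewrite inE/= in_itv/= andbT => u0.
  rewrite -!EFinM; congr (_%:E).
  have := reduced_density_subst (N := N) a b r y al0 be0 u0 w0.
  rewrite -/(q y) -S11E -S12E -S22E -/p -/(ex y w u) /h /g c1E.
  set rd := reduced_density _ _ _ _ _ _ _ _ => rdE.
  transitivity (K * \1_I (psi y) * (rd * (al / u ^+ 2) * (be * q y / w ^+ 2) / q y ^+ 3))%R.
    by ring.
  by rewrite rdE; ring.
have mgyw : measurable_fun [set: mR * mR] (fun t => \int[mu]_(u in pos) (g t.1 t.2 u)%:E).
  exact: (measurable_integral3_2 mpos mg g0).
(* The integral over [y] moves innermost, since [z = r w - u y] replaces [y] at fixed [w] and
   [u]. *)
rewrite (tonelli_swapD mu mu measurableT mpos mgyw); last first.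
  by move=> y w; apply: integral_ge0 => u _; rewrite lee_fin.
pose G w u z := (c1 * (\1_I (psi ((r * w - z) / u)) *
  (u `^ (n%:R - a - 1) * w `^ p * expR (- ((u ^+ 2 + z ^+ 2 + (1 - r ^+ 2) * w ^+ 2) / 2)))))%R.
have G0 w u z : (0 <= G w u z)%R by rewrite !mulr_ge0 ?expR_ge0 ?powR_ge0// ltW.
have mG : measurable_fun [set: mR * mR * mR] (fun t => G t.1.1 t.1.2 t.2).
  apply: measurable_funM; first exact: measurable_cst.
  apply: measurable_funM.
    by apply: (measurable_indic_comp mI); apply: measurable_psi_comp; meas.
  by meas; try by []; apply: measurable_powR_comp; meas.
transitivity (\int[mu]_(w in pos) \int[mu]_(u in pos) \int[mu]_z (G w u z)%:E).
  apply: eq_integral => w _.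
  have mgw : measurable_fun [set: mR * mR] (fun t => (g t.1 w t.2)%:E).
    apply/measurable_EFinP.
    apply: (measurableT_comp mg (_ : measurable_fun _ (fun t : mR * mR => (t.1, w, t.2)))).
    by meas.
  rewrite (tonelli_swapD mu mu measurableT mpos mgw); last by move=> y u; rewrite lee_fin.
  apply: eq_integral => u; rewrite inE/= in_itv/= andbT => u0.
  have un0 : (- u != 0)%R by rewrite oppr_eq0 gt_eqF.
  (* The factor [u] compensates the Jacobian of [z = r w - u y]; it is taken from the power [n - a]
     of [u], leaving [n - a - 1]. *)
  pose H z := (u%:E * (G w u z)%:E).
  have mGz : measurable_fun [set: R] (fun z => (G w u z)%:E).
    apply/measurable_EFinP.
    exact: (measurable_fun_pair2 ((w, u) : mR * mR)%R mG).
  have mH : measurable_fun [set: R] H.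
    by apply: emeasurable_funM => //; exact: measurable_cst.
  have H0 z : 0 <= H z by rewrite mule_ge0// lee_fin// ltW.
  transitivity (\int[mu]_y H (- u * y + r * w)%R).
    apply: eq_integral => y _; rewrite /H /G /g /ex -EFinM; congr (_%:E).
    have -> : ((r * w - (- u * y + r * w)) / u = y)%R by field; rewrite gt_eqF.
    have -> : ((- u * y + r * w) = (r * w - u * y))%R by ring.
    have -> : (u `^ (n%:R - a) = u * u `^ (n%:R - a - 1))%R.
      rewrite -[X in (_ = X * _)%R](powRr1 (ltW u0)) -powRD; last by rewrite (gt_eqF u0) implybT.
      by congr (_ `^ _)%R; ring.
    by ring.
  rewrite (ge0_integral_affine _ un0 mH H0) normrN gtr0_norm// /H ge0_integralZl; last 4 first.
  - exact: measurableT.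
  - exact: mGz.
  - by move=> z _; rewrite lee_fin.
  - by rewrite lee_fin ltW.
  by rewrite muleA -EFinM mulVf ?mul1e// gt_eqF.
pose k := (r / ka)%R.
pose M v := \int[mu]_(u in pos) \int[mu]_z ((c1 * ka `^ (- p)) * chi_weight3 I k v u z)%:E.
have cp0 : (0 <= c1 * ka `^ (- p))%R by rewrite mulr_ge0 ?powR_ge0// ltW.
have mcw : measurable_fun [set: mR * mR * mR]
    (fun t => (c1 * ka `^ (- p)) * chi_weight3 I k t.1.1 t.1.2 t.2)%R.
  by apply: measurable_funM; [exact: measurable_cst|exact: measurable_chi_weight3].
have cw0 v u z : (0 <= (c1 * ka `^ (- p)) * chi_weight3 I k v u z)%R.
  by rewrite mulr_ge0// chi_weight3_ge0.
have mM : measurable_fun [set: R] M by exact: (measurable_integral3_1 mpos measurableT mcw cw0).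
have M0 v : 0 <= M v.
  by apply: integral_ge0 => u _; apply: integral_ge0 => z _; rewrite lee_fin.
transitivity (\int[mu]_(w in pos) M (ka * w)%R).
  apply: eq_integral => w; rewrite inE/= in_itv/= andbT => w0.
  rewrite /M; apply: eq_integral => u _; apply: eq_integral => z _; congr (_%:E).
  rewrite /G /chi_weight3 -/p -ka2.
  have -> : (- 1 * z + k * (ka * w) = r * w - z)%R by rewrite /k; field; rewrite gt_eqF.
  have -> : ((ka * w) `^ p = ka `^ p * w `^ p)%R by rewrite powRM// ltW.
  have -> : (- ((u ^+ 2 + z ^+ 2 + ka ^+ 2 * w ^+ 2) / 2) =
    - (u ^+ 2 / 2) + - (z ^+ 2 / 2) + - ((ka * w) ^+ 2 / 2))%R by field.
  rewrite !expRD; move: (expR _) (expR _) (expR _) => e1 e2 e3.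
  rewrite powRN; have := powR_gt0 p ka0; move: (ka `^ p)%R => kp kp0.
  by field; rewrite gt_eqF.
rewrite (ge0_integral_itv0y_scale ka0 mM M0) /M.
rewrite (@ge0_integralZl3 R pos pos setT (fun v u z => chi_weight3 I k v u z)
  mpos mpos measurableT (measurable_chi_weight3 k mI)); last 2 first.
- by move=> *; exact: chi_weight3_ge0.
- exact: cp0.
by rewrite muleA -EFinM.
Qed.

Lemma triple_chi_integral3 (m1 m2 : probability mR R) (k1 k2 k : R) :
  has_chi_density m1 (n%:R - b - 1) k1 -> has_chi_density m2 (n%:R - a - 1) k2 ->
  exists2 c : R, (0 < c)%R & forall I, measurable I ->
    (m1 \x (m2 \x gamma)) [set p | I (psi (ratio (- 1) k p))] = c%:E * chi_integral3 I k.
Proof.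
move=> [k10 m1E] [k20 m2E].
have pk0 : (0 < normal_peak 1 :> R)%R by rewrite normal_peak_gt0// oner_eq0.
exists (k1 * (k2 * normal_peak 1))%R; first by rewrite !mulr_gt0.
move=> I mI.
have mpos : measurable pos by exact: measurable_itv.
have mC : measurable [set p : mR * (mR * mR) | I (psi (ratio (- 1) k p))].
  by apply: (measurable_preimageT _ mI); apply: measurable_psi_comp; exact: measurable_ratio.
pose w (q u : R) := (u `^ q * expR (- (u ^+ 2 / 2)))%R.
have w0 q u : (0 <= w q u)%R := chi_weight_ge0 q u.
have mw q : measurable_fun [set: mR] (fun u => (w q u)%:E).
  by apply/measurable_EFinP; exact: measurable_chi_weight.
rewrite tripleE m1E; last 2 first.
- exact: measurable_triple_inner.
- by move=> u; exact: integral_ge0.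
rewrite /chi_integral3 -(@ge0_integralZl3 R pos pos setT (fun v u z => chi_weight3 I k v u z)
  mpos mpos measurableT (measurable_chi_weight3 k mI)); last 2 first.
- by move=> *; exact: chi_weight3_ge0.
- by rewrite !mulr_ge0// ltW.
rewrite -ge0_integralZl; last 4 first.
- exact: mpos.
- apply: measurable_funTS; apply: emeasurable_funM; last exact: mw.
  exact: measurable_triple_inner.
- by move=> v _; apply: mule_ge0; [exact: integral_ge0|rewrite lee_fin; exact: w0].
- by rewrite lee_fin ltW.
apply: eq_integral => v _; rewrite -/(w _ v).
rewrite m2E; last 2 first.
- by apply: measurable_fun_xsection; exact: measurable_xsection.
- by [].
have cw0 : (0 <= k1 * (k2 * w (n%:R - b - 1) v))%R.
  by apply: mulr_ge0; [exact: ltW|apply: mulr_ge0; [exact: ltW|exact: w0]].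
have reorder (x y z : R) (e : \bar R) : x%:E * (y%:E * e * z%:E) = (x * (y * z))%:E * e.
  by rewrite (muleAC y%:E) muleA !EFinM.
rewrite reorder -ge0_integralZl; last 4 first.
- exact: mpos.
- apply: measurable_funTS; apply: emeasurable_funM; last exact: mw.
  by apply: measurable_fun_xsection; exact: measurable_xsection.
- by move=> u _; apply: mule_ge0; [by []|rewrite lee_fin; exact: w0].
- by rewrite lee_fin; exact: cw0.
apply: eq_integral => u _; rewrite -/(w _ u) xsection_xsection.
set X := [set z | _].
have mX : measurable X.
  by rewrite /X -xsection_xsection; apply: measurable_xsection; exact: measurable_xsection.
have mIX : measurable_fun [set: R] (fun z : R => (\1_X z : R)%:E).
  by apply/measurable_EFinP; exact: measurable_indic.
have -> : gamma X = \int[mu]_z ((\1_X z)%:E * (normal_pdf 0 1 z)%:E).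
  by rewrite -(integral_gamma mIX)// -[X in gamma X]setIT -integral_indic.
rewrite muleCA -EFinM muleC -ge0_integralZl; last 4 first.
- exact: measurableT.
- by apply: emeasurable_funM; [exact: mIX|apply/measurable_EFinP; exact: measurable_normal_pdf].
- by move=> z _; rewrite mule_ge0// lee_fin normal_pdf_ge0.
- by rewrite lee_fin; apply: mulr_ge0; [exact: cw0|exact: w0].
apply: eq_integral => z _; rewrite -!EFinM; congr (_%:E).
rewrite normal_pdf01E /chi_weight3 -/(w _ u) -/(w _ v).
have -> : \1_X z = \1_I (psi ((- 1 * z + k * v) / u)) :> R.
  by rewrite !indicE; congr (nat_of_bool _)%:R; apply/idP/idP => /set_mem/= h; exact/mem_set.
by ring.
Qed.

End reduced_mass_law.

Section psi_order.
Context {R : realType}.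

Lemma psi_ltP (x y : R) : (psi x < psi y) = (x < y).
Proof.
move: x y; apply: leW_mono; apply: le_mono => x y xy.
have cpsi : continuous (@psi R).
  move=> z; apply: differentiable_continuous; apply/derivable1_diffP.
  by have [] := is_derive_psi z.
have [|c _ /eqP] := @MVT R (@psi R) (@dpsi R) x y xy (fun z _ => is_derive_psi z).
  exact: continuous_subspaceT.
rewrite subr_eq => /eqP ->; rewrite ltrDr mulr_gt0 ?subr_gt0// /dpsi.
by rewrite invr_gt0 exprn_gt0// sqrt1_sqr_gt0.
Qed.

Lemma psi_leP (x y : R) : (psi x <= psi y) = (x <= y).
Proof. by rewrite !leNgt psi_ltP. Qed.

Lemma lt_psi (r y : R) : -1 < r < 1 -> (r < psi y) = (psi_inv r < y).
Proof. by move=> r1; rewrite -{1}[r]psi_invK ?psi_ltP// in_itv. Qed.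

Lemma psi_le (r y : R) : -1 < r < 1 -> (psi y <= r) = (y <= psi_inv r).
Proof. by move=> r1; rewrite -{1}[r]psi_invK ?psi_leP// in_itv. Qed.

Lemma inf_ge_set (x : R) : inf [set t | x <= t] = x.
Proof.
apply/eqP; rewrite eq_le; apply/andP; split.
  by apply: ge_inf => /=; [exists x => y|].
by apply: lb_le_inf; [exists x => /=|move=> y].
Qed.

(** The infimum runs over all reals, while [psi_inv] inverts [psi] only between -1 and 1. At or
    below -1 the probability is 0 and at or above 1 it is 1, so both sides still agree there. *)
Lemma quantile_psi d (T : measurableType d) (Q : probability T R) (W : T -> R) (beta : R) :
  measurable_fun [set: T] W -> 0 < beta < 1 ->
  quantile Q (fun w => psi (W w)) beta = psi (quantile Q W beta).
Proof.
move=> mW b01; have /andP[b0 b1] := b01.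
rewrite -[RHS]inf_ge_set; congr inf; rewrite predeqE => t.
suff -> : [set w | (beta%:E <= Q [set u | (psi (W u) <= w)%R])%E] t =
    (psi (quantile Q W beta) <= t) :> Prop by [].
rewrite /=; congr is_true; have [t1|t1] := leP t (-1).
  rewrite (_ : [set u | _] = set0) ?measure0; last first.
    rewrite predeqE => w; split => //= h; have := psi_itv (W w).
    by rewrite in_itv/= ltNge (le_trans h).
  have := psi_itv (quantile Q W beta); rewrite in_itv/= => /andP[h _].
  by rewrite lee_fin !leNgt b0 (le_lt_trans t1 h).
have [t2|t2] := leP 1 t.
  rewrite (_ : [set u | _] = setT) ?probability_setT; last first.
    rewrite predeqE => w; split => //= _; have := psi_itv (W w).
    by rewrite in_itv/= => /andP[_ /ltW] /le_trans; apply.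
  have := psi_itv (quantile Q W beta); rewrite in_itv/= => /andP[_ /ltW h].
  by rewrite lee_fin (ltW b1) (le_trans h).
rewrite psi_le ?t1// (quantile_le Q mW b01).
by under eq_set do rewrite psi_le ?t1//.
Qed.

End psi_order.

Section null_sets.
Local Open Scope ereal_scope.
Context {R : realType} d (T : measurableType d) (P : probability T R).

Lemma prob_setI1 (A D : set T) : measurable A -> measurable D -> P D = 1 ->
  P A = P (A `&` D).
Proof.
move=> mA mD PD; rewrite -[in LHS](setUIDK A D) measureU; last 3 first.
- exact: measurableI.
- exact: measurableD.
- by rewrite predeqE => w; split => //= -[[_ ?] []].
rewrite [X in _ + X](_ : _ = 0) ?adde0//; apply/eqP.
rewrite eq_le measure_ge0 andbT; apply: (@le_trans _ _ (P (~` D))).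
  by apply: le_measure; rewrite ?inE; [exact: measurableD|exact: measurableC|move=> w []].
by rewrite probability_setC// PD subee.
Qed.

Lemma prob_eq_on (A B D : set T) : measurable A -> measurable B -> measurable D -> P D = 1 ->
  (forall w, D w -> A w <-> B w) -> P A = P B.
Proof.
move=> mA mB mD PD AB; rewrite (prob_setI1 mA mD PD) (prob_setI1 mB mD PD); congr (P _).
by rewrite predeqE => w; split => -[h /[dup] Dw /AB e]; split => //; apply/e.
Qed.

End null_sets.

(** * Measurability of the posterior quantile *)

Section measurable_quantile.
Context {R : realType} d (T : measurableType d).

(** As [C] is increasing, [rho] lies below the infimum exactly when some rational above [rho] fails
    to be in the set, a countable union. Where [C h] fails the set is empty and its [inf] is 0 by
    convention, so that part contributes all or nothing according to the sign of [rho]. *)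
Lemma measurable_lt_inf (C : R -> set T) (l h rho : R) :
  (forall t, measurable (C t)) -> (forall s t, s <= t -> C s `<=` C t) ->
  (forall t, t <= l -> C t = set0) -> (forall t, C t `<=` C h) ->
  measurable [set w | rho < inf [set t | C t w]].
Proof.
move=> mC Cm Cl Ch.
rewrite (_ : [set w | _] =
  (C h `&` \bigcup_(q : rat) (if rho < ratr q then ~` C (ratr q) else set0)) `|`
  (~` C h `&` (if rho < 0 then setT else set0))).
  apply: measurableU; apply: measurableI => //; last by case: ifP.
    by apply: bigcupT_measurable_rat => q; case: ifP => // _; exact: measurableC.
  exact: measurableC.
rewrite predeqE => w; have [Chw|nCh] := pselect (C h w); last first.
  have S0 : [set t | C t w] = set0 by rewrite predeqE => t; split => // /Ch.
  rewrite /= S0 inf0; split=> [r0|[[]//|[_]]]; first by right; split => //; rewrite r0.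
  by case: ifP.
have S0 : [set t | C t w] !=set0 by exists h.
have Sl : has_lbound [set t | C t w].
  exists l => t /= Ct; rewrite leNgt; apply/negP => tl.
  by move: Ct; rewrite (Cl _ (ltW tl)).
split=> /= [rS|].
  left; split => //; have [q] := rat_in_itvoo rS; rewrite in_itv/= => /andP[rq qS].
  exists q => //; rewrite rq => /= Cq; have := ge_inf Sl Cq.
  by rewrite leNgt qS.
case=> [[_ [q _]]|[]//]; case: ifP => // rq /= nCq.
apply: (lt_le_trans rq); apply: lb_le_inf => // t /= Ct.
by rewrite leNgt; apply/negP => /ltW tq; apply: nCq; exact: (Cm _ _ tq).
Qed.

Lemma measurable_reduced_mass (N : nat) (a b : R) (I : set R) (f1 f2 f3 : T -> measurableTypeR R) :
  measurable I -> measurable_fun [set: T] f1 -> measurable_fun [set: T] f2 ->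
  measurable_fun [set: T] f3 ->
  measurable_fun [set: T] (fun w => reduced_mass (N := N) a b I (f1 w) (f2 w) (f3 w)).
Proof.
move=> mI mf1 mf2 mf3; rewrite /reduced_mass.
pose mR := measurableTypeR R.
pose K := @mass_const R N.
have K0 : 0 <= K by rewrite ltW// mass_const_gt0.
pose h (w : T) (rho s2 s1 : mR) : \bar R := (K * (\1_I rho *
  reduced_density (N := N) a b (f1 w) (f2 w) (f3 w) s1 s2 rho))%:E.
have h0 w rho s2 s1 : (0 <= h w rho s2 s1)%E.
  rewrite lee_fin; apply: mulr_ge0; first exact: K0.
  by apply: mulr_ge0; [rewrite indicE|exact: reduced_density_ge0].
have mh : measurable_fun [set: T * mR * mR * mR] (fun p => h p.1.1.1 p.1.1.2 p.1.2 p.2).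
  apply/measurable_EFinP; apply: measurable_funM; first exact: measurable_cst.
  apply: measurable_funM; first by apply: (measurable_indic_comp mI); meas.
  by apply: measurable_reduced_density; try (by meas);
    [apply: (measurableT_comp mf1)|apply: (measurableT_comp mf2)|apply: (measurableT_comp mf3)]; meas.
have mpos : measurable (`]0, +oo[ : set mR) by exact: measurable_itv.
apply: (@measurable_tonelliD _ _ T mR R lebesgue_measure (fun w rho =>
  (\int[lebesgue_measure]_(s2 in `]0%R, +oo[) \int[lebesgue_measure]_(s1 in `]0%R, +oo[) h w rho s2 s1)%E)).
- exact: measurable_itv.
- apply: (@measurable_tonelliD _ _ (T * mR)%type mR R lebesgue_measure (fun (p : T * mR) s2 =>
    (\int[lebesgue_measure]_(s1 in `]0%R, +oo[) h p.1 p.2 s2 s1)%E) _ mpos).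
    apply: (@measurable_tonelliD _ _ (T * mR * mR)%type mR R lebesgue_measure
      (fun (p : T * mR * mR) s1 => h p.1.1 p.1.2 p.2 s1) _ mpos).
      exact: mh.
    by move=> p s1; exact: h0.
  by move=> p s2; apply: integral_ge0 => s1 _; exact: h0.
- by move=> w rho; apply: integral_ge0 => s2 _; apply: integral_ge0 => s1 _; exact: h0.
Qed.

End measurable_quantile.

(* Recall that [x / 0] is [x * +oo] and [x / +oo] is [0] in [\bar R]. *)
Lemma le_mass_ratio {R : realType} (beta : R) (x M : \bar R) : 0 < beta ->
  (0 <= x)%E -> (x <= M)%E ->
  (beta%:E <= x / M)%E <-> [/\ (0 < M)%E, (M < +oo)%E & (beta%:E * M <= x)%E].
Proof.
move=> b0; move: M => [M| |] x0 xM.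
- have M0 : 0 <= M by rewrite -lee_fin (le_trans x0).
  have [M00|Mn0] := eqVneq M 0.
    have -> : x = 0%E by apply/eqP; rewrite eq_le x0 -[X in (_ <= X%:E)%E]M00 xM.
    by rewrite mul0e lee_fin leNgt b0 M00 ltxx; split => // -[].
  have Mp : 0 < M by rewrite lt_neqAle eq_sym Mn0.
  move: x x0 xM => [x| |]// x0 xM.
  rewrite inver (negbTE Mn0) -!EFinM !lee_fin lte_fin Mp ltry ler_pdivlMr//.
  by split => [|[]].
- by rewrite invey mule0 lee_fin leNgt b0 ltxx; split => // -[].
- by move: (le_trans x0 xM).
Qed.

(** The quotient is cleared through [le_mass_ratio], leaving comparisons of measurable functions.
    The bounds -1 and 1 are those of a correlation: no mass lies below -1 and all of it lies below
    1. *)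
Lemma measurable_lt_inf_ratio {R : realType} d (T : measurableType d) (m : R -> T -> \bar R)
    (M : T -> \bar R) (rho beta : R) : 0 < beta ->
  (forall t, measurable_fun [set: T] (m t)) -> measurable_fun [set: T] M ->
  (forall t w, (0 <= m t w)%E) -> (forall t w, (m t w <= M w)%E) ->
  (forall s t w, s <= t -> (m s w <= m t w)%E) ->
  (forall t w, t <= - 1 -> m t w = 0%E) -> (forall t w, (m t w <= m 1%R w)%E) ->
  measurable [set w | rho < inf [set t | (beta%:E <= m t w / M w)%E]].
Proof.
move=> b0 mm mM m0 mMle mle ml mh.
have E t w := le_mass_ratio b0 (m0 t w) (mMle t w).
apply: (@measurable_lt_inf _ _ _ (fun t => [set w | (beta%:E <= m t w / M w)%E]) (- 1) 1).
- move=> t; rewrite (_ : [set w | _] = [set w | (0 < M w)%E] `&` ([set w | (M w < +oo)%E] `&`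
      [set w | (beta%:E * M w <= m t w)%E])); last first.
    by rewrite predeqE => w; split => /= [/E[]//|[? [? ?]]]; exact/E.
  apply: measurableI; last apply: measurableI.
  + by rewrite -[X in measurable X]setTI; apply: measurable_lte => //; exact: measurable_cst.
  + by rewrite -[X in measurable X]setTI; apply: measurable_lte => //; exact: measurable_cst.
  + rewrite -[X in measurable X]setTI; apply: measurable_lee => //.
    by apply: emeasurable_funM => //; exact: measurable_cst.
- move=> s t st w /= /E [? ? h]; apply/E; split => //; exact: (le_trans h (mle _ _ _ st)).
- move=> t t1; rewrite predeqE => w; split => // /E [M0 _].
  by rewrite ml// leNgt mule_gt0// lte_fin.
- by move=> t w /= /E [? ? h]; apply/E; split => //; exact: (le_trans h).
Qed.

(** * The posterior law of the correlation *)

Section posterior_law.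
Local Open Scope ereal_scope.
Context {R : realType} {N : nat}.
Local Notation n := N.+1.
Local Notation mu := (@lebesgue_measure R).
Local Notation mR := (measurableTypeR R).
Local Notation gamma := (@normal_prob R 0 1).
Variables (a b : R).

(** The posterior mass and the law of [psi] of [Y*] are both multiples of [chi_integral3], with
    factors independent of [I]. Taking the whole space for [I] evaluates the total mass and
    normalises the quotient. *)
Lemma posterior_rhoE (mb ma : probability mR R) (kb ka : R) (x : 'I_n -> R * R)
    (I : set R) (r := scorr x) :
  has_chi_density mb (n%:R - b - 1) kb -> has_chi_density ma (n%:R - a - 1) ka ->
  (0 < s11 x)%R -> (0 < s22 x)%R -> (-1 < r < 1)%R -> measurable I ->
  posterior a b x [set th | I th.2] =
  (mb \x (ma \x gamma)) [set p | I (psi (ratio (- 1) (r / Num.sqrt (1 - r ^+ 2)) p))].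
Proof.
move=> mbE maE s110 s220 r1 mI.
have [c c0 cE] := reduced_massE (N := N) a b s110 s220 r1.
have [c' c'0 c'E] := triple_chi_integral3 (r / Num.sqrt (1 - r ^+ 2)) mbE maE.
have massE J : measurable J -> posterior_mass a b x [set th | J th.2] = (c / c')%:E *
    (mb \x (ma \x gamma)) [set p | J (psi (ratio (- 1) (r / Num.sqrt (1 - r ^+ 2)) p))].
  move=> mJ; rewrite posterior_massE// cE// c'E// muleA -EFinM divfK//.
  by rewrite gt_eqF.
have massT : posterior_mass a b x setT = (c / c')%:E.
  rewrite -[RHS]mule1 -(probability_setT (mb \x (ma \x gamma) : probability (mR * (mR * mR))%type R)).
  exact: (massE setT measurableT).
have cc0 : (0 < c / c')%R by rewrite divr_gt0.
rewrite /posterior massE// massT muleAC inver gt_eqF// -EFinM divff ?mul1e//.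
by rewrite gt_eqF.
Qed.

Lemma reduced_mass_ge0 I (S11 S12 S22 : R) : 0 <= reduced_mass (N := N) a b I S11 S12 S22.
Proof.
apply: integral_ge0 => rho _; apply: integral_ge0 => s2 _; apply: integral_ge0 => s1 _.
rewrite lee_fin; apply: mulr_ge0; first by rewrite ltW// mass_const_gt0.
by apply: mulr_ge0; [rewrite indicE|exact: reduced_density_ge0].
Qed.

Lemma eq_reduced_mass I J (S11 S12 S22 : R) :
  (forall rho : R, (-1 < rho < 1)%R -> I rho <-> J rho) ->
  reduced_mass (N := N) a b I S11 S12 S22 = reduced_mass (N := N) a b J S11 S12 S22.
Proof.
move=> IJ; apply: eq_integral => rho; rewrite inE/= in_itv/= => r1.
apply: eq_integral => s2 _; apply: eq_integral => s1 _; congr (mass_const * (_ * _))%:E.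
by rewrite !indicE; congr (nat_of_bool _)%:R; apply/idP/idP => /set_mem/(IJ _ r1) ?; exact/mem_set.
Qed.

Lemma reduced_mass0 (S11 S12 S22 : R) : reduced_mass (N := N) a b set0 S11 S12 S22 = 0.
Proof.
apply: integral0_eq => rho _; apply: integral0_eq => s2 _; apply: integral0_eq => s1 _.
by rewrite indic0 mul0r mulr0.
Qed.

Lemma le_reduced_mass I J (S11 S12 S22 : R) : measurable I -> measurable J -> I `<=` J ->
  reduced_mass (N := N) a b I S11 S12 S22 <= reduced_mass (N := N) a b J S11 S12 S22.
Proof.
move=> mI mJ IJ.
have K0 : (0 <= @mass_const R N)%R by rewrite ltW// mass_const_gt0.
pose h L rho s2 s1 := (@mass_const R N * (\1_L rho *
  reduced_density (N := N) a b S11 S12 S22 s1 s2 rho))%R.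
have h0 L rho s2 s1 : (0 <= h L rho s2 s1)%R.
  apply: mulr_ge0; first exact: K0.
  by apply: mulr_ge0; [rewrite indicE|exact: reduced_density_ge0].
have mh (L : set R) : measurable L ->
    measurable_fun [set: mR * mR * mR] (fun q => h L q.1.1 q.1.2 q.2).
  move=> mL; apply: measurable_funM; first exact: measurable_cst.
  apply: measurable_funM; first by apply: (measurable_indic_comp mL); meas.
  by apply: measurable_reduced_density; meas.
have mpos : measurable (`]0%R, +oo[ : set mR) by exact: measurable_itv.
apply: ge0_le_integral.
- exact: measurable_itv.
- by move=> rho _; apply: integral_ge0 => s2 _; apply: integral_ge0 => s1 _; rewrite lee_fin; exact: (h0 I).
- apply: measurable_funTS; exact: (measurable_integral3_1 mpos mpos (mh I mI) (h0 I)).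
- apply: measurable_funTS; exact: (measurable_integral3_1 mpos mpos (mh J mJ) (h0 J)).
move=> rho _; apply: ge0_le_integral.
- exact: mpos.
- by move=> s2 _; apply: integral_ge0 => s1 _; rewrite lee_fin; exact: (h0 I).
- apply: measurable_funTS.
  exact: (measurable_fun_pair2 (rho : mR) (measurable_integral3_2 mpos (mh I mI) (h0 I))).
- apply: measurable_funTS.
  exact: (measurable_fun_pair2 (rho : mR) (measurable_integral3_2 mpos (mh J mJ) (h0 J))).
move=> s2 _; apply: ge0_le_integral.
- exact: mpos.
- by move=> s1 _; rewrite lee_fin; exact: (h0 I).
- apply: measurable_funTS; apply/measurable_EFinP.
  exact: (measurable_fun_pair2 ((rho, s2) : mR * mR)%type (mh I mI)).
- apply: measurable_funTS; apply/measurable_EFinP.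
  exact: (measurable_fun_pair2 ((rho, s2) : mR * mR)%type (mh J mJ)).
move=> s1 _; rewrite lee_fin; apply: ler_wpM2l; first exact: K0.
apply: ler_wpM2r; first exact: reduced_density_ge0.
rewrite !indicE ler_nat; case: (boolP (rho \in I)) => // /set_mem/IJ Jr.
by rewrite mem_set.
Qed.

(** It holds for every sample, with no nondegeneracy condition, as is required to discard a null set
    in the computation of the coverage. The data enter through [s11], [s12] and [s22] alone. *)
Lemma measurable_rho_lt_quantile d (T : measurableType d) (X : 'I_n -> T -> R * R) (rho beta : R) :
  (0 < beta)%R ->
  measurable_fun [set: T] (fun w => s11 (X^~ w) : mR) ->
  measurable_fun [set: T] (fun w => s12 (X^~ w) : mR) ->
  measurable_fun [set: T] (fun w => s22 (X^~ w) : mR) ->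
  measurable [set w | (rho < rho_posterior_quantile a b (X^~ w) beta)%R].
Proof.
move=> b0 m11 m12 m22.
pose It (t : R) : set R := [set y | (y <= t)%R].
have mIt t : measurable (It t) := measurable_le_set (@measurable_id _ _ setT) t.
pose m t w := reduced_mass (N := N) a b (It t) (s11 (X^~ w)) (s12 (X^~ w)) (s22 (X^~ w)).
pose M w := reduced_mass (N := N) a b setT (s11 (X^~ w)) (s12 (X^~ w)) (s22 (X^~ w)).
have mm t : measurable_fun [set: T] (m t) by exact: measurable_reduced_mass.
have mM : measurable_fun [set: T] M by exact: measurable_reduced_mass.
have m0 t w : 0 <= m t w by exact: reduced_mass_ge0.
have mMle t w : m t w <= M w by apply: le_reduced_mass.
pose C (t : R) : set T := [set w | beta%:E <= m t w / M w].
have CE w t : C t w = (beta%:E <= posterior a b (X^~ w) [set th | (th.2 <= t)%R]) :> Prop.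
  have h1 : posterior_mass a b (X^~ w) [set th | (th.2 <= t)%R] = m t w.
    exact: (posterior_massE a b (X^~ w) (mIt t)).
  have h2 : posterior_mass a b (X^~ w) setT = M w by exact: (posterior_massE a b (X^~ w) measurableT).
  by rewrite /C /posterior h1 h2.
rewrite (_ : [set w | _] = [set w | (rho < inf [set t | C t w])%R]); last first.
  rewrite predeqE => w; rewrite /rho_posterior_quantile /quantile.
  have SE : [set t | C t w] = [set t | beta%:E <= posterior a b (X^~ w) [set th | (th.2 <= t)%R]].
    by apply/funext => t; exact: CE.
  by rewrite /= SE; split=> h; exact: h.
apply: measurable_lt_inf_ratio; [exact: b0|exact: mm|exact: mM|exact: m0|exact: mMle| | |].
- by move=> s t w st; apply: le_reduced_mass; [exact: mIt|exact: mIt|move=> y /= /le_trans; exact].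
- move=> t w t1; rewrite /m -[RHS](reduced_mass0 (s11 (X^~ w)) (s12 (X^~ w)) (s22 (X^~ w))).
  apply: eq_reduced_mass => y /andP[y1 _]; split=> [yt|[]].
  by move: (lt_le_trans y1 (le_trans yt t1)); rewrite ltxx.
- move=> t w; rewrite [leRHS](_ : _ = M w); first exact: mMle.
  by apply: eq_reduced_mass => y /andP[_ /ltW y1]; split.
Qed.

End posterior_law.

(** * Coverage *)

Lemma triple_unique {R : realType} (m1 m2 m1' m2' : probability (measurableTypeR R) R)
    (p1 p2 k1 k2 k1' k2' : R) (C : set _) :
  has_chi_density m1 p1 k1 -> has_chi_density m1' p1 k1' ->
  has_chi_density m2 p2 k2 -> has_chi_density m2' p2 k2' -> measurable C ->
  (m1 \x (m2 \x @normal_prob R 0 1))%E C = (m1' \x (m2' \x @normal_prob R 0 1))%E C.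
Proof.
move=> m1E m1E' m2E m2E' mC.
have [k1E _] := has_chi_density_unique m1E m1E'.
have [k2E _] := has_chi_density_unique m2E m2E'.
have [_ I1] := m1E; have [_ I1'] := m1E'; have [_ I2] := m2E; have [_ I2'] := m2E'.
rewrite !tripleE I1; last 2 first.
- exact: measurable_triple_inner.
- by move=> u; exact: integral_ge0.
rewrite I1'; last 2 first.
- exact: measurable_triple_inner.
- by move=> u; exact: integral_ge0.
rewrite k1E; congr (_ * _)%E; apply: eq_integral => u _; congr (_ * _)%E.
rewrite I2; last 2 first.
- by apply: measurable_fun_xsection; exact: measurable_xsection.
- by [].
rewrite I2'; last 2 first.
- by apply: measurable_fun_xsection; exact: measurable_xsection.
- by [].
by rewrite k2E.
Qed.

Lemma measurable_pos_pair {R : realType} :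
  measurable [set p : measurableTypeR R * (measurableTypeR R * measurableTypeR R) |
    0 < p.1 /\ 0 < p.2.1].
Proof.
rewrite (_ : [set p | _] = `]0, +oo[ `*` (`]0, +oo[ `*` setT)).
  by apply: measurableX; [exact: measurable_itv|apply: measurableX => //; exact: measurable_itv].
by rewrite predeqE => -[u [v z]]; rewrite /= !in_itv/= !andbT; split => [[? ?]|[? [? _]]].
Qed.

Lemma triple_pos {R : realType} (m1 m2 : probability (measurableTypeR R) R) (p1 p2 k1 k2 : R) :
  has_chi_density m1 p1 k1 -> has_chi_density m2 p2 k2 ->
  (m1 \x (m2 \x @normal_prob R 0 1))%E [set p | 0 < p.1 /\ 0 < p.2.1] = 1%E.
Proof.
move=> m1E m2E; have mD := @measurable_pos_pair R.
rewrite tripleE (has_chi_density_integral m1E); last 2 first.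
- exact: measurable_triple_inner.
- by move=> u; exact: integral_ge0.
rewrite -[RHS](has_chi_density_itv m1E) -[RHS]mul1e -integral_cst; last exact: measurable_itv.
apply: eq_integral => u; rewrite inE/= in_itv/= andbT => u0.
rewrite (has_chi_density_integral m2E); last 2 first.
- by apply: measurable_fun_xsection; exact: measurable_xsection.
- by [].
rewrite -[RHS](has_chi_density_itv m2E) -[RHS]mul1e -integral_cst; last exact: measurable_itv.
apply: eq_integral => v; rewrite inE/= in_itv/= andbT => v0.
rewrite xsection_xsection /= -[RHS](probability_setT (@normal_prob R 0 1)); congr (normal_prob _ _ _).
by rewrite predeqE => z; split.
Qed.

(** Both inequalities say that [th v + z - k u] is nonnegative: solving for [k] instead of [th]
    exchanges the two chi variables between numerator and denominator. *)
Lemma ratio_swap {R : realType} (tau th k u v z : R) : 0 < tau -> 0 < u -> 0 < v ->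
  (ratio (- 1) k (u, (v, z)) <= th) = (tau * k <= ratio tau (th * tau) (v, (u, z))).
Proof.
move=> t0 u0 v0; rewrite /ratio/= ler_pdivrMr// ler_pdivlMr//.
rewrite -subr_ge0 -[RHS]subr_ge0.
have -> : tau * z + th * tau * v - tau * k * u = tau * (th * v - (- 1 * z + k * u)) by ring.
by rewrite pmulr_rge0.
Qed.

Section coverage.
Context {R : realType} {N : nat}.
Local Notation n := N.+3.
Local Notation mR := (measurableTypeR R).
Local Notation gamma := (@normal_prob R 0 1).
Context (a b : R) (d' : measure_display) (T' : measurableType d') (Q : probability T' R)
  (Z3 C1 C2 Z3s Ca Cb : {RV Q >-> R})
  (Z3_law : has_density Q Z3 (normal_pdf 0 1))
  (C1_law : has_density Q C1 (chi2_pdf (n%:R - 1)))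
  (C2_law : has_density Q C2 (chi2_pdf (n%:R - 2)))
  (Z3s_law : has_density Q Z3s (normal_pdf 0 1))
  (Ca_law : has_density Q Ca (chi2_pdf (n%:R - a)))
  (Cb_law : has_density Q Cb (chi2_pdf (n%:R - b)))
  (indep : mutually_independent Q (tnth [tuple Z3; C1; C2; Z3s; Ca; Cb])).

Let indep3 i j k := @mutually_independent3 R _ _ Q _ _ i j k indep.

Let o0 : 'I_6 := @Ordinal 6 0 isT.
Let o1 : 'I_6 := @Ordinal 6 1 isT.
Let o2 : 'I_6 := @Ordinal 6 2 isT.
Let o3 : 'I_6 := @Ordinal 6 3 isT.
Let o4 : 'I_6 := @Ordinal 6 4 isT.
Let o5 : 'I_6 := @Ordinal 6 5 isT.

Let mRV (Y : {RV Q >-> R}) : measurable_fun [set: T'] (Y : T' -> R).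
Proof. exact: (@measurable_funPT _ _ _ _ Y). Qed.

Let msqrt (Y : {RV Q >-> R}) : measurable_fun [set: T'] (fun w => Num.sqrt (Y w)).
Proof. by apply: (measurableT_comp measurable_sqrt); exact: mRV. Qed.

Lemma measurable_ratio_comp c e (C C' Z : {RV Q >-> R}) :
  measurable_fun [set: T'] (fun w => ratio c e (Num.sqrt (C w), (Num.sqrt (C' w), Z w))).
Proof.
apply: (measurableT_comp (measurable_ratio c e)); apply: measurable_fun_pair; first exact: msqrt.
by apply: measurable_fun_pair; [exact: msqrt|exact: mRV].
Qed.

(** Both quantiles are infima over the same set, because the posterior of [rho] and the law of [psi]
    of [Y*] give equal mass to each half-line; [quantile_psi] then takes [psi] outside. *)
Lemma posterior_quantileE (x : 'I_n -> R * R) (beta : R) (r := scorr x) :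
  0 < s11 x -> 0 < s22 x -> -1 < r < 1 -> 0 < beta < 1 ->
  rho_posterior_quantile a b x beta = psi (quantile Q
    (fun w => ratio (- 1) (r / Num.sqrt (1 - r ^+ 2)) (Num.sqrt (Cb w), (Num.sqrt (Ca w), Z3s w))) beta).
Proof.
move=> s110 s220 r1 b01.
have [mb [ma [kb [ka [mbE maE QE]]]]] := chi2_triple Z3s_law Cb_law Ca_law
  (@indep3 o5 o4 o3 isT isT isT).
set k := r / _; pose Y w := ratio (- 1) k (Num.sqrt (Cb w), (Num.sqrt (Ca w), Z3s w)).
have mY : measurable_fun [set: T'] Y by exact: measurable_ratio_comp.
rewrite -/Y -(quantile_psi Q mY b01) /rho_posterior_quantile /quantile.
congr inf; apply/funext => t; rewrite /mkset; congr (is_true (_ <= _)%E).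
have mt : measurable [set y : R | y <= t] := measurable_le_set (@measurable_id _ _ setT) t.
rewrite (posterior_rhoE mbE maE s110 s220 r1 mt).
exact: (esym (QE _ (measurable_le_set (measurable_psi_comp (measurable_ratio (- 1) k)) t))).
Qed.

Section star.
Variable rho : R.
Hypothesis rho1 : -1 < rho < 1.
Let tau := Num.sqrt (1 - rho ^+ 2).
Let tau0 : 0 < tau. Proof. exact: sqrt_onem_sqr_gt0. Qed.

Definition star_pivot (w : T') : R := ratio tau rho (Num.sqrt (Ca w), (Num.sqrt (Cb w), Z3s w)).
Definition pivot (w : T') : R := ratio tau rho (Num.sqrt (C1 w), (Num.sqrt (C2 w), Z3 w)).

Lemma measurable_star_pivot : measurable_fun [set: T'] star_pivot.
Proof. exact: measurable_ratio_comp. Qed.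

Lemma measurable_pivot : measurable_fun [set: T'] pivot.
Proof. exact: measurable_ratio_comp. Qed.

Lemma star_pivot_law : exists (ma mb : probability mR R) (ka kb : R),
  [/\ has_chi_density ma (n%:R - a - 1) ka, has_chi_density mb (n%:R - b - 1) kb &
   forall D, measurable D -> Q [set w | D (Num.sqrt (Ca w), (Num.sqrt (Cb w), Z3s w))] =
     (ma \x (mb \x gamma))%E D].
Proof. exact: (chi2_triple Z3s_law Ca_law Cb_law (@indep3 o4 o5 o3 isT isT isT)). Qed.

Lemma pivot_law : exists (m1 m2 : probability mR R) (k1 k2 : R),
  [/\ has_chi_density m1 N.+1%:R k1, has_chi_density m2 N%:R k2 &
   forall D, measurable D -> Q [set w | D (Num.sqrt (C1 w), (Num.sqrt (C2 w), Z3 w))] =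
     (m1 \x (m2 \x gamma))%E D].
Proof.
(* The exponent of a chi density is one less than the degrees of freedom. *)
have -> : N.+1%:R = n%:R - 1 - 1 :> R by rewrite -[in RHS]addn2 natrD; ring.
have -> : N%:R = n%:R - 2 - 1 :> R by rewrite -[in RHS]addn3 natrD; ring.
exact: (chi2_triple Z3_law C1_law C2_law (@indep3 o1 o2 o0 isT isT isT)).
Qed.

Lemma star_pivot_no_atom x : Q [set w | star_pivot w = x] = 0%E.
Proof.
have [ma [mb [ka [kb [maE mbE QE]]]]] := star_pivot_law.
by rewrite [LHS](QE _ (measurable_eq_set (measurable_ratio tau rho) x)) (triple_ratio_eq _ _ _ mbE)// gt_eqF.
Qed.

Lemma star_pivot_itv_gt0 x y : x < y -> (0 < Q [set w | (x < star_pivot w < y)%R])%E.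
Proof.
move=> xy; have [ma [mb [ka [kb [maE mbE QE]]]]] := star_pivot_law.
rewrite [X in (_ < X)%E](QE _ (measurable_itv_set (measurable_ratio tau rho) x y)); apply: (triple_ratio_itv_gt0 _ _ _ mbE) => //.
by rewrite gt_eqF.
Qed.

(* The duality between the posterior of [rho] and the pivot: on [Ca, Cb > 0],
   [Y <= rho / tau] means [tau k <= W]. *)
Lemma lt_quantile_dual (k alpha : R) : 0 < alpha < 1 ->
  (psi_inv rho < quantile Q
    (fun w => ratio (- 1) k (Num.sqrt (Cb w), (Num.sqrt (Ca w), Z3s w))) (1 - alpha)) =
  (quantile Q star_pivot alpha < tau * k).
Proof.
move=> a01; have b01 : 0 < 1 - alpha < 1 by lra.
set Y := fun w => _.
have mY : measurable_fun [set: T'] Y by exact: measurable_ratio_comp.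
rewrite ltNge (quantile_le Q mY b01) (quantile_lt measurable_star_pivot a01 star_pivot_no_atom star_pivot_itv_gt0).
have -> : Q [set w | Y w <= psi_inv rho] = Q [set w | tau * k <= star_pivot w].
  have [ma [mb [ka [kb [maE mbE QE]]]]] := star_pivot_law.
  pose D := [set p : mR * (mR * mR) | 0 < p.1 /\ 0 < p.2.1].
  have mD : measurable D by exact: measurable_pos_pair.
  have QD : Q [set w | D (Num.sqrt (Ca w), (Num.sqrt (Cb w), Z3s w))] = 1%E.
    by rewrite (QE _ mD) (triple_pos maE mbE).
  apply: (prob_eq_on _ _ _ QD).
  - exact: measurable_le_set.
  - rewrite (_ : [set w | _] = ~` [set w | star_pivot w < tau * k]).
      by apply: measurableC; apply: measurable_lt_set; exact: measurable_star_pivot.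
    by rewrite predeqE => w /=; rewrite leNgt; split => /negP.
  - apply: (measurable_preimageT _ mD); apply: measurable_fun_pair; first exact: msqrt.
    by apply: measurable_fun_pair; [exact: msqrt|exact: mRV].
  - move=> w [/= ua ub]; rewrite /Y (ratio_swap _ _ _ tau0 ub ua).
    by rewrite /psi_inv -/tau divfK ?gt_eqF.
rewrite (_ : [set w | tau * k <= star_pivot w] = ~` [set w | star_pivot w < tau * k]); last first.
  by rewrite predeqE => w /=; rewrite leNgt; split => /negP.
have mlt := measurable_lt_set measurable_star_pivot (tau * k).
rewrite probability_setC// (prob_lt_le measurable_star_pivot star_pivot_no_atom).
have mle := measurable_le_set measurable_star_pivot (tau * k).
rewrite (prE Q mle) -EFinB !lee_fin lte_fin -ltNge.
by apply/idP/idP; lra.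
Qed.

Section sampling.
Context dT (T : measurableType dT) (P : probability T R).
Variables (X : 'I_n -> {mfun T >-> (R * R)%type}) (m1 m2 s1 s2 : R).
Hypotheses (s10 : 0 < s1) (s20 : 0 < s2).
Hypothesis X_iid : iid_sample P X (m1, m2, s1, s2, rho).

Local Notation A := (stA X m1 m2 s1 s2 rho).
Local Notation B := (stB X m1 m2 s1 s2 rho).
Local Notation t := (stt X m1 m2 s1 s2 rho).

Let mA : measurable_fun [set: T] A. Proof. exact: measurable_stA. Qed.
Let mB : measurable_fun [set: T] B. Proof. exact: measurable_stB. Qed.
Let mt : measurable_fun [set: T] t. Proof. exact: measurable_stt. Qed.

Lemma st_triple : exists (M1 M2 : probability mR R) (k1 k2 : R),
  [/\ has_chi_density M1 N.+1%:R k1, has_chi_density M2 N%:R k2 &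
   forall D, measurable D -> P [set w | D (A w, (B w, t w))] = (M1 \x (M2 \x gamma))%E D].
Proof.
have [k1 k1E] := @has_chi_density_iter_hyp R N.
have [k2 k2E] := @has_chi_density_chi_law R N.
exists (iter N.+1 (@hyp_law R) gamma), (chi_law N.+1), k1, k2; split; [exact: k1E|exact: k2E|].
apply: triple_prob => // e f g me mf mg.
apply: (prob_transfer (st_law s10 s20 rho1 X_iid me mf mg)); first by setac.
by ring.
Qed.

(** Almost surely [A] and [B] are positive; the sample is then nondegenerate and [scorr] is
    [psi y0], where [tau * y0] is the pivot formed from [A], [B], [t]. By the duality the coverage
    event says that this pivot exceeds the starred quantile, and [(A, (B, t))] has the joint law of
    the auxiliary triple. *)
Lemma coverageE (alpha : R) : 0 < alpha < 1 ->
  P [set w | rho < rho_posterior_quantile a b (fun k => X k w) (1 - alpha)] =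
  Q [set w | quantile Q star_pivot alpha < pivot w].
Proof.
move=> a01; have b01 : 0 < 1 - alpha < 1 by lra.
have [M1 [M2 [k1 [k2 [M1E M2E PE]]]]] := st_triple.
have [M1' [M2' [k1' [k2' [M1E' M2E' QE]]]]] := pivot_law.
set q := quantile Q star_pivot alpha.
have mC := measurable_gt_set (measurable_ratio tau rho) q.
rewrite [RHS](QE _ mC) -(triple_unique M1E M1E' M2E M2E' mC) -[RHS](PE _ mC).
have mAtB : measurable_fun [set: T] (fun w => (A w, (B w, t w))).
  by apply: measurable_fun_pair => //; exact: measurable_fun_pair.
pose D := [set p : mR * (mR * mR) | 0 < p.1 /\ 0 < p.2.1].
have mD : measurable D by exact: measurable_pos_pair.
have PD : P [set w | D (A w, (B w, t w))] = 1%E by rewrite (PE _ mD) (triple_pos M1E M2E).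
have sE w := s_stE X m1 m2 s10 s20 rho1 w.
apply: (prob_eq_on _ _ _ PD).
- apply: (@measurable_rho_lt_quantile R N.+2 a b _ T (fun k w => X k w)); first by lra.
  + rewrite (_ : (fun w => _) = fun w => s1 ^+ 2 * A w ^+ 2); first by meas; exact: mA.
    by apply/funext => w; have [] := sE w.
  + rewrite (_ : (fun w => _) = fun w => s1 * s2 * A w * (rho * A w + tau * t w)).
      by meas; [exact: mA|exact: mA|exact: mt].
    by apply/funext => w; have [] := sE w.
  + rewrite (_ : (fun w => _) = fun w =>
        s2 ^+ 2 * ((rho * A w + tau * t w) ^+ 2 + (tau * B w) ^+ 2)).
      by meas; [exact: mA|exact: mt|exact: mB].
    by apply/funext => w; have [] := sE w.
- exact: (measurable_preimageT mAtB mC).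
- exact: (measurable_preimageT mAtB mD).
move=> w [/= Aw Bw]; have [e11 e12 e22] := sE w.
pose x k := X k w; rewrite -/x.
pose h := rho * A w + tau * t w; pose y0 := h / (tau * B w).
have tB0 : 0 < tau * B w by rewrite mulr_gt0.
have s110 : 0 < s11 x by rewrite /x e11 mulr_gt0 ?exprn_gt0.
have s220 : 0 < s22 x.
  by rewrite /x e22 mulr_gt0 ?exprn_gt0// ltr_wpDl ?sqr_ge0// exprn_gt0.
have rE : scorr x = psi y0.
  rewrite /scorr /x e11 e12 e22 -/tau -/h.
  have -> : s1 ^+ 2 * A w ^+ 2 * (s2 ^+ 2 * (h ^+ 2 + (tau * B w) ^+ 2)) =
      (s1 * s2 * A w * (tau * B w)) ^+ 2 * (1 + y0 ^+ 2).
    by rewrite /y0; field; rewrite !gt_eqF.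
  rewrite sqrtrM ?sqr_ge0// sqrtr_sqr gtr0_norm ?mulr_gt0// /psi /y0.
  have := sqrt1_sqr_gt0 (h / (tau * B w)); move: (Num.sqrt (1 + _)) => s s0.
  by field; rewrite !gt_eqF.
have r1 : -1 < scorr x < 1 by have := psi_itv y0; rewrite rE in_itv.
rewrite (posterior_quantileE s110 s220 r1 b01) lt_psi//.
rewrite (lt_quantile_dual _ a01) -/(psi_inv _) rE psiK.
have -> : tau * y0 = ratio tau rho (A w, (B w, t w)).
  by rewrite /ratio/= /y0 /h; field; rewrite !gt_eqF.
by split.
Qed.

End sampling.

End star.

Lemma pivot_gtE rho g : Q [set w | g < pivot rho w] = (1 - Q [set w | (pivot rho w <= g)%R])%E.
Proof.
rewrite -probability_setC; last exact: (measurable_le_set (measurable_pivot rho)).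
by congr (Q _); rewrite predeqE => w /=; rewrite ltNge; split => /negP.
Qed.

Lemma pivot_law_le rho g : exists (m1 m2 : probability mR R) (k1 k2 : R),
  [/\ has_chi_density m1 N.+1%:R k1, has_chi_density m2 N%:R k2 &
    Q [set w | pivot rho w <= g] =
    (m1 \x (m2 \x gamma))%E [set p | ratio (Num.sqrt (1 - rho ^+ 2)) rho p <= g]].
Proof.
have [m1 [m2 [k1 [k2 [m1E m2E QE]]]]] := pivot_law.
exists m1, m2, k1, k2; split; [exact: m1E|exact: m2E|].
exact: (QE _ (measurable_le_set (measurable_ratio (Num.sqrt (1 - rho ^+ 2)) rho) g)).
Qed.

Lemma star_pivot_law_le rho g : exists (ma mb : probability mR R) (ka kb : R),
  [/\ has_chi_density ma (n%:R - a - 1) ka, has_chi_density mb (n%:R - b - 1) kb &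
    Q [set w | star_pivot rho w <= g] =
    (ma \x (mb \x gamma))%E [set p | ratio (Num.sqrt (1 - rho ^+ 2)) rho p <= g]].
Proof.
have [ma [mb [ka [kb [maE mbE QE]]]]] := star_pivot_law.
exists ma, mb, ka, kb; split; [exact: maE|exact: mbE|].
exact: (QE _ (measurable_le_set (measurable_ratio (Num.sqrt (1 - rho ^+ 2)) rho) g)).
Qed.

Lemma exact_coverage_iff :
  (forall alpha rho : R, 0 < alpha < 1 -> -1 < rho < 1 ->
     Q [set w | quantile Q (star_pivot rho) alpha < pivot rho w] = (1 - alpha)%:E) <->
  (a, b) = (1, 2).
Proof.
have N1 : N.+1%:R = n%:R - 1 - 1 :> R by rewrite -[in RHS]addn2 natrD; ring.
have N2 : N%:R = n%:R - 2 - 1 :> R by rewrite -[in RHS]addn3 natrD; ring.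
split=> [H|[aE bE] alpha rho a01 rho1].
  (* Any [g] is the quantile of the starred pivot at its own level, so exact coverage at that level
     equates the two distribution functions at [g]. *)
  have FE rho g : -1 < rho < 1 -> Q [set w | pivot rho w <= g] = Q [set w | star_pivot rho w <= g].
    move=> rho1; have mW := measurable_star_pivot rho.
    rewrite (prE Q (measurable_le_set mW g)).
    have := prE Q (measurable_le_set mW g).
    move=> /(quantile_prob mW (star_pivot_no_atom rho1) (star_pivot_itv_gt0 rho1)) [a01 qE].
    have := H _ _ a01 rho1; rewrite qE pivot_gtE (prE Q (measurable_le_set (measurable_pivot rho) g)).
    by move=> [] /(congr1 (fun x => 1 - x)); rewrite !subKr => ->.
  (* The laws do not depend on [rho] and [g], but each use of the existence statement yields new
     names; one choice is fixed here, with placeholder arguments, and [triple_unique] identifies the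
     others with it. *)
  have [m1 [m2 [k1 [k2 [m1E m2E _]]]]] := pivot_law_le 0 0.
  have [ma [mb [ka [kb [maE mbE _]]]]] := star_pivot_law_le 0 0.
  have tripleEq rho g : -1 < rho < 1 ->
      (m1 \x (m2 \x gamma))%E [set p | ratio (Num.sqrt (1 - rho ^+ 2)) rho p <= g] =
      (ma \x (mb \x gamma))%E [set p | ratio (Num.sqrt (1 - rho ^+ 2)) rho p <= g].
    move=> rho1; have mC := measurable_le_set (measurable_ratio (Num.sqrt (1 - rho ^+ 2)) rho) g.
    have [m1' [m2' [k1' [k2' [m1E' m2E' E1]]]]] := pivot_law_le rho g.
    have [ma' [mb' [ka' [kb' [maE' mbE' E2]]]]] := star_pivot_law_le rho g.
    rewrite (triple_unique m1E m1E' m2E m2E' mC) (triple_unique maE maE' mbE mbE' mC).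
    by rewrite -E1 -E2 FE.
  have bE : n%:R - 2 - 1 = n%:R - b - 1.
    rewrite -N2; apply: (ratio_law_inj m2E mbE) => g.
    (* At [rho = 0] the pivots are a normal variable over the chi variable of the denominator, so
       [b] is determined. *)
    have r0 : -1 < (0 : R) < 1 by lra.
    have := tripleEq 0 g r0.
    by rewrite expr0n/= subr0 sqrtr1 (triple_ratio_snd _ _ m2E) (triple_ratio_snd _ _ mbE).
  have aE : n%:R - 1 - 1 = n%:R - a - 1.
    rewrite -N1; apply: (ratio_law_inj m1E maE) => g.
    (* With [rho = psi (- g)] the threshold [- rho / tau] equals [g]: varying [rho] reaches every
       argument of the distribution function, although the pivot is only compared with 0. *)
    have r1 : -1 < psi (- g) < 1 by have := psi_itv (- g); rewrite in_itv.
    have := tripleEq (psi (- g)) 0 r1.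
    have t0 := sqrt_onem_sqr_gt0 r1.
    rewrite (triple_ratio_le0 _ t0 m1E m2E) (triple_ratio_le0 _ t0 maE mbE).
    by rewrite mulNr -/(psi_inv _) psiK opprK.
  by congr pair; lra.
have [m1 [m2 [k1 [k2 [m1E m2E FE]]]]] := pivot_law_le rho (quantile Q (star_pivot rho) alpha).
have [ma [mb [ka [kb [maE mbE FsE]]]]] := star_pivot_law_le rho (quantile Q (star_pivot rho) alpha).
rewrite aE -N1 in maE; rewrite bE -N2 in mbE.
rewrite pivot_gtE FE (triple_unique m1E maE m2E mbE (measurable_le_set (measurable_ratio (Num.sqrt (1 - rho ^+ 2)) rho) _)) -FsE.
by rewrite (prob_quantile (measurable_star_pivot rho) a01 (star_pivot_no_atom rho1) (star_pivot_itv_gt0 rho1)).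
Qed.

End coverage.

Theorem theorem2 (R : realType) (n : nat) (a b : R)
  (n_ge3 : (3 <= n)%N) (a_lt_n : a < n%:R) (b_lt_n : b < n%:R)
  (* the sampling model *)
  (d : measure_display) (T : measurableType d)
  (P : param R -> probability T R) (X : 'I_n -> {mfun T >-> (R * R)%type})
  (X_iid : forall th : param R, param_space th -> iid_sample (P th) X th)
  (* the auxiliary random variables *)
  (d' : measure_display) (T' : measurableType d') (Q : probability T' R)
  (Z3 C1 C2 Z3s Ca Cb : {RV Q >-> R})
  (Z3_law : has_density Q Z3 (normal_pdf 0 1))
  (C1_law : has_density Q C1 (chi2_pdf (n%:R - 1)))
  (C2_law : has_density Q C2 (chi2_pdf (n%:R - 2)))
  (Z3s_law : has_density Q Z3s (normal_pdf 0 1))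
  (Ca_law : has_density Q Ca (chi2_pdf (n%:R - a)))
  (Cb_law : has_density Q Cb (chi2_pdf (n%:R - b)))
  (indep : mutually_independent Q (tnth [tuple Z3; C1; C2; Z3s; Ca; Cb])) :
  [/\ (* (a) *)
      forall (x : 'I_n -> R * R) (alpha : R),
        0 < s11 x -> 0 < s22 x -> `|scorr x| < 1 -> 0 < alpha < 1 ->
        let r := scorr x in
        let Ystar w :=
          - (Z3s w / Num.sqrt (Ca w)) +
          Num.sqrt (Cb w) / Num.sqrt (Ca w) * (r / Num.sqrt (1 - r ^+ 2)) in
        rho_posterior_quantile a b x (1 - alpha) =
        psi (quantile Q Ystar (1 - alpha)),
      (* (b) *)
      forall alpha m1 m2 s1 s2 rho : R,
        0 < alpha < 1 -> 0 < s1 -> 0 < s2 -> -1 < rho < 1 ->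
        let Wstar w :=
          (Num.sqrt (1 - rho ^+ 2) * Z3s w + rho * Num.sqrt (Ca w)) /
          Num.sqrt (Cb w) in
        P (m1, m2, s1, s2, rho)
          [set w | rho <
                   rho_posterior_quantile a b (fun k => X k w) (1 - alpha)] =
        Q [set w | (Num.sqrt (1 - rho ^+ 2) * Z3 w + rho * Num.sqrt (C1 w)) /
                   Num.sqrt (C2 w) > quantile Q Wstar alpha]
    & (* (c) *)
      forall m1 m2 s1 s2 : R, 0 < s1 -> 0 < s2 ->
        (forall alpha rho : R, 0 < alpha < 1 -> -1 < rho < 1 ->
           P (m1, m2, s1, s2, rho)
             [set w | rho <
                      rho_posterior_quantile a b (fun k => X k w) (1 - alpha)] =
           (1 - alpha)%:E)
        <-> (a, b) = (1, 2) ].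
Proof.
case: n => [|[|[|N]]]// in n_ge3 a_lt_n b_lt_n X X_iid C1_law C2_law Ca_law Cb_law *.
have YE k : (fun w => - (Z3s w / Num.sqrt (Ca w)) + Num.sqrt (Cb w) / Num.sqrt (Ca w) * k) =
    (fun w => ratio (- 1) k (Num.sqrt (Cb w), (Num.sqrt (Ca w), Z3s w))).
  by apply/funext => w; rewrite /ratio/=; ring.
have covE alpha m1 m2 s1 s2 rho : 0 < alpha < 1 -> 0 < s1 -> 0 < s2 -> -1 < rho < 1 ->
    P (m1, m2, s1, s2, rho)
      [set w | rho < rho_posterior_quantile a b (fun k => X k w) (1 - alpha)] =
    Q [set w | quantile Q (star_pivot Z3s Ca Cb rho) alpha < pivot Z3 C1 C2 rho w].
  move=> a01 s10 s20 rho1.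
  apply: (coverageE Z3_law C1_law C2_law Z3s_law Ca_law Cb_law indep rho1 s10 s20 _ a01).
  by apply: X_iid; split => //; rewrite ltr_norml.
split.
- move=> x alpha s110 s220; rewrite ltr_norml => r1 a01 r Ystar.
  rewrite /Ystar YE; apply: (posterior_quantileE Z3s_law Ca_law Cb_law indep) => //.
  by lra.
- move=> alpha m1 m2 s1 s2 rho a01 s10 s20 rho1 Wstar.
  exact: covE.
- move=> m1 m2 s1 s2 s10 s20.
  rewrite -(exact_coverage_iff Z3_law C1_law C2_law Z3s_law Ca_law Cb_law indep).
  split=> H alpha rho a01 rho1; have := H alpha rho a01 rho1.
    by rewrite covE.
  by rewrite covE.
Qed.
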